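(* Let $J\ge1$, and suppose that $\max_{1\le j\le J}|y_j^\dagger|\le\kappa_y$, $\Sigma\succcurlyeq\sigma I_{d_u}$ and $\Gamma\succcurlyeq\gamma I_{d_y}$ for constants $\kappa_y,\sigma,\gamma>0$. Let $\Psi_0:\mathbb{R}^{d_u}\to\mathbb{R}^{d_u}$ and $h_0:\mathbb{R}^{d_u}\to\mathbb{R}^{d_y}$ be affine functions with $|\Psi_0(u)|\le\kappa_\Psi(1+|u|)$ and $|h_0(u)|\le\kappa_h(1+|u|)$ for all $u\in\mathbb{R}^{d_u}$, for some constants $\kappa_\Psi,\kappa_h>0$. Let $\ell_h>0$ be a constant, and let $\mu_0$ be a Gaussian probability measure on $\mathbb{R}^{d_u}$. Set $q:=2\cdot\max\{3+d_u,4+d_y\}$. Then there exists a constant $C=C\bigl(\mathcal{M}_q(\mu_0),\kappa_y,\kappa_\Psi,\kappa_h,\ell_h,\Sigma,\Gamma,J\bigr)$, depending only on the listed quantities, such that for all $\varepsilon\in[0,1]$ and all functions $(\Psi,h)\in B_{L^\infty}\bigl((\Psi_0,h_0),\varepsilon\bigr)$ with $h$ Lipschitz with constant at most $\ell_h$, the probability measures $(\mu_j)_{0\le j\le J}$ and $(\mu_j^{\mathrm{EK}})_{0\le j\le J}$ defined by $\mu_0^{\mathrm{EK}}=\mu_0$ and, for $0\le j\le J-1$, $$\mu_{j+1}=\mathsf{B}_j\mathsf{Q}\mathsf{P}\mu_j,\qquad\mu_{j+1}^{\mathrm{EK}}=\mathsf{T}_j\mathsf{Q}\mathsf{P}\mu_j^{\mathrm{EK}}$$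 (with the operators associated with $(\Psi,h)$) satisfy $$d_g(\mu_J^{\mathrm{EK}},\mu_J)\le C\varepsilon.$$
   Context: Fix positive integers $d_u,d_y$, symmetric positive definite matrices $\Sigma\in\mathbb{R}^{d_u\times d_u}$, $\Gamma\in\mathbb{R}^{d_y\times d_y}$, and (deterministic) data $y_1^\dagger,\dots,y_J^\dagger\in\mathbb{R}^{d_y}$. Functions $\Psi:\mathbb{R}^{d_u}\to\mathbb{R}^{d_u}$, $h:\mathbb{R}^{d_u}\to\mathbb{R}^{d_y}$ are Borel measurable. $|\cdot|$ is the Euclidean norm, $|x|_S:=|S^{-1/2}x|$ for $S$ symmetric positive definite, and $\preccurlyeq$ is the positive semidefinite order. $B_{L^\infty}((\Psi_0,h_0),r)$ is the set of pairs $(\Psi,h)$ with $\|\Psi-\Psi_0\|_{L^\infty}\le r$ and $\|h-h_0\|_{L^\infty}\le r$ (supremum norms). $\mathcal{P}(\mathbb{R}^n)$ is the set of Borel probability measures on $\mathbb{R}^n$; the same symbol is used for a measure and its Lebesgue density. $\mathcal{M}_q(\mu):=\int|x|^q\mu(dx)$; $\mathcal{C}(\mu)$ is the covariance of $\mu$. For $\pi\in\mathcal{P}(\mathbb{R}^{d_u}\times\mathbb{R}^{d_y})$, the law of $(u,y)$, $\mathcal{C}^{uy}(\pi),\mathcal{C}^{yy}(\pi)$ are the corresponding blocks of $\mathcal{C}(\pi)$. Weighted total variation distance: on $\mathcal{P}(\mathbb{R}^n)$, with $g(v)=1+|v|^2$, $d_g(\mu_1,\mu_2)=\sup_{|f|\le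 g}|\mu_1[f]-\mu_2[f]|$, where $\mu[f]=\int f\,d\mu$. Operators associated with $(\Psi,h)$: - $\mathsf{P}\mu(u)=\frac{1}{\sqrt{(2\pi)^{d_u}\det\Sigma}}\int\exp(-\tfrac12|u-\Psi(v)|_\Sigma^2)\,\mu(dv)$. - $\mathsf{Q}\mu(u,y)=\frac{1}{\sqrt{(2\pi)^{d_y}\det\Gamma}}\exp(-\tfrac12|y-h(u)|_\Gamma^2)\,\mu(u)$, i.e. the law of $(U,h(U)+\eta)$ with $U\sim\mu$ independent of $\eta\sim\mathcal{N}(0,\Gamma)$. - $\mathsf{B}_j\pi(u)=\pi(u,y_{j+1}^\dagger)/\int\pi(U,y_{j+1}^\dagger)\,dU$ (conditioning on $y=y_{j+1}^\dagger$). - $\mathsf{T}_j\pi$ is, for $\pi$ with finite second moment and $\mathcal{C}^{yy}(\pi)\succ0$, the pushforward of $\pi$ under the map $(u,y)\mapsto u+\mathcal{C}^{uy}(\pi)\mathcal{C}^{yy}(\pi)^{-1}(y_{j+1}^\dagger-y)$. *)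

(* Defs.v *)
From HB Require Import structures.
From mathcomp Require Import all_boot all_order all_algebra.
From mathcomp Require Import all_classical all_reals all_analysis.
From mathcomp Require Import measurable_realfun.

Set Implicit Arguments.
Unset Strict Implicit.
Unset Printing Implicit Defensive.
Import Order.TTheory GRing.Theory Num.Theory.
Import numFieldNormedType.Exports.
Local Open Scope classical_set_scope.
Local Open Scope ring_scope.

Definition borel_display : measure_display.
Proof. exact: default_measure_display. Qed.

Section borel_matrix.
Context (R : realType) (m n : nat).

Definition borel_mx : set (set 'M[R]_(m, n)) := <<s open >>.

HB.instance Definition _ := @isMeasurable.Build borel_display 'M[R]_(m, n)
  borel_mx (@sigma_algebra0 _ setT open) (@sigma_algebraC _ open)
  (@sigma_algebra_bigcup _ setT open).

Lemma measurable_coord i j :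
  measurable_fun [set: 'M[R]_(m, n)] (fun A : 'M[R]_(m, n) => A i j).
Proof.
apply: (measurability _ (RGenOInfty.measurableE R)) => _ [_ [x ->]] <-.
rewrite setTI; apply: sub_sigma_algebra.
apply: open_comp; last exact: interval_open.
by move=> A _; exact: coord_continuous.
Qed.

Let box (q : 'M[rat]_(m, n) * rat) : set 'M[R]_(m, n) :=
  [set A | forall i j, `|A i j - ratr (q.1 i j)| < ratr q.2].

Lemma open_bigcup_box (U : set 'M[R]_(m, n)) : open U ->
  U = \bigcup_(q in [set q | box q `<=` U]) box q.
Proof.
move=> oU; apply/seteqP; split=> [A UA|A [q]]; last exact.
have /nbhs_ballP[e /= e0 eU] : nbhs A U by exact: open_nbhs_nbhs.
have [r] := @rat_in_itvoo R 0 (e / 2) (divr_gt0 e0 (ltr0Sn R 1)).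
rewrite in_itv/= => /andP[r0 re].
have qP i j : {q : rat | `|A i j - ratr q| < ratr r}.
  apply/cid; have [|q] := @rat_in_itvoo R (A i j - ratr r) (A i j + ratr r).
    by rewrite ltrBlDr -addrA ltrDl addr_gt0.
  rewrite in_itv/= => /andP[q1 q2]; exists q.
  by rewrite ltr_distlC q2 andbT.
exists (\matrix_(i, j) sval (qP i j), r) => /=; last first.
  by move=> i j /=; rewrite mxE; exact: (svalP (qP i j)).
move=> B Bq; apply: eU; split=> // i j; rewrite -ball_normE/=.
rewrite (_ : A i j - B i j = (A i j - ratr (sval (qP i j))) -
   (B i j - ratr (sval (qP i j)))); last by rewrite opprB addrA subrK.
rewrite (le_lt_trans (ler_normB _ _))// (splitr e) ltrD//.
  exact: (lt_trans (svalP (qP i j))).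
by have := Bq i j; rewrite mxE /= => /lt_trans; exact.
Qed.

Lemma measurable_fun_mx d (T : measurableType d) (f : T -> 'M[R]_(m, n)) :
  (forall i j, measurable_fun setT (fun t => f t i j)) -> measurable_fun setT f.
Proof.
move=> mf.
apply: (@measurability _ _ T _ setT f (open : set (set 'M[R]_(m, n)))) => //.
move=> _ [U oU <-]; rewrite setTI (open_bigcup_box oU) preimage_bigcup.
rewrite bigcup_mkcond; apply: countable_bigcupT_measurable => // q.
case: ifPn => // _.
rewrite (_ : f @^-1` box q = \bigcap_(i in setT) \bigcap_(j in setT)
  [set t | `|f t i j - ratr (q.1 i j)| < ratr q.2]); last first.
  apply/seteqP; split => [t tq i _ j _|t tq i j]; first exact: tq.
  exact: (tq i I j I).
apply: fin_bigcap_measurable => // i _; apply: fin_bigcap_measurable => // j _.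
rewrite -[X in measurable X]setTI.
have : measurable_fun setT (fun t => `|f t i j - ratr (q.1 i j)| : R).
  by apply: measurableT_comp => //; exact: measurable_funB.
by move=> /(_ measurableT _ (measurable_itv `]-oo, ratr q.2[)); rewrite set_itvE.
Qed.

End borel_matrix.

Section sigma_finite_measures.
Local Open Scope ereal_scope.
Context d d' (T : measurableType d) (T' : measurableType d') (R : realType).

Lemma sigma_finite_pushforward (mu : {measure set T -> \bar R})
    (f : T -> T') (g : T' -> T) :
  sigma_finite setT mu -> measurable_fun setT g -> cancel f g ->
  sigma_finite setT (pushforward mu f).
Proof.
move=> [F UF oF] mg fK; exists (fun n => g @^-1` F n).
  by rewrite -preimage_bigcup -UF preimage_setT.
move=> n; have [mF Foo] := oF n; split.
  by rewrite -[X in measurable X]setTI; exact: mg.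
rewrite /pushforward -comp_preimage (_ : g \o f = idfun) ?preimage_id//.
by apply/funext => x /=; rewrite fK.
Qed.

Lemma sigma_finite_product (m1 : {sigma_finite_measure set T -> \bar R})
    (m2 : {sigma_finite_measure set T' -> \bar R}) :
  sigma_finite setT (m1 \x m2).
Proof.
have /sigma_finiteP[F [TF ndF Foo]] := sigma_finiteT m1.
have /sigma_finiteP[G [TG ndG Goo]] := sigma_finiteT m2.
exists (fun n => F n `*` G n).
  rewrite -setXTT TF TG predeqE => -[x y]; split.
    move=> [/= [n _ Fnx] [k _ Gky]]; exists (maxn n k) => //; split.
    - by move: x Fnx; exact/subsetPset/ndF/leq_maxl.
    - by move: y Gky; exact/subsetPset/ndG/leq_maxr.
  by move=> [n _ []/= ? ?]; split; exists n.
move=> k; have [? ?] := Foo k; have [? ?] := Goo k.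
split; first exact: measurableX.
by rewrite product_measure1E// lte_mul_pinfty// ge0_fin_numE.
Qed.

End sigma_finite_measures.

Section lebesgue_cV.
Context (R : realType).

Definition consv n (w : R * 'cV[R]_n) : 'cV[R]_n.+1 :=
  \col_i (if unlift ord0 i is Some j then w.2 j 0 else w.1).

Definition unconsv n (v : 'cV[R]_n.+1) : R * 'cV[R]_n :=
  (v ord0 0, \col_j v (lift ord0 j) 0).

Lemma consvK n : cancel (@consv n) (@unconsv n).
Proof.
move=> [x v]; congr pair; first by rewrite mxE unlift_none.
by apply/colP => j; rewrite !mxE liftK.
Qed.

Lemma measurable_consv n : measurable_fun setT (@consv n).
Proof.
apply: measurable_fun_mx => i j; rewrite [j]ord1; case: (unliftP ord0 i) => [k|] ->.
  rewrite (_ : (fun _ => _) = (fun v : 'cV[R]_n => v k 0) \o snd).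
    by apply: measurableT_comp; [exact: measurable_coord|exact: measurable_snd].
  by apply/funext => w /=; rewrite mxE liftK.
rewrite (_ : (fun _ => _) = fst); first exact: measurable_fst.
by apply/funext => w /=; rewrite mxE unlift_none.
Qed.

Lemma measurable_unconsv n : measurable_fun setT (@unconsv n).
Proof.
apply: measurable_fun_pair => /=; first exact: measurable_coord.
apply: measurable_fun_mx => i j; under eq_fun do rewrite mxE.
exact: measurable_coord.
Qed.

Section step.
Context (n : nat) (leb : {sigma_finite_measure set 'cV[R]_n -> \bar R}).

Definition lebesgue_step : set 'cV[R]_n.+1 -> \bar R :=
  pushforward (@lebesgue_measure R \x leb)%E (@consv n).

Let M := measure_function_pushforward__canonical__measure_function_Measure
  (@lebesgue_measure R \x leb)%E (@measurable_consv n).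

Let step0 : lebesgue_step set0 = 0%E.
Proof. exact: (@measure0 _ _ _ M). Qed.

Let step_ge0 A : (0 <= lebesgue_step A)%E.
Proof. exact: (@measure_ge0 _ _ _ M). Qed.

Let step_sigma_additive : semi_sigma_additive lebesgue_step.
Proof.
exact: (@measure_semi_sigma_additive _ _ _ M).
Qed.

HB.instance Definition _ := isMeasure.Build _ _ _ lebesgue_step
  step0 step_ge0 step_sigma_additive.

HB.instance Definition _ := Measure_isSigmaFinite.Build _ _ _ lebesgue_step
  (sigma_finite_pushforward (sigma_finite_product (@lebesgue_measure R) leb)
    (@measurable_unconsv n) (@consvK n)).

End step.

(* The n-fold product of the Lebesgue measure on R. *)
Fixpoint lebesgue_cV n : {sigma_finite_measure set 'cV[R]_n -> \bar R} :=
  if n is n'.+1 then lebesgue_step (lebesgue_cV n')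
  else dirac (0 : 'cV[R]_0).

End lebesgue_cV.

Section probability_with_density.
Context d (T : measurableType d) (R : realType).
Variable lam : {measure set T -> \bar R}.

Definition is_density (f : T -> R) :=
  [/\ measurable_fun setT f, (forall x, 0 <= f x) &
      (\int[lam]_x (f x)%:E = 1)%E].

Section bundled.
Variables (f : T -> R) (fd : is_density f).

Definition density_measure of is_density f : set T -> \bar R :=
  fun A => (\int[lam]_(x in A) (f x)%:E)%E.

Let dm0 : density_measure fd set0 = 0%E.
Proof. exact: integral_set0. Qed.

Let dm_ge0 A : (0 <= density_measure fd A)%E.
Proof. by apply: integral_ge0 => x _; rewrite lee_fin; case: fd. Qed.

Let dm_sigma_additive : semi_sigma_additive (density_measure fd).
Proof.
have [mf f0 _] := fd; apply: semi_sigma_additive_nng_induced.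
  exact/measurable_EFinP.
by move=> x; rewrite lee_fin.
Qed.

HB.instance Definition _ := isMeasure.Build _ _ _ (density_measure fd)
  dm0 dm_ge0 dm_sigma_additive.

Let dm_setT : density_measure fd setT = 1%E.
Proof. by case: fd. Qed.

HB.instance Definition _ :=
  Measure_isProbability.Build _ _ _ (density_measure fd) dm_setT.

End bundled.

(* The probability measure with density f with respect to lam; the Dirac mass
   is a default value for functions f that are not probability densities. *)
Definition density_prob (f : T -> R) : probability T R :=
  if pselect (is_density f) is left fd then density_measure fd
  else dirac (point : T).

End probability_with_density.

Section euclidean.
Context (R : realType).

(* The library norm on matrices is the maximum norm. *)
Definition enorm n (x : 'cV[R]_n) : R := Num.sqrt (\sum_i x i 0 ^+ 2).

Definition quadf n (S : 'M[R]_n) (x : 'cV[R]_n) : R := (x^T *m S *m x) 0 0.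

Definition posdefmx n (S : 'M[R]_n) :=
  S^T = S /\ forall x, x != 0 -> 0 < quadf S x.

Definition lemx n (A B : 'M[R]_n) := forall x, 0 <= quadf (B - A) x.

Definition sqrtmx n (S : 'M[R]_n) : 'M[R]_n :=
  xget 0 [set M | posdefmx M /\ M *m M = S].

Definition wnorm n (S : 'M[R]_n) (x : 'cV[R]_n) : R :=
  enorm (invmx (sqrtmx S) *m x).

Definition affine_map m n (f : 'cV[R]_m -> 'cV[R]_n) :=
  exists M b, forall x, f x = M *m x + b.

Definition elipschitz m n (k : R) (f : 'cV[R]_m -> 'cV[R]_n) :=
  forall x y, enorm (f x - f y) <= k * enorm (x - y).

Definition supnorm m n (f : 'cV[R]_m -> 'cV[R]_n) : \bar R :=
  ereal_sup [set (enorm (f x))%:E | x in setT].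

Definition linf_ball m n p
    (c : ('cV[R]_m -> 'cV[R]_n) * ('cV[R]_m -> 'cV[R]_p)) (r : R) :
    set (('cV[R]_m -> 'cV[R]_n) * ('cV[R]_m -> 'cV[R]_p)) :=
  [set f : ('cV[R]_m -> 'cV[R]_n) * ('cV[R]_m -> 'cV[R]_p) |
           (supnorm (fun u => f.1 u - c.1 u)%R <= r%:E)%E /\
           (supnorm (fun u => f.2 u - c.2 u)%R <= r%:E)%E].

End euclidean.

Section measures_on_euclidean_space.
Context (R : realType).

Definition moment n q (mu : probability 'cV[R]_n R) : \bar R :=
  (\int[mu]_x (enorm x ^+ q)%:E)%E.

(* Where f is not integrable the difference of integrals is infinite, so that
   a finite distance entails that all the integrals involved are finite. *)
Definition dist_g n (mu1 mu2 : probability 'cV[R]_n R) : \bar R :=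
  ereal_sup
    [set `| \int[mu1]_x (f x)%:E - \int[mu2]_x (f x)%:E |%E | f in
      [set f : 'cV[R]_n -> R | measurable_fun setT f /\
                               forall x, `|f x| <= 1 + enorm x ^+ 2]].

Definition gauss_pdf n (S : 'M[R]_n) (m x : 'cV[R]_n) : R :=
  (Num.sqrt ((2 * pi) ^+ n * \det S))^-1 *
  expR (- (2^-1 * wnorm S (x - m) ^+ 2)).

Definition std_gaussian n : probability 'cV[R]_n R :=
  density_prob (lebesgue_cV R n) (gauss_pdf 1%:M 0).

(* Possibly degenerate Gaussians: the covariance is L *m L^T. *)
Definition is_gaussian n (mu : probability 'cV[R]_n R) :=
  exists (L : 'M[R]_n) (m : 'cV[R]_n), forall A, measurable A ->
    mu A = pushforward (std_gaussian n) (fun x => L *m x + m) A.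

Definition covmx n m (nu : probability ('cV[R]_n * 'cV[R]_m)%type R) :
    'M[R]_(n + m) :=
  \matrix_(i, j) fine (covariance nu (fun w => col_mx w.1 w.2 i 0)
                                     (fun w => col_mx w.1 w.2 j 0)).

Definition cov_uy n m (nu : probability ('cV[R]_n * 'cV[R]_m)%type R) :
  'M[R]_(n, m) := ursubmx (covmx nu).

Definition cov_yy n m (nu : probability ('cV[R]_n * 'cV[R]_m)%type R) :
  'M[R]_m := drsubmx (covmx nu).

End measures_on_euclidean_space.

Section operators.
Context (R : realType) (du dy : nat).
Implicit Types (mu : probability 'cV[R]_du R).
Implicit Types (nu : probability ('cV[R]_du * 'cV[R]_dy)%type R).

(* The predictive, joint and conditioned laws of the filter (P, Q and B).
   As conditioning on a null event requires a specific version of the density,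
   these operators return densities; density_prob turns them into measures. *)
Definition predict_pdf (Sigma : 'M[R]_du) (Psi : 'cV[R]_du -> 'cV[R]_du) mu :
    'cV[R]_du -> R :=
  fun u => (\int[mu]_v gauss_pdf Sigma (Psi v) u)%R.

Definition joint_pdf (Gamma : 'M[R]_dy) (h : 'cV[R]_du -> 'cV[R]_dy)
    (p : 'cV[R]_du -> R) : 'cV[R]_du * 'cV[R]_dy -> R :=
  fun w => gauss_pdf Gamma (h w.1) w.2 * p w.1.

Definition condition_pdf (y : 'cV[R]_dy) (p : 'cV[R]_du * 'cV[R]_dy -> R) :
    'cV[R]_du -> R :=
  fun u => p (u, y) / (\int[lebesgue_cV R du]_v p (v, y))%R.

Definition transport_map nu (y : 'cV[R]_dy) (w : 'cV[R]_du * 'cV[R]_dy) :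
    'cV[R]_du :=
  w.1 + cov_uy nu *m invmx (cov_yy nu) *m (y - w.2).

Let measurable_transport_map nu y : measurable_fun setT (transport_map nu y).
Proof.
apply: measurable_fun_mx => i j; under eq_fun do rewrite !mxE.
apply: measurable_funD.
  exact: (measurableT_comp (measurable_coord i j) measurable_fst).
apply: measurable_sum => k; under eq_fun do rewrite !mxE.
apply: measurable_funM => //; apply: measurable_funB => //.
exact: (measurableT_comp (measurable_coord k j) measurable_snd).
Qed.

HB.instance Definition _ nu y :=
  isMeasurableFun.Build _ _ _ _ (transport_map nu y)
    (measurable_transport_map nu y).

Definition transport (y : 'cV[R]_dy) nu : probability 'cV[R]_du R :=
  distribution nu (transport_map nu y).

Variables (Sigma : 'M[R]_du) (Gamma : 'M[R]_dy).
Variables (Psi : 'cV[R]_du -> 'cV[R]_du) (h : 'cV[R]_du -> 'cV[R]_dy).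
Variables (y : nat -> 'cV[R]_dy) (mu0 : probability 'cV[R]_du R).

Definition QP_pdf mu := joint_pdf Gamma h (predict_pdf Sigma Psi mu).

Fixpoint filter_law j : probability 'cV[R]_du R :=
  if j is j'.+1 then
    density_prob (lebesgue_cV R du)
      (condition_pdf (y j'.+1) (QP_pdf (filter_law j')))
  else mu0.

Fixpoint filter_law_EK j : probability 'cV[R]_du R :=
  if j is j'.+1 then
    transport (y j'.+1)
      (density_prob (lebesgue_cV R du \x lebesgue_cV R dy)%E
        (QP_pdf (filter_law_EK j')))
  else mu0.

End operators.

(* Main.v *)
Require Import Defs.
From HB Require Import structures.
From mathcomp Require Import all_boot all_order all_algebra.
From mathcomp Require Import all_classical all_reals all_analysis.
From mathcomp Require Import measurable_realfun ring lra.
From mathcomp Require complex.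

(* Compare both filters with the exact filter [nu_j] of the affine maps
   [(Psi_0, h_0)] started at the same Gaussian [mu_0]. Its predictive laws are
   Gaussian, and on the joint law of an affine Gaussian model the transport is
   exact: the conditional law of [u] given [y] is [N(m(y), C')] with
   [m(y) = m + K (y - ybar)] and [C'] independent of [y], where [K] equals
   [C^uy (C^yy)^-1], so shifting [u] by [K (y^dag - y)] produces conditioning.

   It then suffices that both filters stay within [O(eps)] of [nu_j]. Closeness
   is measured on nonnegative functions dominated by [(1 + |x|) ^ 2] (or
   [(1 + |u| + |y|) ^ 2] for joint laws). Prediction and observation kernels are
   Gaussian with a mean perturbed by at most [eps], and the Gaussian density is
   Lipschitz in its mean. For the transport the covariances, hence the gains, are
   close because [C^yy] is coercive uniformly in the law; changing the gain from
   [K] to [K_0] amounts, after translating [u], to comparing the smooth reference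
   joint density at two nearby points. For conditioning the normalizing constant
   is bounded below in terms of the second moment. *)
Set Implicit Arguments.
Unset Strict Implicit.
Unset Printing Implicit Defensive.
Import Order.TTheory GRing.Theory Num.Theory.
Import numFieldNormedType.Exports.
Local Open Scope classical_set_scope.
Local Open Scope ring_scope.

(** * Positive definite matrices *)

(** The test functions are only measurable, so a displacement of their argument cannot be estimated.
    Every perturbation is carried instead by a Gaussian factor, which is what the two noise
    covariances provide. Nonnegative functions with values in the extended reals allow Tonelli and
    translations of the Lebesgue measure before anything is known to be finite.

    A change of gain displaces [u] by an amount proportional to [1 + |y|], and this costs two more
    powers of the weight than the test functions have. Hence the exact filter carries a fourth
    moment bound, while closeness is measured with quadratic weights only. At the start the fourth
    moment is controlled by the moment of order [q], since [q >= 4].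

    No constant may depend on the perturbed maps. Therefore the coercivity of [C^yy] is drawn from
    the observation noise alone, each estimate fixes its constant before quantifying over laws, maps
    and [eps], and the perturbed laws inherit their second moments from the exact filter through
    closeness. *)

Section posdef.
Context (R : realType).

Lemma quadfE n (S : 'M[R]_n) x : quadf S x = \sum_i \sum_j x i 0 * S i j * x j 0.
Proof.
rewrite /quadf mxE exchange_big/=; apply: eq_bigr => j _.
rewrite mxE mulr_suml; apply: eq_bigr => i _.
by rewrite mxE.
Qed.

Lemma quadf1 n (x : 'cV[R]_n) : quadf 1%:M x = \sum_i x i 0 ^+ 2.
Proof.
by rewrite /quadf mulmx1 mxE; apply: eq_bigr => i _; rewrite mxE expr2.
Qed.

Lemma sqr_enorm n (x : 'cV[R]_n) : enorm x ^+ 2 = quadf 1%:M x.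
Proof.
by rewrite quadf1 sqr_sqrtr// sumr_ge0// => i _; rewrite sqr_ge0.
Qed.

Lemma quadf_ge0 n (S : 'M[R]_n) x : posdefmx S -> 0 <= quadf S x.
Proof.
move=> [_ S0]; have [->|x0] := eqVneq x 0; last exact/ltW/S0.
by rewrite /quadf mulmx0 mxE.
Qed.

Lemma quadf0 n (S : 'M[R]_n) : quadf S 0 = 0.
Proof. by rewrite /quadf mulmx0 mxE. Qed.

Lemma quadfDl n (S T : 'M[R]_n) x : quadf (S + T) x = quadf S x + quadf T x.
Proof. by rewrite /quadf mulmxDr mulmxDl mxE. Qed.

Lemma quadf_sandwich m n (S : 'M[R]_m) (A : 'M[R]_(m, n)) x :
  quadf (A^T *m S *m A) x = quadf S (A *m x).
Proof. by rewrite /quadf trmx_mul !mulmxA. Qed.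

Lemma quadf1_gt0 n (x : 'cV[R]_n) : x != 0 -> 0 < quadf 1%:M x.
Proof.
move=> x0; rewrite lt_def -sqr_enorm sqr_ge0 andbT sqr_enorm quadf1.
apply: contra x0 => /eqP/psumr_eq0P x0; apply/eqP/colP => i.
rewrite mxE; apply/eqP; rewrite -sqrf_eq0; apply/eqP/x0 => // j _.
exact: sqr_ge0.
Qed.

Lemma posdef1 n : posdefmx (1%:M : 'M[R]_n).
Proof. by split; [rewrite trmx1|exact: quadf1_gt0]. Qed.

Lemma posdef_unit n (S : 'M[R]_n) : posdefmx S -> S \in unitmx.
Proof.
move=> [_ S0]; rewrite -row_free_unit -kermx_eq0; apply/eqP/row_matrixP => i.
rewrite row0; apply/eqP; apply: contraT => k0.
have := S0 (row i (kermx S))^T; rewrite -(inj_eq trmx_inj) trmxK trmx0 => /(_ k0).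
by rewrite /quadf trmxK -row_mul mulmx_ker row0 mul0mx mxE ltxx.
Qed.

Lemma posdef_inv n (S : 'M[R]_n) : posdefmx S -> posdefmx (invmx S).
Proof.
move=> pS; have [Ssym S0] := pS; have uS := posdef_unit pS.
have symV : (invmx S)^T = invmx S by rewrite trmx_inv Ssym.
split=> // x x0.
have /(_ (invmx S *m x)) := S0; rewrite -quadf_sandwich symV mulVmx// mul1mx.
apply; apply: contra x0 => /eqP/(congr1 (mulmx S)).
by rewrite mulKVmx// mulmx0 => ->.
Qed.

Lemma posdefD n (S T : 'M[R]_n) : posdefmx S -> T^T = T ->
  (forall x, 0 <= quadf T x) -> posdefmx (S + T).
Proof.
move=> [Ssym S0] Tsym T0; split; first by rewrite linearD/= Ssym Tsym.
by move=> x x0; rewrite quadfDl ltr_wpDr// S0.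
Qed.

Lemma posdef_scale n (S : 'M[R]_n) (a : R) : 0 < a -> posdefmx S ->
  posdefmx (a *: S).
Proof.
move=> a0 [Ssym S0]; split; first by rewrite linearZ/= Ssym.
by move=> x /S0 Sx; rewrite /quadf -scalemxAr -scalemxAl mxE mulr_gt0.
Qed.

Lemma quadfZl n (S : 'M[R]_n) a x : quadf (a *: S) x = a * quadf S x.
Proof. by rewrite /quadf -scalemxAr -scalemxAl mxE. Qed.

(** Newton interpolation: the correction for a new node is a multiple of the product that vanishes
    at the earlier nodes. *)
Lemma poly_interpolation (F : fieldType) (f : F -> F) (s : seq F) :
  exists p : {poly F}, forall x, x \in s -> p.[x] = f x.
Proof.
elim: s => [|a s [p ps]]; first by exists 0.
have [as_|as_] := boolP (a \in s).
  by exists p => x; rewrite inE => /predU1P[->|/ps//]; rewrite ps.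
pose q : {poly F} := \prod_(e <- s) ('X - e%:P).
have qa : q.[a] != 0 by rewrite -/(root q a) root_prod_XsubC.
exists (p + ((f a - p.[a]) / q.[a]) *: q) => x.
rewrite inE hornerD hornerZ => /predU1P[->|xs].
  by rewrite divfK// addrC subrK.
have /eqP-> : q.[x] == 0 by rewrite -/(root q x) root_prod_XsubC.
by rewrite mulr0 addr0 ps.
Qed.

(** Gives the symmetry of the root below, which is a polynomial in the symmetric matrix itself. *)
Lemma trmx_horner (F : fieldType) n (A : 'M[F]_n.+1) (p : {poly F}) :
  A^T = A -> (horner_mx A p)^T = horner_mx A p.
Proof.
move=> Asym; elim/poly_ind: p => [|p c ih]; first by rewrite rmorph0 trmx0.
rewrite rmorphD rmorphM/= horner_mx_X horner_mx_C linearD/= tr_scalar_mx.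
congr (_ + _); rewrite -[in LHS]mulmxE trmx_mul ih Asym.
by rewrite mulmxE -[A in A * _]horner_mx_X -rmorphM/= mulrC rmorphM/= horner_mx_X.
Qed.

Section spectral.
Import complex.
Local Open Scope complex_scope.
Local Open Scope sesquilinear_scope.

(* The eigenvalues are real and positive, so a real polynomial that sends each
   of them to its fourth root yields the required matrix. *)
Lemma posdef_quartic_root n (S : 'M[R]_n.+1) : posdefmx S ->
  exists N : 'M[R]_n.+1, N^T = N /\ (N * N) * (N * N) = S.
Proof.
move=> pS; have [Ssym Spos] := pS.
pose f : {rmorphism R -> R[i]} := real_complex R.
pose A := map_mx f S.
have Aherm : A \is hermsymmx.
  apply: realsym_hermsym.
    by apply/is_hermitianmxP; rewrite expr0 scale1r map_mx_id// map_trmx Ssym.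
  by apply/mxOverP => i j; rewrite mxE; apply/complex_realP; exists (S i j).
have /orthomx_spectralP AE := hermitian_normalmx Aherm.
have /mxOverP spR := hermitian_spectral_diag_real Aherm.
set P := spectralmx A in AE; set sp := spectral_diag A in AE spR.
have uP : P \in unitmx by exact: spectral_unit.
(* The rows of [P] are eigenvectors of the complexified matrix. The characteristic polynomial
   carries the eigenvalue [d] back to a real eigenvector of [S], on which positivity of [quadf S]
   forces [d > 0]. *)
have dP k : {d : R | sp 0 k = f d & 0 < d}.
  have /complex_realP/cid[d dE] := spR 0 k; exists d => //.
  have : eigenvalue S d.
    rewrite eigenvalue_root_char -(fmorph_root f) map_char_poly.
    rewrite -eigenvalue_root_char; apply/eigenvalueP; exists (row k P).
      rewrite -/A {1}AE -row_mul mulmxA mulmxA mulmxV// mul1mx row_mul.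
      rewrite row_diag_mx dE.
      by rewrite -scalemxAl rowE.
    apply: contraTneq uP => kP0; rewrite -row_free_unit.
    apply/negP => /row_freeP[B PB]; have /(congr1 (row k)) := PB.
    rewrite row_mul kP0 mul0mx row1 => /rowP/(_ k)/eqP.
    by rewrite !mxE !eqxx eq_sym oner_eq0.
  move=> /eigenvalueP[v vS v0].
  have v0' : v^T != 0 by rewrite -trmx0 (inj_eq trmx_inj).
  have := Spos _ v0'.
  rewrite /quadf trmxK vS -scalemxAl mxE.
  have : 0 < (v *m v^T) 0 0.
    by have := quadf1_gt0 v0'; rewrite /quadf mulmx1 trmxK.
  by move=> /pmulr_lgt0 ->.
have [p pE] := poly_interpolation (fun x => Num.sqrt (Num.sqrt x))
  [seq sval (sig_of_sig2 (dP k)) | k <- enum 'I_n.+1].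
exists (horner_mx S p); split; first exact: trmx_horner.
rewrite -!rmorphM/=; apply: (map_mx_inj (f := f)).
rewrite map_horner_mx -/A [in RHS]AE {1}AE.
suff spE : map_mx (horner (map_poly f (p * p * (p * p)))) sp = sp.
  by rewrite (horner_mx_uconjC _ _ uP) horner_mx_diag spE.
apply/rowP => k; rewrite mxE.
case E: (dP k) => [d dE d0]; rewrite dE horner_map; congr (f _).
rewrite !hornerM.
have -> : p.[d] = Num.sqrt (Num.sqrt d).
  by apply: pE; apply/mapP; exists k; rewrite ?mem_enum// E.
by rewrite -!expr2 !sqr_sqrtr// ?sqrtr_ge0 ?ltW.
Qed.

End spectral.

(** A fourth root [N] makes positivity free: [N * N] equals [N^T * N] with [N] invertible. Size 0 is
    treated apart because polynomials in a matrix require size [n.+1]. *)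
Lemma sqrtmxP n (S : 'M[R]_n) : posdefmx S ->
  posdefmx (sqrtmx S) /\ sqrtmx S *m sqrtmx S = S.
Proof.
move=> pS; rewrite /sqrtmx; case: xgetP => [M _ //|] /= /(_ _) noM.
exfalso; case: n S pS noM => [|n] S pS noM.
  apply: (noM 0); split; last by rewrite mul0mx [S]flatmx0.
  by split; [exact: trmx0|move=> x; rewrite (flatmx0 x) eqxx].
have [N [Nsym NE]] := posdef_quartic_root pS.
apply: (noM (N * N)); split => //; split.
  by rewrite -mulmxE trmx_mul Nsym.
move=> x x0; rewrite -mulmxE -{1}Nsym -[N^T]mulmx1 quadf_sandwich quadf1_gt0//.
have uN : N \in unitmx.
  have := posdef_unit pS; rewrite -NE -!mulmxE.
  by rewrite !unitmx_mul => /andP[/andP[]].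
by apply: contra x0 => /eqP/(congr1 (mulmx (invmx N))); rewrite mulKmx// mulmx0 => ->.
Qed.

Lemma sqr_wnorm n (S : 'M[R]_n) x : posdefmx S ->
  wnorm S x ^+ 2 = quadf (invmx S) x.
Proof.
move=> pS; have [pM ME] := sqrtmxP pS; have uM := posdef_unit pM.
rewrite /wnorm sqr_enorm -quadf_sandwich mulmx1; congr quadf.
rewrite trmx_inv pM.1 -[in RHS]ME; set M := sqrtmx S in uM *.
apply: (can_inj (mulKmx uM)); rewrite mulKVmx//.
apply: (can_inj (mulKmx uM)); rewrite mulmxV// mulmxA mulmxV//.
by rewrite unitmx_mul uM.
Qed.

End posdef.

(** * Gaussian integrals *)

Section lebesgue_cV.
Context (R : realType).
Local Notation mu := (@lebesgue_measure R).
Local Notation leb n := (lebesgue_cV R n).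
Local Open Scope ereal_scope.

(** Uniqueness of the Lebesgue measure: the image measure has the right values on half-open
    intervals. *)
Lemma lebesgue_measureD (a : R) (A : set R) : measurable A ->
  pushforward mu ((fun x => x + a)%R : _ -> measurableTypeR R) A = mu A.
Proof.
move=> mA.
have mf : measurable_fun setT ((fun x => x + a)%R : _ -> measurableTypeR R).
  by apply: measurable_funD.
apply/esym/lebesgue_measure_unique => //= _ [[b c]] _ <-.
transitivity (mu `](b - a)%R, (c - a)%R]%classic).
  by rewrite !lebesgue_measure_itv/= !lte_fin ltrD2r -!EFinD opprD opprK addrACA addNr addr0.
congr (mu _); apply/seteqP; split=> x /=; rewrite !in_itv/=.
  by rewrite ltrBlDr lerBrDr.
by rewrite ltrBlDr lerBrDr.
Qed.

Lemma integral_cVS n (f : 'cV[R]_n.+1 -> \bar R) : measurable_fun setT f ->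
  (forall x, 0 <= f x) ->
  \int[leb n.+1]_v f v = \int[mu]_x \int[leb n]_v f (consv (x, v)).
Proof.
move=> mf f0.
transitivity (\int[mu \x leb n]_w (f \o @consv R n) w).
  pose m : {measure set (measurableTypeR R * 'cV[R]_n)%type -> \bar R} :=
    (mu \x leb n)%E.
  have mc : measurable_fun [set: measurableTypeR R * 'cV[R]_n] (@consv R n).
    exact: measurable_consv.
  have := ge0_integral_pushforward mc m measurableT mf (fun y _ => f0 y).
  by rewrite preimage_setT.
rewrite fubini_tonelli1//; last by move=> x /=; exact: f0.
by apply: measurableT_comp => //; exact: measurable_consv.
Qed.

Lemma ge0_integral_shift (f : R -> \bar R) a : measurable_fun setT f ->
  (forall x, 0 <= f x) -> \int[mu]_x f (x + a)%R = \int[mu]_x f x.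
Proof.
move=> mf f0.
have ms : measurable_fun [set: measurableTypeR R]
    ((fun x => x + a)%R : _ -> measurableTypeR R).
  exact: measurable_funD.
have := ge0_integral_pushforward ms mu measurableT mf (fun y _ => f0 y).
rewrite preimage_setT => <-.
by apply: eq_measure_integral => A mA _; exact: lebesgue_measureD.
Qed.

Lemma ge0_integral_opp (f : R -> \bar R) : measurable_fun setT f ->
  (forall x, 0 <= f x) -> \int[mu]_x f (- x)%R = \int[mu]_x f x.
Proof.
move=> mf f0.
have ms : measurable_fun [set: measurableTypeR R] (-%R : _ -> measurableTypeR R).
  exact: oppr_measurable.
have := ge0_integral_pushforward ms mu measurableT mf (fun y _ => f0 y).
rewrite preimage_setT => <-.
by apply: eq_measure_integral => A mA _; exact: lebesgue_measureN.
Qed.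

Lemma measurable_opp_cV n : measurable_fun setT (fun x : 'cV[R]_n => - x)%R.
Proof.
apply: measurable_fun_mx => i j; under eq_fun do rewrite mxE.
by apply: measurableT_comp => //; exact: measurable_coord.
Qed.

Lemma measurable_shift_cV n (a : 'cV[R]_n) :
  measurable_fun setT (fun x : 'cV[R]_n => x + a)%R.
Proof.
apply: measurable_fun_mx => i j; under eq_fun do rewrite mxE.
by apply: measurable_funD => //; exact: measurable_coord.
Qed.

Lemma consvD n x y (v w : 'cV[R]_n) :
  (consv (x, v) + consv (y, w) = consv (x + y, v + w))%R.
Proof.
by apply/colP => i; rewrite !mxE; case: unliftP => [j|] _; rewrite ?mxE.
Qed.

Lemma consvN n x (v : 'cV[R]_n) : (- consv (x, v) = consv (- x, - v))%R.
Proof.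
by apply/colP => i; rewrite !mxE; case: unliftP => [j|] _; rewrite ?mxE.
Qed.

Lemma unconsvK n : cancel (@unconsv R n) (@consv R n).
Proof.
by move=> v; apply/colP => i; rewrite mxE; case: unliftP => [j|] ->; rewrite ?mxE.
Qed.

Lemma measurable_int_cVS n (f : 'cV[R]_n.+1 -> \bar R) : measurable_fun setT f ->
  (forall x, 0 <= f x) ->
  measurable_fun setT (fun x => \int[leb n]_v f (consv (x, v))).
Proof.
move=> mf f0.
apply: (@measurable_fun_fubini_tonelli_F _ _ _ _ _ (leb n) (f \o @consv R n)).
  by apply: measurableT_comp => //; exact: measurable_consv.
by move=> x /=; exact: f0.
Qed.

Lemma measurable_consv2 n (f : 'cV[R]_n.+1 -> \bar R) x :
  measurable_fun setT f -> measurable_fun setT (fun v => f (consv (x, v))).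
Proof.
move=> mf; apply: measurableT_comp => //.
by apply: (measurableT_comp (@measurable_consv R n)); exact: measurable_pair1.
Qed.

Lemma ge0_integral_shift_cV n (f : 'cV[R]_n -> \bar R) (a : 'cV[R]_n) :
  measurable_fun setT f -> (forall x, 0 <= f x) ->
  \int[leb n]_x f (x + a)%R = \int[leb n]_x f x.
Proof.
elim: n f a => [|n ih] f a mf f0.
  by apply: eq_integral => x _; rewrite [a]flatmx0 addr0.
have mfa : measurable_fun setT (fun x : 'cV[R]_n.+1 => f (x + a)%R).
  by apply: measurableT_comp => //; exact: measurable_shift_cV.
rewrite (integral_cVS mf f0) (integral_cVS mfa (fun x => f0 _)) -[a]unconsvK; case: (unconsv a) => y w.
pose F x := \int[leb n]_v f (consv (x, v)).
have F0 x : 0 <= F x by exact: integral_ge0.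
transitivity (\int[mu]_x F (x + y)%R); last first.
  exact: ge0_integral_shift (measurable_int_cVS mf f0) F0.
apply: eq_integral => x _; rewrite -[RHS](ih _ w)//; last exact: measurable_consv2.
by apply: eq_integral => v _; rewrite consvD.
Qed.

(** Combined with a translation, this gives the reflection about a conditional mean used in
    [cond_mean_ortho]. *)
Lemma ge0_integral_opp_cV n (f : 'cV[R]_n -> \bar R) :
  measurable_fun setT f -> (forall x, 0 <= f x) ->
  \int[leb n]_x f (- x)%R = \int[leb n]_x f x.
Proof.
elim: n f => [|n ih] f mf f0.
  by apply: eq_integral => x _; rewrite [x]flatmx0 oppr0.
have mfa : measurable_fun setT (fun x : 'cV[R]_n.+1 => f (- x)%R).
  by apply: measurableT_comp => //; exact: measurable_opp_cV.
rewrite (integral_cVS mf f0) (integral_cVS mfa (fun x => f0 _)).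
pose F x := \int[leb n]_v f (consv (x, v)).
have F0 x : 0 <= F x by exact: integral_ge0.
transitivity (\int[mu]_x F (- x)%R); last first.
  exact: ge0_integral_opp (measurable_int_cVS mf f0) F0.
apply: eq_integral => x _; rewrite -[RHS]ih//; last exact: measurable_consv2.
by apply: eq_integral => v _; rewrite consvN.
Qed.

End lebesgue_cV.

Section gauss_integral.
Context (R : realType).
Local Notation mu := (@lebesgue_measure R).
Local Notation leb n := (lebesgue_cV R n).

(** The integrand is the normal density of mean [-c] and variance [1 / a] divided by its peak
    value. *)
Lemma integral_expR_sqr (a c : R) : 0 < a ->
  (\int[mu]_t (expR (- (2^-1 * (a * (t + c) ^+ 2))))%:E =
   (Num.sqrt (2 * pi / a))%:E)%E.
Proof.
move=> a0; pose s := (Num.sqrt a)^-1.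
have s0 : s != 0 by rewrite invr_neq0// gt_eqF// sqrtr_gt0.
have s2 : s ^+ 2 = a^-1 by rewrite exprVn sqr_sqrtr// ltW.
have peakE : (normal_peak s)^-1 = Num.sqrt (2 * pi / a).
  by rewrite /normal_peak invrK s2; congr Num.sqrt; rewrite -mulr_natr; ring.
rewrite -peakE -[RHS]mule1 -(integral_normal_pdf (- c) s).
have m1 : measurable_fun [set: measurableTypeR R]
    (fun x => (normal_pdf (- c) s x)%:E).
  by apply/measurable_EFinP; exact: measurable_normal_pdf.
rewrite -ge0_integralZl_EFin//; first last.
- by rewrite invr_ge0 normal_peak_ge0.
- by move=> x _; rewrite lee_fin normal_pdf_ge0.
apply: eq_integral => t _; rewrite normal_pdfE// -EFinM mulKf//; last first.
  by rewrite gt_eqF// normal_peak_gt0.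
rewrite /normal_fun s2 opprK; congr (expR _)%:E.
move: (t + c) => z; have an0 : a != 0 by rewrite gt_eqF.
by rewrite -[X in _ / X]mulr_natr; field.
Qed.

(** Matches the recursion that defines [lebesgue_cV] with the block decomposition of matrices of
    size [1 + n]. *)
Lemma col_mx_consv n (t : R) (v : 'cV[R]_n) :
  consv (t, v) = col_mx (t%:M : 'M[R]_1) v.
Proof.
apply/colP => i; rewrite mxE; case: (unliftP (0 : 'I_n.+1) i) => [j|] -> /=.
  have -> : lift 0 j = rshift 1 j :> 'I_(1 + n) by apply: val_inj.
  by rewrite (col_mxEd (t%:M : 'M[R]_1) v j).
have -> : 0 = lshift n 0 :> 'I_(1 + n) by apply: val_inj.
by rewrite (col_mxEu (t%:M : 'M[R]_1) v 0) mxE.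
Qed.

Definition schur_compl n (W : 'M[R]_(1 + n)) : 'M[R]_n :=
  drsubmx W - (ulsubmx W 0 0)^-1 *: (dlsubmx W *m ursubmx W).

Section schur.
Context (n : nat) (W : 'M[R]_(1 + n)) (pW : posdefmx W).
Let a := ulsubmx W 0 0.
Let b := dlsubmx W.

Lemma ursub_tr : ursubmx W = b^T.
Proof. by rewrite /b trmx_dlsub pW.1. Qed.

Lemma ulsub_gt0 : 0 < a.
Proof.
have := pW.2 (col_mx 1 0); rewrite {1}/quadf -{1}[W]submxK tr_col_mx.
rewrite mul_row_block mul_row_col !trmx0 !mulmx0 !mul0mx !addr0 mulmx1 trmx1 mul1mx.
apply; apply/eqP; rewrite -col_mx0 => /eq_col_mx[] /matrixP/(_ 0 0)/eqP.
by rewrite !mxE eqxx oner_eq0.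
Qed.

(** Completing the square in the first coordinate, whose coefficient [a] is positive. *)
Lemma quadf_schur t (v : 'cV[R]_n) :
  quadf W (col_mx (t%:M : 'M[R]_1) v) =
  a * (t + a^-1 * (b^T *m v) 0 0) ^+ 2 + quadf (schur_compl W) v.
Proof.
have vb : (v^T *m b) 0 0 = (b^T *m v) 0 0.
  by rewrite -[in LHS](trmxK b) -trmx_mul mxE.
rewrite {1}/quadf -{1}[W]submxK tr_col_mx mul_row_block mul_row_col.
rewrite ursub_tr -/b tr_scalar_mx !mulmxDl !mul_scalar_mx !mul_mx_scalar.
rewrite -scalemxAl.
rewrite /quadf /schur_compl ursub_tr -/a -/b mulmxBr mulmxBl.
rewrite -scalemxAr -scalemxAl mulmxA -(mulmxA (v^T *m b)).
have Dm (A B : 'M[R]_1) : (A + B) 0 0 = A 0 0 + B 0 0 by rewrite mxE.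
have Zm c (A : 'M[R]_1) : (c *: A) 0 0 = c * A 0 0 by rewrite mxE.
rewrite -[- (a^-1 *: _)]scaleN1r !(Dm, Zm) -/a.
have -> : (v^T *m b *m (b^T *m v)) 0 0 = (b^T *m v) 0 0 ^+ 2.
  by rewrite mxE big_ord1 vb expr2.
rewrite vb; move: ((b^T *m v) 0 0) => beta.
have a0 : a != 0 by rewrite gt_eqF// ulsub_gt0.
by field.
Qed.

Lemma posdef_schur : posdefmx (schur_compl W).
Proof.
have [symW W0] := pW.
split.
  rewrite /schur_compl ursub_tr -/b linearB linearZ/= trmx_mul trmxK.
  by rewrite trmx_drsub symW.
(* This first coordinate cancels the square in [quadf_schur]. *)
move=> v v0; have := W0 (col_mx (- (a^-1 * (b^T *m v) 0 0))%:M v).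
rewrite quadf_schur addNr expr0n mulr0 add0r; apply.
by apply: contra v0 => /eqP; rewrite -col_mx0 => /eq_col_mx[_ ->].
Qed.

(** Block elimination: [W] is a unit lower triangular factor times an upper triangular one. *)
Lemma det_schur : \det W = a * \det (schur_compl W).
Proof.
have a0 : a != 0 by rewrite gt_eqF// ulsub_gt0.
have WE : W = block_mx 1%:M 0 (a^-1 *: b) 1%:M *m
              block_mx a%:M b^T 0 (schur_compl W).
  rewrite mulmx_block !mul1mx !mul0mx !addr0 mul_mx_scalar scalerA.
  rewrite mulfV// scale1r -scalemxAl /schur_compl ursub_tr -/a -/b addrC subrK.
  by rewrite -ursub_tr -mx11_scalar submxK.
by rewrite {1}WE det_mulmx det_lblock det_ublock !det1 !mul1r det_scalar1.
Qed.

End schur.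

Lemma measurable_quadf n d (T : measurableType d) (S : 'M[R]_n)
    (f : T -> 'cV[R]_n) :
  measurable_fun setT f -> measurable_fun setT (fun t => quadf S (f t)).
Proof.
move=> mf; under eq_fun do rewrite quadfE.
have mc i j : measurable_fun setT (fun t => f t i j).
  by apply: (measurableT_comp (measurable_coord i j)).
apply: measurable_sum => i; apply: measurable_sum => j.
by apply: measurable_funM => //; apply: measurable_funM.
Qed.

Lemma measurable_expR_quadf n (W : 'M[R]_n) :
  measurable_fun setT (fun x => (expR (- (2^-1 * quadf W x)))%:E).
Proof.
apply/measurable_EFinP; apply: measurableT_comp => //.
apply: measurableT_comp => //; apply: measurable_funM => //.
exact: measurable_quadf.
Qed.

(** Induction on the dimension: integrating out the first coordinate yields [sqrt (2 pi / a)] and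
    leaves the quadratic form of the Schur complement. Positivity of the determinant is carried
    along, since the value is a square root. *)
Lemma integral_expR_quadf n (W : 'M[R]_n) : posdefmx W ->
  0 < \det W /\
  (\int[leb n]_x (expR (- (2^-1 * quadf W x)))%:E =
   (Num.sqrt ((2 * pi) ^+ n / \det W))%:E)%E.
Proof.
elim: n W => [|n ih] W pW.
  rewrite det_mx00 ltr01 divr1 expr0 sqrtr1 integral_dirac//=; last first.
    exact: measurable_expR_quadf.
  by rewrite diracT mul1e quadf0 mulr0 oppr0 expR0.
have pS := posdef_schur pW; have [dS iS] := ih _ pS.
have a0 := ulsub_gt0 pW; have dW := det_schur pW.
split; first by rewrite dW mulr_gt0.
have mW := measurable_expR_quadf W.
have W0 (x : 'cV[R]_n.+1) : (0 <= (expR (- (2^-1 * quadf W x)))%:E)%E.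
  by rewrite lee_fin expR_ge0.
rewrite (integral_cVS mW W0).
set a := ulsubmx (W : 'M[R]_(1 + n)) 0 0 in a0 dW *.
pose g (w : R * 'cV[R]_n) := (expR (- (2^-1 * quadf W (consv w))))%:E.
have mg : measurable_fun setT g.
  by apply: (measurableT_comp mW); exact: measurable_consv.
(* The coordinate in which the square was completed has to be the inner variable, whereas
   [integral_cVS] puts it outside. *)
transitivity (\int[leb n]_v \int[mu]_t g (t, v))%E.
  exact: (@fubini_tonelli _ _ _ _ R mu (leb n) g mg (fun w => W0 _)).
under eq_integral => v _.
  rewrite (_ : (\int[mu]_t g (t, v) = (Num.sqrt (2 * pi / a))%:E *
    (expR (- (2^-1 * quadf (schur_compl W) v)))%:E)%E); last first.
    pose c := a^-1 * ((dlsubmx (W : 'M[R]_(1 + n)))^T *m v) 0 0.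
    rewrite -(integral_expR_sqr c a0) -ge0_integralZr//; last first.
      apply/measurable_EFinP; apply: measurableT_comp => //.
      apply: measurableT_comp => //; apply: measurable_funM => //.
      apply: measurable_funM => //; apply: measurable_funX.
      exact: measurable_funD.
    apply: eq_integral => t _; rewrite /g col_mx_consv quadf_schur// -EFinM -expRD.
    by rewrite -opprD -mulrDr.
  over.
transitivity ((Num.sqrt (2 * pi / a))%:E *
    \int[leb n]_v (expR (- (2^-1 * quadf (schur_compl W) v)))%:E)%E.
  by apply: ge0_integralZl_EFin => //; exact: measurable_expR_quadf.
rewrite iS -EFinM -sqrtrM; last first.
  by rewrite divr_ge0 ?ltW// mulr_gt0 ?pi_gt0.
congr (Num.sqrt _)%:E; rewrite dW exprS.
have a0' : a != 0 by rewrite gt_eqF.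
have d0' : \det (schur_compl W) != 0 by rewrite gt_eqF.
by rewrite -/a; field; rewrite a0' d0'.
Qed.

End gauss_integral.

(** * Norm estimates *)

Section norm_bounds.
Context (R : realType).

Lemma ler_coord m n (A : 'M[R]_(m, n)) i j : `|A i j| <= `|A|.
Proof.
rewrite /Num.norm/= mx_normrE.
by apply: (le_bigmax _ (fun ij : 'I_m * 'I_n => `|A ij.1 ij.2|) (i, j)).
Qed.

Lemma mx_norm_le m n (A : 'M[R]_(m, n)) c : 0 <= c ->
  (forall i j, `|A i j| <= c) -> `|A| <= c.
Proof.
move=> c0 Ac; rewrite /Num.norm/= mx_normrE.
by apply/bigmax_leP; split => // i _.
Qed.

Lemma ler_sum_cst n (F : 'I_n -> R) c :
  (forall i, F i <= c) -> \sum_i F i <= n%:R * c.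
Proof.
move=> Fc; rewrite (le_trans (ler_sum _ (fun i _ => Fc i)))//.
by rewrite sumr_const card_ord mulr_natl.
Qed.

Lemma ler_norm_mulmx m n (A : 'M[R]_(m, n)) (x : 'cV[R]_n) :
  `|A *m x| <= n%:R * `|A| * `|x|.
Proof.
apply: mx_norm_le => [|i j]; first by rewrite !mulr_ge0.
rewrite mxE (le_trans (ler_norm_sum _ _ _))//.
rewrite -mulrA ler_sum_cst// => k.
by rewrite normrM [j]ord1 ler_pM// ler_coord.
Qed.

Lemma quadf_bilinear_le n (W : 'M[R]_n) (x y : 'cV[R]_n) :
  `|(x^T *m W *m y) 0 0| <= n%:R * (n%:R * `|W|) * (`|x| * `|y|).
Proof.
rewrite -mulmxA mxE (le_trans (ler_norm_sum _ _ _))//.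
rewrite -mulrA ler_sum_cst// => k.
rewrite normrM mxE mulrCA ler_pM// ?ler_coord//.
by rewrite (le_trans (ler_coord _ _ _))// ler_norm_mulmx.
Qed.

Lemma ler_norm_enorm n (x : 'cV[R]_n) : `|x| <= enorm x.
Proof.
apply: mx_norm_le => [|i j]; first exact: sqrtr_ge0.
rewrite -sqrtr_sqr ler_wsqrtr// [j]ord1 (bigD1 i)//= lerDl sumr_ge0// => k _.
exact: sqr_ge0.
Qed.

Lemma enorm_le n (x : 'cV[R]_n) : enorm x <= n%:R * `|x|.
Proof.
rewrite -[leRHS]ger0_norm ?mulr_ge0// -sqrtr_sqr ler_wsqrtr// exprMn.
apply: (@le_trans _ _ (n%:R * `|x| ^+ 2)).
  apply: ler_sum_cst => i.
  by rewrite -[leLHS]ger0_norm ?sqr_ge0// normrX lerXn2r ?nnegrE// ler_coord.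
rewrite ler_wpM2r ?sqr_ge0// -natrX ler_nat.
by case: n x => // n _; rewrite leq_pmulr.
Qed.

Lemma enorm_ge0 n (x : 'cV[R]_n) : 0 <= enorm x.
Proof. exact: sqrtr_ge0. Qed.

Lemma quadf_ge_norm n (W : 'M[R]_n) : posdefmx W ->
  exists2 c, 0 < c & forall x, c * `|x| ^+ 2 <= quadf W x.
Proof.
move=> pW; have [pM ME] := sqrtmxP pW; set M := sqrtmx W in pM ME.
have uM := posdef_unit pM.
(* The summand 1 keeps [k] positive also in dimension 0. *)
pose k := n%:R * `|invmx M| + 1.
have k0 : 0 < k by rewrite ltr_wpDl// mulr_ge0.
exists (k ^- 2) => [|x]; first by rewrite invr_gt0 exprn_gt0.
rewrite mulrC ler_pdivrMr ?exprn_gt0//.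
have -> : quadf W x = enorm (M *m x) ^+ 2.
  by rewrite sqr_enorm -quadf_sandwich mulmx1 pM.1 ME.
rewrite -exprMn lerXn2r ?nnegrE// ?mulr_ge0 ?enorm_ge0 ?(ltW k0)//.
rewrite -[x in leLHS](mulKmx uM) (le_trans (ler_norm_mulmx _ _))//.
rewrite mulrC ler_pM// ?mulr_ge0//; last by rewrite /k lerDl.
exact: ler_norm_enorm.
Qed.

Lemma bilinear_sym n (W : 'M[R]_n) (x y : 'cV[R]_n) : W^T = W ->
  (y^T *m W *m x) 0 0 = (x^T *m W *m y) 0 0.
Proof.
by move=> Wsym; rewrite -[in LHS](trmxK (_ *m x)) mxE !trmx_mul trmxK Wsym mulmxA.
Qed.

Lemma quadf_diff n (W : 'M[R]_n) (x y : 'cV[R]_n) : W^T = W ->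
  quadf W x - quadf W y = ((x - y)^T *m W *m (x + y)) 0 0.
Proof.
move=> Wsym; have E := bilinear_sym x y Wsym.
have Dm (A B : 'M[R]_1) : (A + B) 0 0 = A 0 0 + B 0 0 by rewrite mxE.
have Nm (A : 'M[R]_1) : (- A) 0 0 = - A 0 0 by rewrite mxE.
by rewrite /quadf linearB/= !mulmxBl mulmxDr mulmxDr !(Dm, Nm) E; ring.
Qed.

Lemma quadfB n (W : 'M[R]_n) (x y : 'cV[R]_n) : W^T = W ->
  quadf W (x - y) = quadf W x - 2 * (x^T *m W *m y) 0 0 + quadf W y.
Proof.
move=> Wsym; have E := bilinear_sym x y Wsym.
have Dm (A B : 'M[R]_1) : (A + B) 0 0 = A 0 0 + B 0 0 by rewrite mxE.
have Nm (A : 'M[R]_1) : (- A) 0 0 = - A 0 0 by rewrite mxE.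
by rewrite /quadf [(x - y)^T]linearB/= !mulmxBl !mulmxBr !(Dm, Nm) E; ring.
Qed.

Lemma quadf_shift_le n (W : 'M[R]_n) : W^T = W ->
  exists2 c, 0 <= c & forall x y : 'cV[R]_n,
    `|quadf W x - quadf W y| <= c * `|x - y| * (`|x| + `|y|).
Proof.
move=> Wsym; exists (n%:R * (n%:R * `|W|)); first by rewrite !mulr_ge0.
move=> x y; rewrite quadf_diff// (le_trans (quadf_bilinear_le _ _ _))// mulrA.
by rewrite ler_wpM2l ?mulr_ge0// ler_normD.
Qed.

(** For [b <= a] this is [1 - exp (- (a - b)) <= a - b]. Both exponentials appear on the right so
    that the bound is symmetric and the error is again a sum of Gaussian weights. *)
Lemma expRN_lip (a b : R) :
  `|expR (- a) - expR (- b)| <= `|a - b| * (expR (- a) + expR (- b)).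
Proof.
wlog ab : a b / b <= a.
  move=> H; have [/H//|/ltW/H] := leP b a.
  by move=> h; rewrite distrC (distrC a) (addrC (expR (- a))).
rewrite distrC ger0_norm ?subr_ge0 ?ler_expR ?lerN2// ger0_norm ?subr_ge0//.
rewrite mulrDr ler_wpDl ?mulr_ge0 ?expR_ge0 ?subr_ge0//.
have -> : - a = - b - (a - b) by ring.
rewrite expRD -[X in X - _]mulr1 -mulrBr mulrC ler_wpM2r ?expR_ge0//.
by rewrite lerBlDr -lerBlDl addrC (le_trans _ (expR_ge1Dx _))// addrC.
Qed.

(** Being at least 1, the weight dominates constants and each of its powers dominates the lower
    ones. *)
Definition wt n (x : 'cV[R]_n) : R := 1 + `|x|.

Lemma wt_ge1 n (x : 'cV[R]_n) : 1 <= wt x.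
Proof. by rewrite lerDl. Qed.

Lemma wt_gt0 n (x : 'cV[R]_n) : 0 < wt x.
Proof. exact: lt_le_trans (wt_ge1 x). Qed.

Lemma wt_ge0 n (x : 'cV[R]_n) : 0 <= wt x.
Proof. exact/ltW/wt_gt0. Qed.

(** [wt x ^+ k] is at most [exp (k |x|)], and [k t <= k ^ 2 / c + c t ^ 2 / 4] lets half of the
    exponent absorb it, where [c] is the coercivity constant of [W]. *)
Lemma expR_wt n (W : 'M[R]_n) k : posdefmx W ->
  exists2 C, 0 <= C & forall x,
    wt x ^+ k * expR (- (2^-1 * quadf W x)) <=
    C * expR (- (2^-1 * quadf (2^-1 *: W) x)).
Proof.
move=> pW; have [c c0 cW] := quadf_ge_norm pW.
exists (expR (k%:R ^+ 2 / c)) => [|x]; first exact: expR_ge0.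
have wk : wt x ^+ k <= expR (k%:R * `|x|).
  by rewrite expRM_natl lerXn2r ?nnegrE ?wt_ge0 ?expR_ge0// expR_ge1Dx.
apply: (le_trans (ler_wpM2r (expR_ge0 _) wk)).
rewrite -!expRD ler_expR quadfZl.
have := cW x; move: (quadf W x) (`|x|) => q t cq.
suff : k%:R * t <= k%:R ^+ 2 / c + 4^-1 * (c * t ^+ 2) by nra.
rewrite -subr_ge0.
have -> : k%:R ^+ 2 / c + 4^-1 * (c * t ^+ 2) - k%:R * t =
  c * (k%:R / c - 2^-1 * t) ^+ 2 by field; rewrite gt_eqF.
by rewrite mulr_ge0 ?sqr_ge0// ltW.
Qed.

End norm_bounds.

(** * The Gaussian density *)

(* Naming a function through an equation instead of [pose] keeps unification
   from unfolding it. *)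
Lemma opaque_copy T (x : T) : exists y, y = x.
Proof. by exists x. Qed.

Section measurability.
Context (R : realType) d (T : measurableType d).

Lemma measurable_coord_comp m n (f : T -> 'M[R]_(m, n)) i j :
  measurable_fun setT f -> measurable_fun setT (fun t => f t i j).
Proof. by move=> mf; apply: (measurableT_comp (measurable_coord i j)). Qed.

Lemma measurable_mxD m n (f g : T -> 'M[R]_(m, n)) :
  measurable_fun setT f -> measurable_fun setT g ->
  measurable_fun setT (fun t => f t + g t).
Proof.
move=> mf mg; apply: measurable_fun_mx => i j; under eq_fun do rewrite mxE.
by apply: measurable_funD; exact: measurable_coord_comp.
Qed.

Lemma measurable_mxN m n (f : T -> 'M[R]_(m, n)) :
  measurable_fun setT f -> measurable_fun setT (fun t => - f t).
Proof.
move=> mf; apply: measurable_fun_mx => i j; under eq_fun do rewrite mxE.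
by apply: measurableT_comp => //; exact: measurable_coord_comp.
Qed.

Lemma measurable_mulmx m n (A : 'M[R]_(m, n)) (f : T -> 'cV[R]_n) :
  measurable_fun setT f -> measurable_fun setT (fun t => A *m f t).
Proof.
move=> mf; apply: measurable_fun_mx => i j; under eq_fun do rewrite mxE.
apply: measurable_sum => k; apply: measurable_funM => //.
exact: measurable_coord_comp.
Qed.

Lemma measurable_normv n (f : T -> 'cV[R]_n) :
  measurable_fun setT f -> measurable_fun setT (fun t => `|f t| : R).
Proof.
move=> mf.
have mn : measurable_fun setT (fun x : 'cV[R]_n => `|x| : R).
  apply: (measurability _ (RGenOInfty.measurableE R)) => _ [_ [x ->]] <-.
  rewrite setTI; apply: sub_sigma_algebra.
  apply: open_comp; last exact: interval_open.
  by move=> A _; exact: norm_continuous.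
exact: (measurableT_comp mn).
Qed.

Lemma measurable_wt n (f : T -> 'cV[R]_n) :
  measurable_fun setT f -> measurable_fun setT (fun t => wt (f t)).
Proof. by move=> mf; apply: measurable_funD => //; exact: measurable_normv. Qed.

Lemma measurable_gauss_pdf n (S : 'M[R]_n) (f g : T -> 'cV[R]_n) :
  measurable_fun setT f -> measurable_fun setT g ->
  measurable_fun setT (fun t => gauss_pdf S (f t) (g t)).
Proof.
move=> mf mg; rewrite /gauss_pdf /wnorm; under eq_fun do rewrite sqr_enorm.
apply: measurable_funM => //; apply: measurableT_comp => //.
apply: measurableT_comp => //; apply: measurable_funM => //.
apply: measurable_quadf; apply: measurable_mulmx.
by apply: measurable_mxD => //; exact: measurable_mxN.
Qed.

End measurability.

(* [measurable_fun] unfolds to a product, so [apply:] would try to pass further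
   arguments to these lemmas; [refine] fixes their arity. *)
Ltac mfun_hyp :=
  match goal with
  | H : measurable_fun setT ?g |- measurable_fun _ ?f => constr_eq f g; exact H
  end.
Ltac mfun_step :=
  lazymatch goal with
  | |- measurable_fun _ (fun x => x) => refine measurable_id
  | |- measurable_fun _ id => refine measurable_id
  | |- measurable_fun _ (@Num.norm _ _) =>
      refine (@measurable_normv _ _ _ _ (fun x => x) _)
  | |- measurable_fun _ fst => refine measurable_fst
  | |- measurable_fun _ snd => refine measurable_snd
  | |- measurable_fun _ (fun _ => ?c) => refine (measurable_cst _)
  | |- measurable_fun _ (fun x => (@?a x)%:E) =>
      refine (proj2 (measurable_EFinP _ _) _)
  | |- measurable_fun _ (EFin \o _) => refine (proj2 (measurable_EFinP _ _) _)
  | |- measurable_fun _ (gauss_pdf ?S ?m) =>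
      refine (@measurable_gauss_pdf _ _ _ _ S (fun=> m) (fun x => x) _ _)
  | |- measurable_fun _ (quadf ?W) =>
      refine (@measurable_quadf _ _ _ _ W (fun x => x) _)
  | |- measurable_fun _ (mulmx ?A) =>
      refine (@measurable_mulmx _ _ _ _ _ A (fun x => x) _)
  | |- measurable_fun _ (@wt _ _) =>
      refine (@measurable_wt _ _ _ _ (fun x => x) _)
  | |- measurable_fun _ (fun x => gauss_pdf _ (@?a x) (@?b x)) =>
      refine (measurable_gauss_pdf _ _ _)
  | |- measurable_fun _ (fun x => wt (@?a x)) => refine (measurable_wt _)
  | |- measurable_fun _ (fun x => `|@?a x|%R) =>
      first [refine (measurable_normv _)
            | refine (measurableT_comp (@normr_measurable _ setT) _)]
  | |- measurable_fun _ (fun x => expR (@?a x)) =>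
      refine (measurableT_comp (@measurable_expR _) _)
  | |- measurable_fun _ (fun x => quadf _ (@?a x)) =>
      refine (measurable_quadf _ _)
  | |- measurable_fun _ (fun x => (@?a x + @?b x)%R) =>
      first [refine (measurable_funD _ _) | refine (measurable_mxD _ _)]
  | |- measurable_fun _ (fun x => (- @?a x)%R) =>
      first [refine (measurableT_comp (@oppr_measurable _ setT) _)
            | refine (measurable_mxN _)]
  | |- measurable_fun _ (fun x => (@?a x * @?b x)%R) =>
      refine (measurable_funM _ _)
  | |- measurable_fun _ (fun x => (@?a x ^+ ?k)%R) =>
      refine (measurable_funX k _)
  | |- measurable_fun _ (fun x => (_ *m @?b x)%R) =>
      refine (measurable_mulmx _ _)
  | |- measurable_fun _ (fun x => (@?a x, @?b x)) =>
      refine (measurable_fun_pair _ _)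
  | |- measurable_fun _ (fun x => fst (@?a x)) =>
      refine (measurableT_comp measurable_fst _)
  | |- measurable_fun _ (fun x => snd (@?a x)) =>
      refine (measurableT_comp measurable_snd _)
  | |- measurable_fun _ (fun x => fun_of_matrix (@?a x) _ _) =>
      refine (measurable_coord_comp _ _ _)
  | |- measurable_fun _ (fun x => ?f (@?a x)) =>
      match goal with
      | H : measurable_fun setT ?g |- _ =>
          constr_eq f g; refine (measurableT_comp H _)
      | H : forall z, measurable_fun setT (@?g z) |- _ =>
          let h := fresh in
          match f with ?k ?z => pose proof (H z) as h end;
          lazymatch type of h with measurable_fun setT ?l => constr_eq f l end;
          refine (measurableT_comp h _)
      end
  | |- measurable_fun _ ?f =>
      match goal with
      | H : forall z, measurable_fun setT (@?g z) |- _ =>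
          let h := fresh in
          match f with ?k ?z => pose proof (H z) as h end;
          lazymatch type of h with measurable_fun setT ?l => constr_eq f l end;
          exact h
      end
  end.
Ltac mfun := repeat first [mfun_hyp | mfun_step].

Section integral_nonneg.
Context (R : realType) d (T : measurableType d) (mu : {measure set T -> \bar R}).
Implicit Types f g : T -> R.
Local Open Scope ereal_scope.

Lemma int_le f g : measurable_fun setT f -> measurable_fun setT g ->
  (forall x, 0 <= f x)%R -> (forall x, f x <= g x)%R ->
  \int[mu]_x (f x)%:E <= \int[mu]_x (g x)%:E.
Proof.
move=> mf mg f0 fg; apply: ge0_le_integral => //.
- by move=> x _; rewrite lee_fin.
- exact/measurable_EFinP.
- exact/measurable_EFinP.
- by move=> x _; rewrite lee_fin.
Qed.

Lemma int_ge0 f : (forall x, 0 <= f x)%R -> 0 <= \int[mu]_x (f x)%:E.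
Proof. by move=> f0; apply: integral_ge0 => x _; rewrite lee_fin. Qed.

Lemma int_add f g : measurable_fun setT f -> measurable_fun setT g ->
  (forall x, 0 <= f x)%R -> (forall x, 0 <= g x)%R ->
  \int[mu]_x (f x + g x)%:E = \int[mu]_x (f x)%:E + \int[mu]_x (g x)%:E.
Proof.
move=> mf mg f0 g0; under eq_integral do rewrite EFinD.
apply: ge0_integralD => //; try exact/measurable_EFinP.
- by move=> x _; rewrite lee_fin.
- by move=> x _; rewrite lee_fin.
Qed.

Lemma int_scale f c : measurable_fun setT f -> (0 <= c)%R ->
  (forall x, 0 <= f x)%R ->
  \int[mu]_x (c * f x)%:E = c%:E * \int[mu]_x (f x)%:E.
Proof.
move=> mf c0 f0; under eq_integral do rewrite EFinM.
apply: ge0_integralZl_EFin => //; first by move=> x _; rewrite lee_fin.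
exact/measurable_EFinP.
Qed.

End integral_nonneg.

Section gauss.
Context (R : realType) (n : nat) (S : 'M[R]_n) (pS : posdefmx S).
Local Notation leb := (lebesgue_cV R n).
Local Notation G := (gauss_pdf S).
Implicit Types x y a b m : 'cV[R]_n.

Lemma gauss_pdfE m x : G m x =
  (Num.sqrt ((2 * pi) ^+ n * \det S))^-1 *
  expR (- (2^-1 * quadf (invmx S) (x - m))).
Proof. by rewrite /gauss_pdf sqr_wnorm. Qed.

Lemma gauss_cst_gt0 : 0 < (Num.sqrt ((2 * pi) ^+ n * \det S))^-1.
Proof.
rewrite invr_gt0 sqrtr_gt0 mulr_gt0 ?exprn_gt0 ?mulr_gt0 ?pi_gt0//.
by have [] := integral_expR_quadf pS.
Qed.

Lemma gauss_gt0 m x : 0 < G m x.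
Proof. by rewrite gauss_pdfE mulr_gt0 ?gauss_cst_gt0 ?expR_gt0. Qed.

Lemma gauss_ge0 m x : 0 <= G m x.
Proof. exact/ltW/gauss_gt0. Qed.

Lemma gauss_pdf_shift m x : G m x = G 0 (x - m).
Proof. by rewrite /gauss_pdf subr0. Qed.

Lemma gauss_pdf_opp x : G 0 (- x) = G 0 x.
Proof.
rewrite !gauss_pdfE !subr0 !quadfE; do 4 congr (_ _).
apply: eq_bigr => i _; apply: eq_bigr => j _.
by rewrite !mxE !mulNr mulrN opprK.
Qed.

Lemma integral_gauss m : (\int[leb]_x (G m x)%:E = 1)%E.
Proof.
transitivity (\int[leb]_x (G 0 (x - m))%:E)%E.
  by apply: eq_integral => x _; rewrite -gauss_pdf_shift.
rewrite (ge0_integral_shift_cV (f := fun x => (G 0 x)%:E)); last 2 first.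
- by mfun.
- by move=> x; rewrite lee_fin gauss_ge0.
under eq_integral => x _ do rewrite gauss_pdfE subr0.
have mE : measurable_fun setT (fun x => expR (- (2^-1 * quadf (invmx S) x))).
  by apply/measurable_EFinP; exact: measurable_expR_quadf.
rewrite (int_scale _ mE (ltW gauss_cst_gt0) (fun x => expR_ge0 _)).
have [_ ->] := integral_expR_quadf (posdef_inv pS).
rewrite det_inv invrK -EFinM mulVf// -invr_eq0 gt_eqF// gauss_cst_gt0//.
Qed.

Let c := (Num.sqrt ((2 * pi) ^+ n * \det S))^-1.

Lemma gauss_dominated k : exists2 C, 0 <= C & forall x,
  wt x ^+ k * G 0 x <= C * expR (- (2^-1 * quadf (2^-1 *: invmx S) x)).
Proof.
have [C C0 CP] := expR_wt k (posdef_inv pS).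
exists (c * C) => [|x]; first by rewrite mulr_ge0// ltW// gauss_cst_gt0.
rewrite gauss_pdfE subr0 -/c mulrCA -mulrA ler_wpM2l//.
by rewrite ltW// gauss_cst_gt0.
Qed.

Lemma gauss_bound k : exists2 C, 0 <= C & forall a x,
  wt (x - a) ^+ k * G a x <= C.
Proof.
have [C C0 CP] := gauss_dominated k; exists C => [//|a x].
rewrite gauss_pdf_shift (le_trans (CP _))// ler_piMr// -expR0 ler_expR oppr_le0.
rewrite mulr_ge0// quadf_ge0//; apply: posdef_scale => //.
exact: posdef_inv.
Qed.

Lemma gauss_moment k : exists2 C, 0 <= C & forall a,
  (\int[leb]_x (wt (x - a) ^+ k * G a x)%:E <= C%:E)%E.
Proof.
have [C C0 CP] := gauss_dominated k.
have pW : posdefmx (2^-1 *: invmx S).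
  by apply: posdef_scale => //; exact: posdef_inv.
have [_ iW] := integral_expR_quadf pW.
set D := Num.sqrt _ in iW.
exists (C * D) => [|a]; first by rewrite mulr_ge0// sqrtr_ge0.
have mE : measurable_fun setT
    (fun x => expR (- (2^-1 * quadf (2^-1 *: invmx S) x))).
  by apply/measurable_EFinP; exact: measurable_expR_quadf.
rewrite EFinM -iW -int_scale//.
have h0 x : 0 <= wt x ^+ k * G 0 x.
  by rewrite mulr_ge0 ?exprn_ge0 ?wt_ge0 ?gauss_ge0.
have mh : measurable_fun setT (fun x => wt x ^+ k * G 0 x) by mfun.
rewrite [leLHS](_ : _ = \int[leb]_x (wt x ^+ k * G 0 x)%:E)%E; last first.
  rewrite -[RHS](ge0_integral_shift_cV (- a)); last 2 first.
  - exact/measurable_EFinP.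
  - by move=> x; rewrite lee_fin.
  by apply: eq_integral => x _; rewrite gauss_pdf_shift.
by apply: int_le => //; mfun.
Qed.

(** The increment of the quadratic form is at most [|a - b|] times a norm centered at [a] plus one
    centered at [b]. As [|a - b| <= 1], either norm is at most the other plus 1, so each density can
    be given the weight with its own center. *)
Lemma gauss_lip : exists2 C, 0 <= C & forall a b x, `|a - b| <= 1 ->
  `|G a x - G b x| <= C * `|a - b| * (wt (x - a) * G a x + wt (x - b) * G b x).
Proof.
have [C C0 CP] := quadf_shift_le (posdef_inv pS).1.
exists C => // a b x ab.
have pcst := gauss_cst_gt0.
rewrite !gauss_pdfE -/c -mulrBr normrM gtr0_norm//.
set p := expR (- (2^-1 * quadf _ (x - a))); set q := expR _.
rewrite mulrCA (mulrCA _ c q) -mulrDr mulrCA ler_wpM2l ?(ltW pcst)//.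
apply: (le_trans (expRN_lip _ _)).
have p0 : 0 <= p := expR_ge0 _; have q0 : 0 <= q := expR_ge0 _.
rewrite -mulrBr normrM ger0_norm//.
have := CP (x - a) (x - b).
have -> : x - a - (x - b) = - (a - b) by rewrite opprB addrC addrA subrK opprB.
rewrite normrN; set Q := `|_ - _| => QC.
have ta : `|x - b| <= `|x - a| + 1.
  rewrite (le_trans _ (lerD (lexx _) ab))// (le_trans _ (ler_normD _ _))//.
  by rewrite addrA subrK.
have tb : `|x - a| <= `|x - b| + 1.
  rewrite (le_trans _ (lerD (lexx _) ab))// distrC (distrC x b).
  by rewrite (le_trans _ (ler_normD _ _))// [X in _ <= `|X|]addrC addrA subrK.
have Qa : 2^-1 * Q <= C * `|a - b| * wt (x - a).
  rewrite mulrC ler_pdivrMr// (le_trans QC)// -[leRHS]mulrA ler_wpM2l ?mulr_ge0//.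
  by rewrite /wt; lra.
have Qb : 2^-1 * Q <= C * `|a - b| * wt (x - b).
  rewrite mulrC ler_pdivrMr// (le_trans QC)// -[leRHS]mulrA ler_wpM2l ?mulr_ge0//.
  by rewrite /wt; lra.
by rewrite !mulrDr !mulrA lerD// ler_wpM2r.
Qed.

Lemma gauss_lip_bound : exists2 C, 0 <= C & forall a b x, `|a - b| <= 1 ->
  `|G a x - G b x| <= C * `|a - b|.
Proof.
have [C C0 CP] := gauss_lip; have [D D0 DP] := gauss_bound 1.
exists (C * (D + D)) => [|a b x ab]; first by rewrite mulr_ge0// addr_ge0.
rewrite (le_trans (CP _ _ _ ab))// mulrAC ler_wpM2r// ler_wpM2l//.
by rewrite lerD// -[wt _]expr1 DP.
Qed.

(** In the applications [A] is 1 or the weight of a second variable that is held fixed, so that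
    joint weights such as [wt u + |y|] are treated as weights in one variable. *)
Lemma wt_shift (A : R) a x : 1 <= A -> A + `|x| <= (A + `|a|) * wt (x - a).
Proof.
move=> A1; have : `|x| <= `|a| + `|x - a|.
  by rewrite (le_trans _ (ler_normD _ _))// addrC subrK.
rewrite /wt; have := normr_ge0 a; have := normr_ge0 (x - a); nra.
Qed.

Lemma gauss_growth k : exists2 C, 0 <= C & forall (A : R) a, 1 <= A ->
  (\int[leb]_x ((A + `|x|) ^+ k * G a x)%:E <= (C * (A + `|a|) ^+ k)%:E)%E.
Proof.
have [C C0 CP] := gauss_moment k; exists C => // A a A1.
have Aa : 0 <= A + `|a| by rewrite addr_ge0// (le_trans _ A1).
have A0 : 0 <= A by rewrite (le_trans _ A1).
pose h x := wt (x - a) ^+ k * G a x.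
have h0 x : 0 <= h x by rewrite mulr_ge0 ?exprn_ge0 ?wt_ge0 ?gauss_ge0.
have mh : measurable_fun setT h by rewrite /h; mfun.
have pt x : (A + `|x|) ^+ k * G a x <= (A + `|a|) ^+ k * h x.
  rewrite /h mulrA ler_wpM2r ?gauss_ge0// -exprMn.
  by rewrite lerXn2r ?nnegrE ?mulr_ge0 ?wt_ge0 ?addr_ge0// wt_shift.
rewrite mulrC EFinM (le_trans _ (lee_wpmul2l _ (CP a)))//; last first.
  by rewrite lee_fin exprn_ge0.
rewrite -int_scale//; last exact: exprn_ge0.
apply: int_le => //; [by mfun|by mfun|move=> x].
by rewrite mulr_ge0 ?gauss_ge0// exprn_ge0// addr_ge0.
Qed.

Lemma gauss_lip_int : exists2 C, 0 <= C & forall (A r : R) a b (f : 'cV[R]_n -> R),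
  1 <= A -> `|a - b| <= r -> r <= 1 -> measurable_fun setT f ->
  (forall x, 0 <= f x <= (A + `|x|) ^+ 2) ->
  (\int[leb]_x (f x * G a x)%:E <=
   \int[leb]_x (f x * G b x)%:E + (C * r * (A + `|b|) ^+ 2)%:E)%E.
Proof.
have [C C0 CP] := gauss_lip; have [D D0 DP] := gauss_moment 3.
(* [D] is a moment of order 3: two powers come from [f] and one from [gauss_lip]. The factor 5 is
   [4 + 1], since [(A + |a|) ^ 2 <= 4 (A + |b|) ^ 2] when [|a - b| <= 1 <= A]. *)
exists (5 * C * D) => [|A r a b f A1 abr r1 mf f0A]; first by rewrite !mulr_ge0.
have r0 : 0 <= r by rewrite (le_trans _ abr).
have f0 x : 0 <= f x by case/andP: (f0A x).
have fA x : f x <= (A + `|x|) ^+ 2 by case/andP: (f0A x).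
have A0 : 0 <= A by rewrite (le_trans _ A1).
have [h hE] := opaque_copy (fun z x : 'cV[R]_n => wt (x - z) ^+ 3 * G z x).
have h0 z x : 0 <= h z x by rewrite hE mulr_ge0 ?exprn_ge0 ?wt_ge0 ?gauss_ge0.
have mh z : measurable_fun setT (h z) by rewrite hE; mfun.
have [e eE] := opaque_copy (fun z : 'cV[R]_n => C * r * (A + `|z|) ^+ 2).
have e0 z : 0 <= e z by rewrite eE !mulr_ge0// ?exprn_ge0 ?addr_ge0.
have fw z x : f x * (wt (x - z) * G z x) <= (A + `|z|) ^+ 2 * h z x.
  rewrite hE.
  have -> : (A + `|z|) ^+ 2 * (wt (x - z) ^+ 3 * G z x) =
    ((A + `|z|) * wt (x - z)) ^+ 2 * (wt (x - z) * G z x) by ring.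
  rewrite ler_wpM2r ?mulr_ge0 ?wt_ge0 ?gauss_ge0// (le_trans (fA x))//.
  by rewrite lerXn2r ?nnegrE ?mulr_ge0 ?wt_ge0 ?addr_ge0// wt_shift.
have pt x : f x * G a x <= f x * G b x + (e a * h a x + e b * h b x).
  pose K := wt (x - a) * G a x + wt (x - b) * G b x.
  have K0 : 0 <= K by rewrite addr_ge0 ?mulr_ge0 ?wt_ge0 ?gauss_ge0.
  have Hab : G a x - G b x <= C * r * K.
    rewrite (le_trans (ler_norm _))// (le_trans (CP _ _ _ (le_trans abr r1)))//.
    by rewrite ler_wpM2r// ler_wpM2l.
  rewrite -lerBlDl -mulrBr (le_trans (ler_wpM2l (f0 x) Hab))//.
  have -> : e a * h a x + e b * h b x =
    C * r * ((A + `|a|) ^+ 2 * h a x + (A + `|b|) ^+ 2 * h b x).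
    by rewrite !eE; ring.
  rewrite mulrCA (ler_wpM2l (mulr_ge0 C0 r0))// mulrDr.
  exact: (lerD (fw a x) (fw b x)).
have fG z x : 0 <= f x * G z x by rewrite mulr_ge0 ?gauss_ge0.
have eh0 z x : 0 <= e z * h z x by exact: mulr_ge0 (e0 z) (h0 z x).
have eh00 x : 0 <= e a * h a x + e b * h b x by exact: addr_ge0 (eh0 a x) (eh0 b x).
have mfG z : measurable_fun setT (fun x => f x * G z x) by mfun.
have meh z : measurable_fun setT (fun x => e z * h z x) by mfun.
have meh2 : measurable_fun setT (fun x => e a * h a x + e b * h b x).
  exact: measurable_funD (meh a) (meh b).
apply: (le_trans (int_le _ (mfG a) (measurable_funD (mfG b) meh2) (fG a) pt)).
rewrite (int_add _ (mfG b) meh2 (fG b) eh00) leeD2l//.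
rewrite (int_add _ (meh a) (meh b) (eh0 a) (eh0 b)).
rewrite (int_scale _ (mh a) (e0 a) (h0 a)) (int_scale _ (mh b) (e0 b) (h0 b)).
apply: (@le_trans _ _ ((e a)%:E * D%:E + (e b)%:E * D%:E)%E).
  by rewrite leeD// lee_wpmul2l ?lee_fin// hE DP.
rewrite -!EFinM -EFinD lee_fin !eE.
have aA : (A + `|a|) ^+ 2 <= 4 * (A + `|b|) ^+ 2.
  have -> : 4 * (A + `|b|) ^+ 2 = (2 * (A + `|b|)) ^+ 2 by ring.
  rewrite lerXn2r ?nnegrE ?addr_ge0 ?mulr_ge0 ?addr_ge0//.
  have : `|a| <= `|b| + `|a - b|.
    by rewrite (le_trans _ (ler_normD _ _))// addrC subrK.
  have := normr_ge0 b; lra.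
have Cr : 0 <= C * r * D by rewrite !mulr_ge0.
have := ler_wpM2l Cr aA; lra.
Qed.

End gauss.

(** * Factorization of Gaussian densities *)

Section tonelli.
Context (R : realType) d1 d2 (T1 : measurableType d1) (T2 : measurableType d2).
Context (m1 : {sigma_finite_measure set T1 -> \bar R}).
Context (m2 : {sigma_finite_measure set T2 -> \bar R}).
Context (f : T1 * T2 -> R) (mf : measurable_fun setT f) (f0 : forall z, 0 <= f z).
Let mF : measurable_fun setT (EFin \o f). Proof. exact/measurable_EFinP. Qed.
Let F0 z : (0 <= (EFin \o f) z)%E. Proof. by rewrite lee_fin. Qed.

Lemma int_swap :
  (\int[m1]_x \int[m2]_y (f (x, y))%:E = \int[m2]_y \int[m1]_x (f (x, y))%:E)%E.
Proof. exact: (@fubini_tonelli _ _ _ _ _ m1 m2 _ mF F0). Qed.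

Lemma int_prod :
  (\int[m1 \x m2]_z (f z)%:E = \int[m1]_x \int[m2]_y (f (x, y))%:E)%E.
Proof. exact: (@fubini_tonelli1 _ _ _ _ _ m1 m2 _ mF F0). Qed.

Lemma measurable_int1 : measurable_fun setT (fun x => \int[m2]_y (f (x, y))%:E)%E.
Proof. exact: (@measurable_fun_fubini_tonelli_F _ _ _ _ _ m2 _ mF F0). Qed.

End tonelli.

Section density.
Context (R : realType) d (T : measurableType d).
Import HBNNSimple.

Lemma ge0_integral_withdensity (mu nu : {measure set T -> \bar R}) (f g : T -> R) :
  measurable_fun setT f -> (forall x, 0 <= f x) ->
  (forall A, measurable A -> nu A = \int[mu]_(x in A) (f x)%:E)%E ->
  measurable_fun setT g -> (forall x, 0 <= g x) ->
  (\int[nu]_x (g x)%:E = \int[mu]_x (g x * f x)%:E)%E.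
Proof.
move=> mf f0 nuE mg g0.
have mG : measurable_fun setT (EFin \o g) by exact/measurable_EFinP.
pose s := nnsfun_approx measurableT mG.
have s_cvg x : (EFin \o s^~ x) n @[n --> \oo] --> (g x)%:E.
  by apply: cvg_nnsfun_approx => // y _; rewrite lee_fin.
transitivity (limn (fun n => \int[nu]_x (s n x)%:E)%E).
  rewrite -monotone_convergence//.
  - by apply: eq_integral => x _; apply/esym/cvg_lim => //; exact: s_cvg.
  - by move=> n; exact/measurable_EFinP.
  - by move=> n x _; rewrite lee_fin.
  - by move=> x _ m n mn; rewrite lee_fin; exact/lefP/nd_nnsfun_approx.
transitivity (limn (fun n => \int[mu]_x (s n x * f x)%:E)%E); last first.
  rewrite -monotone_convergence//.
  - apply: eq_integral => x _; apply/cvg_lim => //.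
    under eq_fun do rewrite EFinM.
    rewrite EFinM; apply: cvgeZr => //; exact: s_cvg.
  - by move=> n; apply/measurable_EFinP; exact: measurable_funM.
  - by move=> n x _; rewrite lee_fin mulr_ge0.
  - move=> x _ m n mn; rewrite lee_fin ler_wpM2r//.
    exact/lefP/nd_nnsfun_approx.
congr (limn _); apply/funext => n.
under eq_integral do rewrite fimfunE -fsumEFin//.
rewrite ge0_integral_fsum//; last 2 first.
- by move=> r; exact/measurable_EFinP/measurable_funM.
- by move=> r x _; rewrite nnfun_muleindic_ge0.
under [RHS]eq_integral => x _.
  rewrite EFinM fimfunE -fsumEFin// ge0_mule_fsuml; last first.
    by move=> r; rewrite nnfun_muleindic_ge0.
  over.
rewrite ge0_integral_fsum//; last 2 first.
- move=> r; apply: emeasurable_funM; last exact/measurable_EFinP.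
  exact/measurable_EFinP/measurable_funM.
- by move=> r x _; rewrite mule_ge0 ?nnfun_muleindic_ge0// lee_fin.
apply: eq_fsbigr => r _.
have [r0|r0] := leP 0 r; last first.
  rewrite !integral0_eq// => x _; rewrite preimage_nnfun0// indic0 mulr0//.
  by rewrite mul0e.
under eq_integral do rewrite EFinM.
rewrite ge0_integralZl_EFin//; last exact/measurable_EFinP.
under [RHS]eq_integral do rewrite EFinM -muleA.
rewrite ge0_integralZl_EFin//; last 2 first.
- by move=> x _; rewrite mule_ge0 ?lee_fin.
- apply: emeasurable_funM; exact/measurable_EFinP.
congr (_ * _)%E; rewrite integral_indic//= setIT nuE// integral_mkcond.
apply: eq_integral => x _; rewrite patchE indicE.
by case: (x \in _); rewrite (mul0e, mul1e).
Qed.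

Lemma density_probE (mu : {measure set T -> \bar R}) (f : T -> R) A :
  is_density mu f -> density_prob mu f A = (\int[mu]_(x in A) (f x)%:E)%E.
Proof. by move=> fd; rewrite /density_prob; case: pselect. Qed.

Lemma integral_density_prob (mu : {measure set T -> \bar R}) (f g : T -> R) :
  is_density mu f -> measurable_fun setT g -> (forall x, 0 <= g x) ->
  (\int[density_prob mu f]_x (g x)%:E = \int[mu]_x (g x * f x)%:E)%E.
Proof.
move=> fd mg g0; have [mf f0 _] := fd.
by apply: ge0_integral_withdensity => // A mA; exact: density_probE.
Qed.

End density.

Section factor.
Context (R : realType) (n m : nat) (G : 'M[R]_m) (C : 'M[R]_n) (H : 'M[R]_(m, n)).
Hypotheses (pG : posdefmx G) (pC : posdefmx C).

(** Kalman update of the prior covariance [C] by an observation [H u + b] with noise covariance [G],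
    in information form. [kgain] is the familiar gain [C H^T (G + H C H^T)^-1]. *)
Definition post_prec := invmx C + H^T *m invmx G *m H.
Definition post_cov := invmx post_prec.
Definition kgain := post_cov *m H^T *m invmx G.
Definition innov_cov := G + H *m C *m H^T.

Lemma posdef_prec : posdefmx post_prec.
Proof.
apply: posdefD; first exact: posdef_inv.
  by rewrite !trmx_mul trmxK (posdef_inv pG).1 mulmxA.
by move=> x; rewrite quadf_sandwich quadf_ge0//; exact: posdef_inv.
Qed.

Lemma posdef_post : posdefmx post_cov.
Proof. exact: posdef_inv posdef_prec. Qed.

Lemma posdef_innov : posdefmx innov_cov.
Proof.
apply: posdefD => //; first by rewrite !trmx_mul trmxK pC.1 mulmxA.
by move=> x; rewrite -[H in H *m C]trmxK quadf_sandwich quadf_ge0.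
Qed.

(** Woodbury identity, verified by multiplying with [innov_cov] and writing [H^T G^-1 H] as
    [post_prec - C^-1]. *)
Lemma innov_inv :
  invmx innov_cov = invmx G - invmx G *m H *m post_cov *m H^T *m invmx G.
Proof.
set T := RHS.
have uG := posdef_unit pG; have uC := posdef_unit pC.
have uP := posdef_unit posdef_prec; have uS := posdef_unit posdef_innov.
suff ST : innov_cov *m T = 1%:M.
  by apply: (can_inj (mulKmx uS)); rewrite mulmxV.
have HGH : H^T *m invmx G *m H = post_prec - invmx C by rewrite /post_prec addrC addKr.
have E : H *m C *m H^T *m (invmx G *m H *m post_cov *m H^T *m invmx G) =
    H *m C *m H^T *m invmx G - H *m post_cov *m H^T *m invmx G.
  rewrite !mulmxA -(mulmxA (H *m C)) -(mulmxA (H *m C)) HGH mulmxBr.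
  by rewrite !mulmxBl {1}/post_cov mulmxK// mulmxK// !mulmxA.
rewrite /T mulmxBr !mulmxDl mulmxV// E !mulmxA mulmxV// mul1mx.
by rewrite [X in _ - X]addrCA subrr addr0 addrK.
Qed.

(** Completing the square in [x]: the left-hand side is minimal at [kgain *m e], and the Woodbury
    identity evaluates the minimum. *)
Lemma quadf_factor x e :
  quadf (invmx G) (e - H *m x) + quadf (invmx C) x =
  quadf (invmx innov_cov) e + quadf (invmx post_cov) (x - kgain *m e).
Proof.
have uP := posdef_unit posdef_prec.
have symG := (posdef_inv pG).1; have symP := posdef_prec.1.
have symPV := posdef_post.1.
rewrite innov_inv [in RHS]/post_cov invmxK !quadfB//.
set T := _ *m invmx G.
have -> : quadf (invmx G - T) e = quadf (invmx G) e - quadf T e.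
  by rewrite quadfDl -[- T]scaleN1r quadfZl mulN1r.
have -> : quadf post_prec x = quadf (invmx C) x + quadf (invmx G) (H *m x).
  by rewrite /post_prec quadfDl quadf_sandwich.
have PK : post_prec *m (kgain *m e) = H^T *m invmx G *m e.
  by rewrite /kgain /post_cov !mulmxA mulmxV// mul1mx.
have -> : quadf post_prec (kgain *m e) = quadf T e.
  rewrite /quadf -mulmxA PK trmx_mul; congr (fun_of_matrix _ 0 0).
  by rewrite /kgain !trmx_mul trmxK symG symPV /T !mulmxA.
have -> : (x^T *m post_prec *m (kgain *m e)) 0 0 =
    (e^T *m invmx G *m (H *m x)) 0 0.
  rewrite -mulmxA PK -[in LHS](trmxK (x^T *m _)) mxE !trmx_mul !trmxK symG.
  by rewrite !mulmxA.
by ring.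
Qed.

(** By [quadf_factor] the exponents agree, so the two sides differ by a constant factor [rho]. Both
    are probability densities in [(u, y)], which forces [rho = 1] and replaces a comparison of
    determinants. *)
Lemma gauss_factor b c u y :
  gauss_pdf G (H *m u + b) y * gauss_pdf C c u =
  gauss_pdf innov_cov (H *m c + b) y *
  gauss_pdf post_cov (c + kgain *m (y - (H *m c + b))) u.
Proof.
have [f1 f1E] := opaque_copy (fun w : 'cV[R]_n * 'cV[R]_m =>
  gauss_pdf G (H *m w.1 + b) w.2 * gauss_pdf C c w.1).
have [f2 f2E] := opaque_copy (fun w : 'cV[R]_n * 'cV[R]_m =>
  gauss_pdf innov_cov (H *m c + b) w.2 *
  gauss_pdf post_cov (c + kgain *m (w.2 - (H *m c + b))) w.1).
have f2_ge0 w : 0 <= f2 w.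
  by rewrite f2E mulr_ge0 ?gauss_ge0//; [exact: posdef_innov|exact: posdef_post].
have mf2 : measurable_fun setT f2 by rewrite f2E; mfun.
have int1 : (\int[lebesgue_cV R n]_u \int[lebesgue_cV R m]_y (f1 (u, y))%:E = 1)%E.
  rewrite -(integral_gauss pC c); apply: eq_integral => v _.
  rewrite f1E/=; under eq_integral do rewrite mulrC.
  rewrite int_scale ?gauss_ge0//; first by rewrite integral_gauss ?mule1.
    by mfun.
  by move=> z; rewrite gauss_ge0.
have int2 : (\int[lebesgue_cV R n]_u \int[lebesgue_cV R m]_y (f2 (u, y))%:E = 1)%E.
  rewrite int_swap// -(integral_gauss posdef_innov (H *m c + b)).
  apply: eq_integral => v _; rewrite f2E/=.
  set a := c + _.
  have mp : measurable_fun setT (gauss_pdf post_cov a) by mfun.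
  rewrite (int_scale _ mp (gauss_ge0 posdef_innov _ _)
    (fun x => gauss_ge0 posdef_post a x)).
  by rewrite (integral_gauss posdef_post) mule1.
have [rho rho0 rhoE] : exists2 rho, 0 <= rho & forall w, f1 w = rho * f2 w.
  have := gauss_cst_gt0 pG; have := gauss_cst_gt0 pC.
  have := gauss_cst_gt0 posdef_innov; have := gauss_cst_gt0 posdef_post.
  set c1 := _^-1; set c2 := _^-1; set c3 := _^-1; set c4 := _^-1.
  move=> c1_gt0 c2_gt0 c3_gt0 c4_gt0.
  exists (c4 * c3 / (c1 * c2)).
    by rewrite divr_ge0 ?mulr_ge0 ?ltW.
  move=> [v z]; rewrite f1E f2E/=.
  rewrite (gauss_pdfE pG) (gauss_pdfE pC) (gauss_pdfE posdef_innov).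
  rewrite (gauss_pdfE posdef_post) -/c1 -/c2 -/c3 -/c4.
  have := quadf_factor (v - c) (z - (H *m c + b)).
  have -> : z - (H *m c + b) - H *m (v - c) = z - (H *m v + b).
    rewrite mulmxBr; move: (H *m c) (H *m v) => p q.
    by apply/colP => i; rewrite !mxE; ring.
  rewrite [in _ -> _](opprD c) (addrA v).
  set q1 := quadf _ _; set q2 := quadf _ _; set q3 := quadf _ _; set q4 := quadf _ _.
  move=> qE.
  have -> : expR (- (2^-1 * q3)) = expR (- (2^-1 * q1)) * expR (- (2^-1 * q2)) * expR (2^-1 * q4).
    rewrite -!expRD; congr expR; lra.
  have -> : expR (2^-1 * q4) = (expR (- (2^-1 * q4)))^-1 by rewrite expRN invrK.
  by field; rewrite !gt_eqF ?expR_gt0.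
have : (1 = rho%:E * 1)%E.
  rewrite -[in RHS]int2 -[LHS]int1.
  have mf2v v : measurable_fun setT (fun z => f2 (v, z)).
    exact: (measurableT_comp mf2 (measurable_pair1 v)).
  rewrite -ge0_integralZl_EFin//; [|by move=> v _; apply: int_ge0|exact: measurable_int1].
  apply: eq_integral => v _.
  rewrite -(int_scale _ (mf2v v) rho0 (fun z => f2_ge0 (v, z))).
  by apply: eq_integral => z _; rewrite rhoE.
rewrite mule1 => -[rho1].
by have := rhoE (u, y); rewrite -rho1 mul1r f1E f2E.
Qed.

End factor.

(** * Closeness of measures *)

Section gexp.
Context (R : realType).

Lemma EFin_leD (x y c : R) X Y : (x%:E = X)%E -> (y%:E = Y)%E ->
  (X <= Y + c%:E)%E -> x <= y + c.
Proof. by move=> <- <-; rewrite -EFinD lee_fin. Qed.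

(** A real number, so that it can serve as a test function in turn. By [gexpE] the default value of
    [fine] does not occur for functions of polynomial growth. *)
Definition gexp n (S : 'M[R]_n) (a : 'cV[R]_n) (f : 'cV[R]_n -> R) : R :=
  fine (\int[lebesgue_cV R n]_x (f x * gauss_pdf S a x)%:E)%E.

Lemma gexp_ge0 n (S : 'M[R]_n) a f : posdefmx S -> (forall x, 0 <= f x) ->
  0 <= gexp S a f.
Proof.
by move=> pS f0; apply/fine_ge0/int_ge0 => x; rewrite mulr_ge0 ?gauss_ge0.
Qed.

Lemma measurable_gexp n (S : 'M[R]_n) d (T : measurableType d)
    (F : T * 'cV[R]_n -> R) (a : T -> 'cV[R]_n) :
  posdefmx S -> measurable_fun setT F -> (forall w, 0 <= F w) ->
  measurable_fun setT a ->
  measurable_fun setT (fun t => gexp S (a t) (fun x => F (t, x))).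
Proof.
move=> pS mF F0 ma; apply: (measurableT_comp (@fine_measurable _ setT measurableT)).
pose H w := F w * gauss_pdf S (a w.1) w.2.
apply: (@measurable_int1 _ _ _ _ _ (lebesgue_cV R n) H).
  by rewrite /H; mfun.
by move=> w; rewrite mulr_ge0 ?gauss_ge0.
Qed.

Section bounds.
Context n (S : 'M[R]_n) (pS : posdefmx S).
Implicit Types (A r : R) (a b : 'cV[R]_n) (f : 'cV[R]_n -> R) (k : nat).

Lemma gexpE k A a f : measurable_fun setT f -> 1 <= A ->
  (forall x, 0 <= f x <= (A + `|x|) ^+ k) ->
  ((gexp S a f)%:E = \int[lebesgue_cV R n]_x (f x * gauss_pdf S a x)%:E)%E.
Proof.
move=> mf A1 fA; rewrite fineK//.
have f0 x : 0 <= f x by case/andP: (fA x).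
have [C C0 CP] := gauss_growth pS k.
rewrite ge0_fin_numE; last by apply: int_ge0 => x; rewrite mulr_ge0 ?gauss_ge0.
apply: le_lt_trans (ltry (C * (A + `|a|) ^+ k)).
apply: le_trans (CP A a A1); apply: int_le; [by mfun|by mfun| |] => x.
  by rewrite mulr_ge0 ?gauss_ge0.
by rewrite ler_wpM2r ?gauss_ge0//; case/andP: (fA x).
Qed.

Lemma gexp_le k : exists2 C, 0 <= C & forall A a f,
  measurable_fun setT f -> 1 <= A -> (forall x, 0 <= f x <= (A + `|x|) ^+ k) ->
  gexp S a f <= C * (A + `|a|) ^+ k.
Proof.
have [C C0 CP] := gauss_growth pS k; exists C => // A a f mf A1 fA.
rewrite -lee_fin (gexpE a mf A1 fA) (le_trans _ (CP A a A1))//.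
apply: int_le; [by mfun|by mfun| |] => x; case/andP: (fA x) => f0 fx.
  by rewrite mulr_ge0 ?gauss_ge0.
by rewrite ler_wpM2r ?gauss_ge0.
Qed.

Lemma gexp_lip : exists2 C, 0 <= C & forall A r a b f,
  1 <= A -> `|a - b| <= r -> r <= 1 -> measurable_fun setT f ->
  (forall x, 0 <= f x <= (A + `|x|) ^+ 2) ->
  gexp S a f <= gexp S b f + C * r * (A + `|b|) ^+ 2.
Proof.
have [C C0 CP] := gauss_lip_int pS; exists C => // A r a b f A1 ab r1 mf fA.
exact: EFin_leD (gexpE a mf A1 fA) (gexpE b mf A1 fA) (CP A r a b f A1 ab r1 mf fA).
Qed.

End bounds.
End gexp.

Section closeness.
Context (R : realType) d (T : measurableType d).
Implicit Types (mu nu : {measure set T -> \bar R}) (W f : T -> R).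

(** Two one-sided inequalities replace a difference, so that the notion presupposes no finiteness
    and never subtracts infinities. *)
Definition mclose W (e : R) mu nu := forall f, measurable_fun setT f ->
  (forall x, 0 <= f x <= W x) ->
  (\int[mu]_x (f x)%:E <= \int[nu]_x (f x)%:E + e%:E)%E /\
  (\int[nu]_x (f x)%:E <= \int[mu]_x (f x)%:E + e%:E)%E.

Lemma mclose_sym W e mu nu : mclose W e mu nu -> mclose W e nu mu.
Proof. by move=> H f mf fW; have [? ?] := H f mf fW. Qed.

Lemma mclose_refl W e mu : 0 <= e -> mclose W e mu mu.
Proof. by move=> e0 f mf fW; split; rewrite leeDl// lee_fin. Qed.

Lemma mclose_scale W e mu nu C f : mclose W e mu nu -> 0 < C ->
  measurable_fun setT f -> (forall x, 0 <= f x <= C * W x) ->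
  (\int[mu]_x (f x)%:E <= \int[nu]_x (f x)%:E + (C * e)%:E)%E.
Proof.
move=> cl C0 mf fW; have Cn0 : C != 0 by rewrite gt_eqF.
have mg : measurable_fun setT (fun x => C^-1 * f x) by mfun.
have g0 x : 0 <= C^-1 * f x.
  by rewrite mulr_ge0 ?invr_ge0 ?(ltW C0)//; case/andP: (fW x).
have gW x : 0 <= C^-1 * f x <= W x.
  by rewrite g0 mulrC ler_pdivrMr// mulrC; case/andP: (fW x).
have [H _] := cl _ mg gW.
have E (m : {measure set T -> \bar R}) :
    (\int[m]_x (f x)%:E = C%:E * \int[m]_x (C^-1 * f x)%:E)%E.
  rewrite -(int_scale _ mg (ltW C0) g0); apply: eq_integral => x _.
  by rewrite mulVKf.
rewrite !E EFinM -muleDr//; last exact: fin_num_adde_defl.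
by rewrite lee_wpmul2l// lee_fin ltW.
Qed.

End closeness.

Section kernel.
Context (R : realType).
Local Notation wt2 := (fun v => wt v ^+ 2).

(** Two replacements: the mean [a] by [a0] under [mu], at the cost of [eps] times the second moment,
    then [mu] by [nu], tested on the expectation [g0], which grows quadratically. As [F] may depend
    on both variables, the lemma covers prediction and observation. *)
Lemma kernel_close n (S : 'M[R]_n) (kap : R) : posdefmx S -> 0 <= kap ->
  exists2 C, 0 <= C & forall m (mu nu : {measure set 'cV[R]_m -> \bar R})
    (del eps B : R) (a a0 : 'cV[R]_m -> 'cV[R]_n) (F : 'cV[R]_m * 'cV[R]_n -> R),
  0 <= del -> eps <= 1 -> 0 <= B ->
  measurable_fun setT a -> measurable_fun setT a0 ->
  (forall v, `|a v - a0 v| <= eps) -> (forall v, `|a0 v| <= kap * wt v) ->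
  mclose wt2 del mu nu -> (\int[mu]_v (wt v ^+ 2)%:E <= B%:E)%E ->
  measurable_fun setT F ->
  (forall v x, 0 <= F (v, x) <= (wt v + `|x|) ^+ 2) ->
  (\int[mu]_v (gexp S (a v) (fun x => F (v, x)))%:E <=
    \int[nu]_v (gexp S (a0 v) (fun x => F (v, x)))%:E +
    (C * (eps * B + del))%:E /\
  \int[nu]_v (gexp S (a0 v) (fun x => F (v, x)))%:E <=
    \int[mu]_v (gexp S (a v) (fun x => F (v, x)))%:E +
    (C * (eps * B + del))%:E)%E.
Proof.
move=> pS kap0.
have [C1 C10 le1] := gexp_le pS 2; have [C2 C20 lip2] := gexp_lip pS.
(* [D1] dominates [g0], with 1 added because [mclose_scale] needs a positive factor. [D2] contains
   [2 + kap] because [wt v] is added to [|a v|], itself at most [(1 + kap) * wt v]. *)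
pose D1 := C1 * (1 + kap) ^+ 2 + 1; pose D2 := C2 * (2 + kap) ^+ 2.
have D10 : 0 < D1 by rewrite ltr_wpDl// mulr_ge0// exprn_ge0// addr_ge0.
have D20 : 0 <= D2 by rewrite mulr_ge0// exprn_ge0// addr_ge0.
exists (D1 + D2) => [|m mu nu del eps B a a0 F del0 eps1 B0 ma ma0 aa0 a0k cl muB mF Fw].
  by rewrite addr_ge0// ltW.
have eps0 : 0 <= eps by rewrite (le_trans _ (aa0 0)).
have F0 w : 0 <= F w by case: w => v x; case/andP: (Fw v x).
have mFv v : measurable_fun setT (fun x => F (v, x)).
  by apply: (measurableT_comp mF); exact: measurable_pair1.
have [g gE] := opaque_copy (fun v => gexp S (a v) (fun x => F (v, x))).
have [g0 g0E] := opaque_copy (fun v => gexp S (a0 v) (fun x => F (v, x))).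
have mg : measurable_fun setT g by rewrite gE; exact: measurable_gexp.
have mg0 : measurable_fun setT g0 by rewrite g0E; exact: measurable_gexp.
have gp v : 0 <= g v by rewrite gE gexp_ge0.
have g0p v : 0 <= g0 v by rewrite g0E gexp_ge0.
suff : (\int[mu]_v (g v)%:E <=
    \int[nu]_v (g0 v)%:E + ((D1 + D2) * (eps * B + del))%:E /\
  \int[nu]_v (g0 v)%:E <=
    \int[mu]_v (g v)%:E + ((D1 + D2) * (eps * B + del))%:E)%E by rewrite gE g0E.
have g0W v : 0 <= g0 v <= D1 * wt v ^+ 2.
  rewrite g0p/= g0E (le_trans (le1 _ _ _ (mFv v) (wt_ge1 v) (Fw v)))//.
  rewrite mulrDl mul1r ler_wpDr ?exprn_ge0 ?wt_ge0// -mulrA ler_wpM2l//.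
  rewrite -exprMn lerXn2r ?nnegrE ?mulr_ge0 ?addr_ge0 ?wt_ge0//.
  by rewrite mulrDl mul1r lerD2l.
have aK v : `|a v| <= (1 + kap) * wt v.
  have : `|a v| <= `|a0 v| + `|a v - a0 v|.
    by rewrite (le_trans _ (ler_normD _ _))// addrC subrK.
  have := aa0 v; have := a0k v; have := wt_ge1 v; nra.
have growth (b : 'cV[R]_n) (v : 'cV[R]_m) : `|b| <= (1 + kap) * wt v ->
    C2 * eps * (wt v + `|b|) ^+ 2 <= D2 * eps * wt v ^+ 2.
  move=> bK; rewrite /D2 -[leRHS]mulrA [leRHS]mulrAC -[leLHS]mulrA.
  have -> : C2 * (eps * wt v ^+ 2) * (2 + kap) ^+ 2 =
            C2 * (eps * ((2 + kap) * wt v) ^+ 2) by ring.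
  rewrite ler_wpM2l// ler_wpM2l// lerXn2r ?nnegrE ?mulr_ge0 ?addr_ge0 ?wt_ge0//.
  by have := wt_ge1 v; move: bK; nra.
have gle v : g v <= g0 v + D2 * eps * wt v ^+ 2.
  rewrite gE g0E (le_trans (lip2 _ _ _ _ _ (wt_ge1 v) (aa0 v) eps1 (mFv v) (Fw v)))//.
  rewrite lerD2l growth// (le_trans (a0k v))// ler_wpM2r ?wt_ge0//.
  by rewrite lerDr.
have g0le v : g0 v <= g v + D2 * eps * wt v ^+ 2.
  have a0a : `|a0 v - a v| <= eps by rewrite distrC.
  rewrite gE g0E (le_trans (lip2 _ _ _ _ _ (wt_ge1 v) a0a eps1 (mFv v) (Fw v)))//.
  by rewrite lerD2l growth.
have mw : measurable_fun setT (fun v : 'cV[R]_m => wt v ^+ 2) by mfun.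
have w0 (v : 'cV[R]_m) : 0 <= wt v ^+ 2 by rewrite exprn_ge0 ?wt_ge0.
have De0 : 0 <= D2 * eps by rewrite mulr_ge0.
have mDw : measurable_fun setT (fun v : 'cV[R]_m => D2 * eps * wt v ^+ 2) by mfun.
have Dw0 (v : 'cV[R]_m) : 0 <= D2 * eps * wt v ^+ 2 by rewrite mulr_ge0.
have err (f1 f2 : 'cV[R]_m -> R) : measurable_fun setT f1 -> measurable_fun setT f2 ->
    (forall v, 0 <= f1 v) -> (forall v, 0 <= f2 v) ->
    (forall v, f1 v <= f2 v + D2 * eps * wt v ^+ 2) ->
    (\int[mu]_v (f1 v)%:E <= \int[mu]_v (f2 v)%:E + (D2 * (eps * B))%:E)%E.
  move=> mf1 mf2 f10 f20 f12.
  apply: (le_trans (int_le _ mf1 (measurable_funD mf2 mDw) f10 f12)).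
  rewrite (int_add _ mf2 mDw f20 Dw0) leeD2l// (int_scale _ mw De0 w0).
  by rewrite mulrA [leRHS]EFinM lee_wpmul2l ?lee_fin.
have cst : D1 * del + D2 * (eps * B) <= (D1 + D2) * (eps * B + del).
  have : 0 <= eps * B by rewrite mulr_ge0.
  by move: (eps * B) => t t0; nra.
split.
- apply: (le_trans (err _ _ mg mg0 gp g0p gle)).
  apply: (le_trans (leeD2r _ (mclose_scale cl D10 mg0 g0W))).
  by rewrite -addeA leeD2l// -EFinD lee_fin.
- apply: (le_trans (mclose_scale (mclose_sym cl) D10 mg0 g0W)).
  apply: (le_trans (leeD2r _ (err _ _ mg0 mg g0p gp g0le))).
  by rewrite -addeA leeD2l// -EFinD lee_fin addrC.
Qed.

End kernel.

(** * Predictive, joint and conditional laws *)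

Section prob_integrals.
Context (R : realType) d (T : measurableType d) (P : probability T R).

Lemma int_prob_cst (c : R) : (\int[P]_x c%:E = c%:E)%E.
Proof.
rewrite integral_cst//.
transitivity (c%:E * 1)%E; last by rewrite mule1.
by congr (_ * _)%E; exact: probability_setT.
Qed.

Lemma int_prob_le (f : T -> R) (c : R) : measurable_fun setT f ->
  (forall x, 0 <= f x <= c) -> (\int[P]_x (f x)%:E <= c%:E)%E.
Proof.
move=> mf fc; rewrite -[leRHS]int_prob_cst.
by apply: int_le => // x; case/andP: (fc x).
Qed.

Lemma int_fin_num (mu : {measure set T -> \bar R}) (f : T -> R) (c : R) :
  (forall x, 0 <= f x) -> (\int[mu]_x (f x)%:E <= c%:E)%E ->
  (\int[mu]_x (f x)%:E)%E \is a fin_num.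
Proof.
move=> f0 fc; rewrite ge0_fin_numE ?int_ge0//.
by apply: le_lt_trans fc _; rewrite ltry.
Qed.

End prob_integrals.

Section predict.
Context (R : realType) (n m : nat) (S : 'M[R]_n) (pS : posdefmx S).
Context (mu : probability 'cV[R]_m R) (a : 'cV[R]_m -> 'cV[R]_n).
Hypothesis ma : measurable_fun setT a.
Local Notation leb := (lebesgue_cV R n).

(** [predict_pdf] with independent source and target dimensions; for equal dimensions the two are
    convertible, which identifies the estimates below with statements about the filters. *)
Definition mixture_pdf : 'cV[R]_n -> R :=
  fun u => (\int[mu]_v gauss_pdf S (a v) u)%R.

Lemma mixture_pdfE u :
  ((mixture_pdf u)%:E = \int[mu]_v (gauss_pdf S (a v) u)%:E)%E.
Proof.
rewrite /mixture_pdf fineK//; have [C C0 CP] := gauss_bound pS 0.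
apply: (int_fin_num (c := C)); first by move=> v; rewrite gauss_ge0.
apply: int_prob_le; [by mfun|move=> v; rewrite gauss_ge0//=].
by have := CP (a v) u; rewrite expr0 mul1r.
Qed.

Lemma mixture_pdf_ge0 u : 0 <= mixture_pdf u.
Proof. by apply/fine_ge0/int_ge0 => v; rewrite gauss_ge0. Qed.

Lemma measurable_mixture_pdf : measurable_fun setT mixture_pdf.
Proof.
apply: (measurableT_comp (@fine_measurable _ setT measurableT)).
have [H HE] := opaque_copy (fun w : 'cV[R]_n * 'cV[R]_m => gauss_pdf S (a w.2) w.1).
have mH : measurable_fun setT H by rewrite HE; mfun.
have H0 w : 0 <= H w by rewrite HE gauss_ge0.
by have := measurable_int1 mu mH H0; rewrite HE.
Qed.

Lemma int_mixture (f : 'cV[R]_n -> R) : measurable_fun setT f -> (forall x, 0 <= f x) ->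
  (\int[leb]_u (f u * mixture_pdf u)%:E =
   \int[mu]_v \int[leb]_u (f u * gauss_pdf S (a v) u)%:E)%E.
Proof.
move=> mf f0.
have [H HE] := opaque_copy (fun w : 'cV[R]_m * 'cV[R]_n =>
  f w.2 * gauss_pdf S (a w.1) w.2).
have mH : measurable_fun setT H by rewrite HE; mfun.
have H0 w : 0 <= H w by rewrite HE mulr_ge0 ?gauss_ge0.
have := int_swap mu leb mH H0; rewrite HE/= => ->.
apply: eq_integral => u _; rewrite int_scale ?EFinM ?mixture_pdfE//; first by mfun.
by move=> v; rewrite gauss_ge0.
Qed.

Lemma mixture_density : is_density leb mixture_pdf.
Proof.
split; [exact: measurable_mixture_pdf|exact: mixture_pdf_ge0|].
transitivity (\int[leb]_u (1 * mixture_pdf u)%:E)%E.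
  by apply: eq_integral => u _; rewrite mul1r.
rewrite (int_mixture (f := fun=> 1))//.
rewrite -[RHS](int_prob_cst mu); apply: eq_integral => v _.
by under eq_integral do rewrite mul1r; rewrite integral_gauss.
Qed.

Lemma law_mixture k (f : 'cV[R]_n -> R) : measurable_fun setT f -> (forall x, 0 <= f x <= wt x ^+ k) ->
  (\int[density_prob leb mixture_pdf]_u (f u)%:E =
   \int[mu]_v (gexp S (a v) f)%:E)%E.
Proof.
move=> mf fw; have f0 x : 0 <= f x by case/andP: (fw x).
rewrite (integral_density_prob mixture_density mf f0) int_mixture//.
apply: eq_integral => v _.
by rewrite (gexpE pS (a v) mf (lexx 1) fw).
Qed.

End predict.

Section joint.
Context (R : realType) (n m : nat) (S : 'M[R]_m) (pS : posdefmx S).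
Context (h : 'cV[R]_n -> 'cV[R]_m) (mh : measurable_fun setT h).
Context (r : 'cV[R]_n -> R).
Local Notation lebn := (lebesgue_cV R n).
Local Notation lebm := (lebesgue_cV R m).
Hypothesis rd : is_density lebn r.
Let rho := density_prob lebn r.

Let mr : measurable_fun setT r. Proof. by case: rd. Qed.
Let r0 u : 0 <= r u. Proof. by case: rd. Qed.

Lemma measurable_joint : measurable_fun setT (joint_pdf S h r).
Proof. by rewrite /joint_pdf; mfun. Qed.

Lemma joint_ge0 w : 0 <= joint_pdf S h r w.
Proof. by rewrite mulr_ge0 ?gauss_ge0. Qed.

Lemma int_joint (F : 'cV[R]_n * 'cV[R]_m -> R) : measurable_fun setT F ->
  (forall w, 0 <= F w) ->
  (\int[lebn \x lebm]_w (F w * joint_pdf S h r w)%:E =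
   \int[lebn]_u \int[lebm]_y (r u * (F (u, y) * gauss_pdf S (h u) y))%:E)%E.
Proof.
move=> mF F0.
have [H HE] := opaque_copy (fun w => F w * joint_pdf S h r w).
have mH : measurable_fun setT H.
  by rewrite HE; exact: measurable_funM mF measurable_joint.
have H0 w : 0 <= H w by rewrite HE mulr_ge0 ?joint_ge0.
have := int_prod lebn lebm mH H0; rewrite HE => ->.
apply: eq_integral => u _; apply: eq_integral => y _.
by rewrite /joint_pdf/= mulrA mulrC.
Qed.

Lemma joint_density : is_density (lebn \x lebm)%E (joint_pdf S h r).
Proof.
split; [exact: measurable_joint|exact: joint_ge0|].
transitivity (\int[lebn \x lebm]_w (1 * joint_pdf S h r w)%:E)%E.
  by apply: eq_integral => w _; rewrite mul1r.
rewrite (int_joint (F := fun=> 1))//; case: rd => _ _ <-.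
apply: eq_integral => u _.
under eq_integral do rewrite mul1r.
rewrite int_scale//; first by rewrite integral_gauss// mule1.
  by mfun.
by move=> y; rewrite gauss_ge0.
Qed.

Lemma law_joint_iter (F : 'cV[R]_n * 'cV[R]_m -> R) : measurable_fun setT F ->
  (forall w, 0 <= F w) ->
  (\int[density_prob (lebn \x lebm) (joint_pdf S h r)]_w (F w)%:E =
   \int[lebn]_u \int[lebm]_y (r u * (F (u, y) * gauss_pdf S (h u) y))%:E)%E.
Proof.
move=> mF F0; rewrite -int_joint//.
exact: integral_density_prob joint_density mF F0.
Qed.

Lemma law_joint k (F : 'cV[R]_n * 'cV[R]_m -> R) : measurable_fun setT F ->
  (forall u y, 0 <= F (u, y) <= (wt u + `|y|) ^+ k) ->
  (\int[density_prob (lebn \x lebm) (joint_pdf S h r)]_w (F w)%:E =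
   \int[rho]_u (gexp S (h u) (fun y => F (u, y)))%:E)%E.
Proof.
move=> mF Fw.
have F0 w : 0 <= F w by case: w => u y; case/andP: (Fw u y).
have mg : measurable_fun setT (fun u => gexp S (h u) (fun y => F (u, y))).
  exact: measurable_gexp.
have g0 u : 0 <= gexp S (h u) (fun y => F (u, y)) by exact: gexp_ge0.
rewrite law_joint_iter// (integral_density_prob rd mg g0).
have mFu u : measurable_fun setT (fun y => F (u, y)).
  by apply: (measurableT_comp mF); exact: measurable_pair1.
apply: eq_integral => u _.
have mFg : measurable_fun setT (fun y => F (u, y) * gauss_pdf S (h u) y).
  by have mFu' := mFu u; mfun.
rewrite (int_scale _ mFg (r0 u)); last by move=> y; rewrite mulr_ge0 ?gauss_ge0.
by rewrite -(gexpE pS (h u) (mFu u) (wt_ge1 u) (Fw u)) -EFinM mulrC.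
Qed.

Section condition.
Context (y : 'cV[R]_m).
Let l u := gauss_pdf S (h u) y.
Let Z := (\int[rho]_u l u)%R.
Hypothesis Z_gt0 : 0 < Z.

Lemma cond_normE : (Z%:E = \int[rho]_u (gauss_pdf S (h u) y)%:E)%E.
Proof.
rewrite /Z fineK//; have [C C0 CP] := gauss_bound pS 0.
apply: (int_fin_num (c := C)); first by move=> v; rewrite gauss_ge0.
apply: int_prob_le; [by rewrite /l; mfun|move=> v; rewrite gauss_ge0//=].
by have := CP (h v) y; rewrite expr0 mul1r.
Qed.

Lemma condition_pdfE u :
  condition_pdf y (joint_pdf S h r) u = Z^-1 * gauss_pdf S (h u) y * r u.
Proof.
rewrite /condition_pdf /joint_pdf/= [LHS]mulrC mulrA; congr (_^-1 * _ * _).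
rewrite /Z; congr fine; rewrite /l integral_density_prob//; first by mfun.
by move=> v; rewrite gauss_ge0.
Qed.

Lemma int_condition (f : 'cV[R]_n -> R) : measurable_fun setT f -> (forall u, 0 <= f u) ->
  (\int[lebn]_u (f u * condition_pdf y (joint_pdf S h r) u)%:E =
   (Z^-1)%:E * \int[rho]_u (f u * gauss_pdf S (h u) y)%:E)%E.
Proof.
move=> mf f0.
have mfl : measurable_fun setT (fun u => f u * gauss_pdf S (h u) y) by mfun.
have fl0 u : 0 <= f u * gauss_pdf S (h u) y by rewrite mulr_ge0 ?gauss_ge0.
rewrite (integral_density_prob rd mfl fl0) -int_scale.
- by apply: eq_integral => u _; rewrite condition_pdfE; congr EFin; ring.
- by mfun.
- by rewrite invr_ge0 ltW.
- by move=> u; rewrite mulr_ge0.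
Qed.

Lemma condition_density : is_density lebn (condition_pdf y (joint_pdf S h r)).
Proof.
split.
- rewrite (_ : condition_pdf _ _ = fun u => Z^-1 * gauss_pdf S (h u) y * r u).
    by mfun.
  by apply/funext => u; rewrite condition_pdfE.
- by move=> u; rewrite condition_pdfE !mulr_ge0 ?gauss_ge0// invr_ge0 ltW.
- transitivity (\int[lebn]_u (1 * condition_pdf y (joint_pdf S h r) u)%:E)%E.
    by apply: eq_integral => u _; rewrite mul1r.
  rewrite (int_condition (f := fun=> 1))//.
  under eq_integral do rewrite mul1r.
  by rewrite -cond_normE -EFinM mulVf// gt_eqF.
Qed.

Lemma law_condition (f : 'cV[R]_n -> R) : measurable_fun setT f -> (forall u, 0 <= f u) ->
  (\int[density_prob lebn (condition_pdf y (joint_pdf S h r))]_u (f u)%:E =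
   (Z^-1)%:E * \int[rho]_u (f u * gauss_pdf S (h u) y)%:E)%E.
Proof.
by move=> mf f0; rewrite (integral_density_prob condition_density mf f0) int_condition.
Qed.

End condition.
End joint.

(** * Covariances and gains *)

Section signed.
Context (R : realType) d (T : measurableType d).
Implicit Types (mu nu : {measure set T -> \bar R}) (W f : T -> R).

Lemma integral_posneg mu f : measurable_fun setT f ->
  (\int[mu]_x (f x)%:E = \int[mu]_x (Num.max (f x) 0)%:E -
                         \int[mu]_x (Num.max (- f x) 0)%:E)%E.
Proof.
move=> mf; rewrite integralE; congr (_ - _)%E; apply: eq_integral => x _.
  by rewrite funeposE -EFin_max.
by rewrite funenegE -EFinN -EFin_max.
Qed.

Lemma measurable_pospart f : measurable_fun setT f ->
  measurable_fun setT (fun x => Num.max (f x) 0).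
Proof. by move=> mf; apply: measurable_maxr. Qed.

Lemma max0_ge0 (x : R) : 0 <= Num.max x 0.
Proof. by rewrite le_max lexx orbT. Qed.

Lemma max0_le (x c : R) : `|x| <= c -> Num.max x 0 <= c.
Proof.
move=> xc; rewrite ge_max (le_trans _ xc) ?normr_ge0 ?ler_norm//.
by rewrite (le_trans _ xc).
Qed.

(** The positive and the negative part each contribute [C * e]. The real witnesses record that both
    integrals are finite. *)
Lemma signed_close W (e B : R) mu nu (C : R) f : mclose W e mu nu -> 0 < C ->
  measurable_fun setT W -> (forall x, 0 <= W x) ->
  (\int[nu]_x (W x)%:E <= B%:E)%E ->
  measurable_fun setT f -> (forall x, `|f x| <= C * W x) ->
  exists x y, [/\ (\int[mu]_x (f x)%:E = x%:E)%E, (\int[nu]_x (f x)%:E = y%:E)%E,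
    `|x - y| <= 2 * (C * e) & `|y| <= C * B].
Proof.
move=> cl C0 mW W0 nuW mf fW.
have mp := measurable_pospart mf.
have mq : measurable_fun setT (fun x => Num.max (- f x) 0).
  by apply: measurable_pospart; mfun.
have pW x : 0 <= Num.max (f x) 0 <= C * W x by rewrite max0_ge0 max0_le.
have qW x : 0 <= Num.max (- f x) 0 <= C * W x by rewrite max0_ge0 max0_le ?normrN.
have part (g : T -> R) : measurable_fun setT g -> (forall x, 0 <= g x <= C * W x) ->
    exists x y, [/\ (\int[mu]_x (g x)%:E = x%:E)%E, (\int[nu]_x (g x)%:E = y%:E)%E,
      `|x - y| <= C * e & 0 <= y <= C * B].
  move=> mg gW; have g0 x : 0 <= g x by case/andP: (gW x).
  have H1 := mclose_scale cl C0 mg gW.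
  have H2 := mclose_scale (mclose_sym cl) C0 mg gW.
  have H3 : (\int[nu]_x (g x)%:E <= (C * B)%:E)%E.
    apply: (@le_trans _ _ (\int[nu]_x (C * W x)%:E)%E).
      by apply: int_le => // [|x]; [mfun|case/andP: (gW x)].
    by rewrite int_scale ?(ltW C0)// EFinM lee_wpmul2l// lee_fin ltW.
  have Fnu := int_fin_num g0 H3.
  have Fmu : (\int[mu]_x (g x)%:E)%E \is a fin_num.
    apply: (int_fin_num (c := fine (\int[nu]_x (g x)%:E) + C * e) g0).
    by rewrite EFinD fineK.
  exists (fine (\int[mu]_x (g x)%:E)), (fine (\int[nu]_x (g x)%:E)).
  rewrite !fineK//; split => //.
    rewrite ler_norml lerBrDr lerBlDr addrC lerBlDr -!lee_fin !EFinD !fineK//.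
    by rewrite H2 addeC H1.
  by rewrite -!lee_fin fineK// H3 int_ge0.
have [p1 [p2 [Ep1 Ep2 pe /andP[p20 p2B]]]] := part _ mp pW.
have [q1 [q2 [Eq1 Eq2 qe /andP[q20 q2B]]]] := part _ mq qW.
exists (p1 - q1), (p2 - q2).
rewrite (integral_posneg mu mf) (integral_posneg nu mf) Ep1 Ep2 Eq1 Eq2.
split; [by []|by []| |].
  have -> : p1 - q1 - (p2 - q2) = (p1 - p2) - (q1 - q2) by ring.
  by rewrite (le_trans (ler_normB _ _))// mulr_natl mulr2n lerD.
by rewrite ler_norml; apply/andP; split; lra.
Qed.

End signed.

Section expect.
Context (R : realType) d (T : measurableType d) (P : probability T R).
Implicit Types (W f g : T -> R) (C c : R).

Definition Ex f : R := fine (\int[P]_x (f x)%:E)%E.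
Definition intg f := P.-integrable setT (EFin \o f).

Lemma intg_dominated W C f : measurable_fun setT f -> measurable_fun setT W ->
  (forall x, 0 <= W x) -> (\int[P]_x (W x)%:E < +oo)%E -> 0 <= C ->
  (forall x, `|f x| <= C * W x) -> intg f.
Proof.
move=> mf mW W0 iW C0 fW; apply/integrableP; split; first exact/measurable_EFinP.
apply: (@le_lt_trans _ _ (\int[P]_x (C * W x)%:E)%E).
  by apply: int_le => //=; mfun.
by rewrite int_scale// lte_mul_pinfty.
Qed.

Lemma intgD f g : intg f -> intg g -> intg (fun x => f x + g x).
Proof.
by move=> If Ig; apply: eq_integrable (integrableD _ If Ig).
Qed.

Lemma intgZ c f : intg f -> intg (fun x => c * f x).
Proof. by move=> If; apply: eq_integrable (integrableZl _ c If). Qed.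

Lemma intg_cst c : intg (fun=> c).
Proof. exact: finite_measure_integrable_cst. Qed.

Lemma intg_sum n (F : 'I_n -> T -> R) : (forall i, intg (F i)) ->
  intg (fun x => \sum_i F i x).
Proof.
move=> IF; have := @integrable_sum _ _ _ P setT measurableT _
  (index_enum 'I_n) xpredT (fun i => EFin \o F i) (fun i _ => IF i).
by apply: eq_integrable => // x _; rewrite /= sumEFin.
Qed.

Lemma ExD f g : intg f -> intg g -> Ex (fun x => f x + g x) = Ex f + Ex g.
Proof. exact: RintegralD. Qed.

Lemma ExZ c f : intg f -> Ex (fun x => c * f x) = c * Ex f.
Proof. exact: RintegralZl. Qed.

Lemma Ex_cst c : Ex (fun=> c) = c.
Proof. by rewrite /Ex int_prob_cst. Qed.

Lemma Ex_sum n (F : 'I_n -> T -> R) : (forall i, intg (F i)) ->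
  Ex (fun x => \sum_i F i x) = \sum_i Ex (F i).
Proof.
move=> IF; rewrite /Ex.
transitivity (fine (\int[P]_x (\sum_i (F i x)%:E))%E).
  by congr fine; apply: eq_integral => x _; rewrite sumEFin.
rewrite integral_sum//.
rewrite (eq_bigr (fun i => (Ex (F i))%:E)) ?sumEFin// => i _.
by rewrite fineK//; exact: (integrable_fin_num measurableT (IF i)).
Qed.

Lemma fine_covE f g :
  fine (covariance P f g) = Ex (fun x => (f x - Ex f) * (g x - Ex g)).
Proof. by rewrite unlock /= unlock. Qed.

Lemma fine_cov_mean f g : intg f -> intg g -> intg (fun x => f x * g x) ->
  fine (covariance P f g) = Ex (fun x => f x * g x) - Ex f * Ex g.
Proof.
move=> If Ig Ifg; rewrite fine_covE.
have -> : (fun x => (f x - Ex f) * (g x - Ex g)) =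
    (fun x => f x * g x + ((- Ex f) * g x + ((- Ex g) * f x + Ex f * Ex g))).
  by apply/funext => x; ring.
rewrite ExD//; last first.
  by do ?[apply: intgD]; do ?[apply: intgZ] => //; exact: intg_cst.
rewrite ExD//; [|exact: intgZ|by apply: intgD; [exact: intgZ|exact: intg_cst]].
rewrite ExD//; [|exact: intgZ|exact: intg_cst].
by rewrite (ExZ _ Ig) (ExZ _ If) Ex_cst; ring.
Qed.

End expect.

Section gauss_variance.
Context (R : realType) (n : nat) (S : 'M[R]_n) (pS : posdefmx S).
Local Notation leb := (lebesgue_cV R n).
Local Notation dot x y := ((x^T *m y) 0 0).

Lemma measurable_dot d (T : measurableType d) (x : 'cV[R]_n) (f : T -> 'cV[R]_n) :
  measurable_fun setT f -> measurable_fun setT (fun t => dot x (f t)).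
Proof.
by move=> mf; apply: measurable_coord_comp; apply: measurable_mulmx.
Qed.

Lemma quadf_parallelogram (W : 'M[R]_n) (x y : 'cV[R]_n) : W^T = W ->
  quadf W (x + y) + quadf W (x - y) = 2 * quadf W x + 2 * quadf W y.
Proof.
move=> Wsym; rewrite -[y in x + y]opprK.
rewrite !quadfB// mulmxN.
have -> : quadf W (- y) = quadf W y.
  rewrite !quadfE; apply: eq_bigr => i _; apply: eq_bigr => j _.
  by rewrite !mxE !mulNr mulrN opprK.
have -> : (- (x^T *m W *m y)) 0 0 = - (x^T *m W *m y) 0 0 by rewrite mxE.
by ring.
Qed.

(* With [E y] below both densities [G y] and [G (y + s)], the variance along
   [x] controls [(x.s)^2] since [(x.s)^2 <= 2 (x.(y+s) - a)^2 + 2 (x.y - a)^2]. *)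
Lemma gauss_variance_ge : exists2 c, 0 < c & forall (b x : 'cV[R]_n) (a : R),
  ((c * `|x| ^+ 2)%:E <=
   \int[leb]_y ((dot x y - a) ^+ 2 * gauss_pdf S b y)%:E)%E.
Proof.
have pV := posdef_inv pS; have [symV _] := pV.
(* By the parallelogram identity the form at [y + s] is at most twice the form at [y] plus a
   constant, whence a common lower bound with the doubled form. *)
have pV2 : posdefmx (2 *: invmx S) by apply: posdef_scale.
have [dV iV] := integral_expR_quadf pV2.
set I := Num.sqrt _ in iV.
have I0 : 0 < I.
  by rewrite sqrtr_gt0 divr_gt0// exprn_gt0// mulr_gt0// pi_gt0.
have [K K0 KP] : exists2 K, 0 <= K & forall s : 'cV[R]_n, `|s| <= 1 ->
    quadf (invmx S) s <= K.
  exists (n%:R * (n%:R * `|invmx S|)) => [|s s1]; first by rewrite !mulr_ge0.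
  rewrite (le_trans (ler_norm _))// (le_trans (quadf_bilinear_le _ _ _))//.
  by rewrite ler_piMr ?mulr_ge0// mulr_ile1.
pose cst := (Num.sqrt ((2 * pi) ^+ n * \det S))^-1.
have cst0 : 0 < cst by exact: gauss_cst_gt0.
pose k := cst * expR (- K).
have k0 : 0 < k by rewrite mulr_gt0// expR_gt0.
pose E (y : 'cV[R]_n) := expR (- (2^-1 * quadf (2 *: invmx S) y)).
have E0 y : 0 <= E y by exact: expR_ge0.
have mE : measurable_fun setT E by rewrite /E; mfun.
have kE y s : `|s| <= 1 -> k * E y <= gauss_pdf S 0 (y + s).
  move=> s1; rewrite gauss_pdfE// subr0 -/cst /k -mulrA ler_wpM2l ?(ltW cst0)//.
  rewrite /E -expRD ler_expR quadfZl mulKf//.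
  have := KP s s1; have := quadf_parallelogram y s symV.
  have := quadf_ge0 (y - s) pV; lra.
exists (k * I / 4) => [|b x a]; first by rewrite divr_gt0// mulr_gt0.
pose q (y : 'cV[R]_n) := (dot x y - (a - dot x b)) ^+ 2.
have mq : measurable_fun setT q.
  apply: measurable_funX; apply: measurable_funB => //.
  by apply: measurable_dot; mfun.
have q0 y : 0 <= q y by exact: sqr_ge0.
have [p pE] := opaque_copy (fun y => q y * gauss_pdf S 0 y).
have mp : measurable_fun setT p.
  by rewrite pE; apply: measurable_funM => //; mfun.
have p0 y : 0 <= p y by rewrite pE mulr_ge0 ?gauss_ge0.
have -> : (\int[leb]_y ((dot x y - a) ^+ 2 * gauss_pdf S b y)%:E =
    \int[leb]_y (p y)%:E)%E.
  rewrite -[RHS](ge0_integral_shift_cV (- b)); first last.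
  - by move=> y; rewrite lee_fin.
  - exact/measurable_EFinP.
  apply: eq_integral => y _; rewrite pE -gauss_pdf_shift /q mulmxBr.
  congr (_ ^+ 2 * _)%:E; rewrite [in RHS]mxE [X in _ + X - _]mxE; ring.
set V := (\int[leb]_y _)%E.
have V0 : (0 <= V)%E by exact: int_ge0.
have [->|x0] := eqVneq x 0; first by rewrite normr0 expr0n mulr0.
(* The direction [s] is the basis vector at which the maximum norm of [x] is attained, so that
   [(x.s) ^ 2] is [|x| ^ 2]. *)
have [i xi] : exists i, `|x| = `|x i 0|.
  have := mx_norm_neq0; move=> /(_ _ _ _ x)[|[i j] xij].
    by move: x0; rewrite -normr_eq0.
  by exists i; move: xij; rewrite /= [j]ord1.
pose s : 'cV[R]_n := delta_mx i 0.
have s1 : `|s| <= 1.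
  by apply: mx_norm_le => // k1 k2; rewrite mxE; case: (_ && _); rewrite ?normr1 ?normr0.
have xs : dot x s = x i 0.
  rewrite mxE (bigD1 i)//= big1 ?addr0; first by rewrite !mxE !eqxx mulr1.
  by move=> j ji; rewrite !mxE (negbTE ji) mulr0.
have qs (y : 'cV[R]_n) : `|x| ^+ 2 <= 2 * q (y + s) + 2 * q y.
  rewrite xi real_normK ?num_real// -xs /q mulmxDr.
  have -> : (x^T *m y + x^T *m s) 0 0 = dot x y + dot x s by rewrite [LHS]mxE.
  move: (dot x s) (dot x y) (a - dot x b) => t1 t2 t3.
  rewrite -subr_ge0 (_ : _ - _ = (t1 + 2 * (t2 - t3)) ^+ 2) ?sqr_ge0//; ring.
have pt (y : 'cV[R]_n) : `|x| ^+ 2 * k * E y <=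
    2 * p (y + s) + 2 * p y.
  rewrite pE -mulrA; have kE0 : 0 <= k * E y by rewrite mulr_ge0// ltW.
  have := ler_wpM2r kE0 (qs y).
  have := ler_wpM2l (q0 (y + s)) (kE y s s1).
  have := kE y 0; rewrite normr0 ler01 addr0 => /(_ isT) /(ler_wpM2l (q0 y)).
  lra.
have mps : measurable_fun setT (fun y : 'cV[R]_n => p (y + s)).
  by apply: (measurableT_comp mp); mfun.
have xk0 : 0 <= `|x| ^+ 2 * k by rewrite mulr_ge0// ltW.
have m2p : measurable_fun setT (fun y => 2 * p y) by exact: measurable_funM.
have m2ps : measurable_fun setT (fun y : 'cV[R]_n => 2 * p (y + s)).
  exact: measurable_funM.
have two0 : 0 <= 2 :> R by [].
have p20 y : 0 <= 2 * p y by rewrite mulr_ge0.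
have mxkE : measurable_fun setT (fun y => `|x| ^+ 2 * k * E y).
  exact: measurable_funM.
have := int_le leb mxkE (measurable_funD m2ps m2p)
  (fun y => mulr_ge0 xk0 (E0 y)) pt.
rewrite (int_scale _ mE xk0 E0) (int_add _ m2ps m2p (fun y => p20 (y + s)) p20).
rewrite (int_scale _ mps two0 (fun y => p0 (y + s))) (int_scale _ mp two0 p0).
rewrite (ge0_integral_shift_cV (f := fun y => (p y)%:E)); first last.
- by move=> y; rewrite lee_fin.
- exact/measurable_EFinP.
rewrite -/V iV -EFinM; move: V V0 => [v| |]//=; rewrite ?leey//.
rewrite lee_fin => v0; rewrite -!EFinM -EFinD !lee_fin; lra.
Qed.

End gauss_variance.

Section coercive.
Context (R : realType) (m : nat).

Lemma quadf_le_norm (A : 'M[R]_m) x : quadf A x <= m%:R * (`|x| * `|A *m x|).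
Proof.
rewrite /quadf -mulmxA mxE (le_trans (ler_norm _))//.
rewrite (le_trans (ler_norm_sum _ _ _))// ler_sum_cst// => k.
by rewrite normrM mxE ler_pM// ler_coord.
Qed.

(** Coercivity and [quadf_le_norm] give [c |x| <= m |A x|]. This makes the kernel trivial and bounds
    the inverse in terms of [c] and the dimension only. *)
Lemma coercive_inv (A : 'M[R]_m) (c : R) : 0 < c ->
  (forall x, c * `|x| ^+ 2 <= quadf A x) ->
  A \in unitmx /\ forall z : 'cV[R]_m, `|invmx A *m z| <= m%:R / c * `|z|.
Proof.
move=> c0 cA.
have lower (x : 'cV[R]_m) : c * `|x| <= m%:R * `|A *m x|.
  have [->|x0] := eqVneq x 0; first by rewrite normr0 mulr0 mulr_ge0.
  have xp : 0 < `|x| by rewrite normr_gt0.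
  rewrite -(ler_pM2l xp) (mulrCA _ c) -expr2.
  by rewrite (le_trans (cA x))// (le_trans (quadf_le_norm A x))// mulrCA.
have uA : A \in unitmx.
  rewrite -unitmx_tr -row_free_unit -kermx_eq0; apply/eqP/row_matrixP => i.
  rewrite row0; apply: trmx_inj; rewrite trmx0; apply/eqP.
  rewrite -normr_eq0 eq_le normr_ge0 andbT.
  have := lower (row i (kermx A^T))^T.
  rewrite -[A in A *m _]trmxK -trmx_mul -row_mul mulmx_ker row0 trmx0 normr0 mulr0.
  by rewrite pmulr_rle0.
split=> // z; have := lower (invmx A *m z); rewrite mulKVmx// => h.
by rewrite mulrAC ler_pdivlMr// mulrC.
Qed.

End coercive.

Section covariances.
Context (R : realType) (n m : nat).
Local Notation T := ('cV[R]_n * 'cV[R]_m)%type.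
Implicit Types (P Q : probability T R) (f g : T -> R).

Definition jw (w : T) : R := wt w.1 + `|w.2|.

Lemma jw_ge1 w : 1 <= jw w.
Proof. by rewrite (le_trans (wt_ge1 w.1))// lerDl. Qed.

Lemma jw_ge0 w : 0 <= jw w.
Proof. by rewrite (le_trans _ (jw_ge1 w)). Qed.

Lemma measurable_jw : measurable_fun setT jw.
Proof. by rewrite /jw; mfun. Qed.

Lemma measurable_jw2 : measurable_fun setT (fun w => jw w ^+ 2).
Proof. by apply: measurable_funX; exact: measurable_jw. Qed.

Lemma jw2_ge0 w : 0 <= jw w ^+ 2.
Proof. by rewrite exprn_ge0// jw_ge0. Qed.

Lemma jw2_itv w : 0 <= jw w ^+ 2 <= jw w ^+ 2.
Proof. by rewrite jw2_ge0 lexx. Qed.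

(** As [jw >= 1], coordinates and products of two coordinates are all dominated by [jw ^+ 2]; this
    makes means and covariances accessible to [mclose] with that weight. *)
Definition coordlike f := measurable_fun setT f /\ forall w, `|f w| <= jw w.

Lemma coordlike_u i : coordlike (fun w => w.1 i 0).
Proof.
split; first by mfun.
by move=> w; rewrite (le_trans (ler_coord _ _ _))// /jw /wt addrAC lerDr addr_ge0.
Qed.

Lemma coordlike_y i : coordlike (fun w => w.2 i 0).
Proof.
split; first by mfun.
by move=> w; rewrite (le_trans (ler_coord _ _ _))// /jw lerDr wt_ge0.
Qed.

Lemma coordlike1 f w : coordlike f -> `|f w| <= jw w ^+ 2.
Proof.
move=> [_ fj]; rewrite (le_trans (fj w))// expr2 ler_peMl ?jw_ge0 ?jw_ge1//.
Qed.

Lemma coordlike2 f g w : coordlike f -> coordlike g -> `|f w * g w| <= jw w ^+ 2.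
Proof. by move=> [_ fj] [_ gj]; rewrite normrM expr2 ler_pM. Qed.

Lemma cov_uyE P i j :
  cov_uy P i j = fine (covariance P (fun w => w.1 i 0) (fun w => w.2 j 0)).
Proof.
rewrite !mxE; congr (fine (covariance _ _ _)); apply/funext => w.
  by rewrite col_mxEu.
by rewrite col_mxEd.
Qed.

Lemma cov_yyE P i j :
  cov_yy P i j = fine (covariance P (fun w => w.2 i 0) (fun w => w.2 j 0)).
Proof.
by rewrite !mxE; congr (fine (covariance _ _ _)); apply/funext => w; rewrite col_mxEd.
Qed.

Section one.
Context P (B : R) (PB : (\int[P]_w (jw w ^+ 2)%:E <= B%:E)%E).

Lemma intg_jw2 f : measurable_fun setT f -> (forall w, `|f w| <= jw w ^+ 2) ->
  intg P f.
Proof.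
move=> mf fj; apply: (intg_dominated (W := fun w => jw w ^+ 2) (C := 1)) => //.
- exact: measurable_jw2.
- exact: jw2_ge0.
- by rewrite (le_lt_trans PB)// ltry.
- by move=> w; rewrite mul1r.
Qed.

Lemma intg_coord f : coordlike f -> intg P f.
Proof. by move=> cf; apply: intg_jw2; [case: cf|move=> w; exact: coordlike1]. Qed.

Lemma intg_coord2 f g : coordlike f -> coordlike g -> intg P (fun w => f w * g w).
Proof.
move=> cf cg; apply: intg_jw2; last by move=> w; exact: coordlike2.
by case: cf cg => mf _ [mg _]; mfun.
Qed.

(** The quadratic form of a covariance is a variance and [a] is the mean. Existence of a center is
    enough, because [gauss_variance_ge] bounds the second moment about every center. *)
Lemma quadf_cov_yy (x : 'cV[R]_m) :
  exists a : R, quadf (cov_yy P) x = Ex P (fun w => ((x^T *m w.2) 0 0 - a) ^+ 2).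
Proof.
pose Y i (w : T) := w.2 i 0; pose Z i w := Y i w - Ex P (Y i).
exists (\sum_i x i 0 * Ex P (Y i)).
have IY i : intg P (Y i) by apply: intg_coord; exact: coordlike_y.
have IYY i j : intg P (fun w => Y i w * Y j w).
  by apply: intg_coord2; exact: coordlike_y.
have IZZ i j : intg P (fun w => Z i w * Z j w).
  rewrite (_ : (fun _ => _) = fun w => Y i w * Y j w + ((- Ex P (Y i)) * Y j w +
    ((- Ex P (Y j)) * Y i w + Ex P (Y i) * Ex P (Y j)))).
    by do ?[apply: intgD]; do ?[apply: intgZ] => //; exact: intg_cst.
  by apply/funext => w; rewrite /Z; ring.
rewrite quadfE.
transitivity (Ex P (fun w => \sum_i \sum_j x i 0 * x j 0 * (Z i w * Z j w))).
  rewrite Ex_sum; last by move=> i; apply: intg_sum => j; exact: intgZ.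
  apply: eq_bigr => i _; rewrite Ex_sum; last by move=> j; exact: intgZ.
  by apply: eq_bigr => j _; rewrite ExZ// cov_yyE fine_covE mulrAC.
congr (Ex P _); apply/funext => w.
have -> : (x^T *m w.2) 0 0 - \sum_i x i 0 * Ex P (Y i) = \sum_i x i 0 * Z i w.
  rewrite mxE -sumrB; apply: eq_bigr => i _.
  by rewrite mxE /Z /Y mulrBr.
rewrite expr2 big_distrlr; apply: eq_bigr => i _; apply: eq_bigr => j _.
by rewrite /= mulrACA.
Qed.

Lemma cov_coord_le f g : coordlike f -> coordlike g ->
  `|fine (covariance P f g)| <= B + B * B.
Proof.
move=> cf cg; rewrite fine_cov_mean; [|exact: intg_coord|exact: intg_coord|exact: intg_coord2].
have b (h : T -> R) : measurable_fun setT h -> (forall w, `|h w| <= jw w ^+ 2) -> `|Ex P h| <= B.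
  move=> mh hj.
  have hj1 w : `|h w| <= 1 * jw w ^+ 2 by rewrite mul1r.
  have [x [y [Ex_ Ey _]]] := signed_close
    (mclose_refl (W := fun w => jw w ^+ 2) P (lexx 0))
    ltr01 measurable_jw2 jw2_ge0 PB mh hj1.
  by rewrite mul1r /Ex Ey.
have [mf _] := cf; have [mg _] := cg.
rewrite (le_trans (ler_normB _ _))// lerD//.
  by apply: b => [|w]; [mfun|exact: coordlike2].
rewrite normrM ler_pM//; apply: b => // w; exact: coordlike1.
Qed.

End one.

Lemma cov_coord_close P Q (e B : R) f g : 0 <= e ->
  mclose (fun w => jw w ^+ 2) e P Q -> (\int[Q]_w (jw w ^+ 2)%:E <= B%:E)%E ->
  coordlike f -> coordlike g ->
  `|fine (covariance P f g) - fine (covariance Q f g)| <= 2 * e * (1 + 2 * B + 2 * e).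
Proof.
move=> e0 cl QB cf cg.
have PB : (\int[P]_w (jw w ^+ 2)%:E <= (B + e)%:E)%E.
  have [H _] := cl _ measurable_jw2 (fun w => jw2_itv w).
  by rewrite (le_trans H)// EFinD leeD2r.
rewrite (fine_cov_mean (intg_coord PB cf) (intg_coord PB cg) (intg_coord2 PB cf cg)).
rewrite (fine_cov_mean (intg_coord QB cf) (intg_coord QB cg) (intg_coord2 QB cf cg)).
have b (h : T -> R) : measurable_fun setT h -> (forall w, `|h w| <= jw w ^+ 2) ->
    `|Ex P h - Ex Q h| <= 2 * e /\ `|Ex Q h| <= B.
  move=> mh hj.
  have hj1 w : `|h w| <= 1 * jw w ^+ 2 by rewrite mul1r.
  have [x [y [Ex_ Ey]]] := signed_close cl ltr01 measurable_jw2 jw2_ge0 QB mh hj1.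
  by rewrite !mul1r /Ex Ex_ Ey.
have [mf _] := cf; have [mg _] := cg.
have [fg1 fg2] := b _ (measurable_funM mf mg) (fun w => coordlike2 w cf cg).
have [f1 f2] := b _ mf (fun w => coordlike1 w cf).
have [g1 g2] := b _ mg (fun w => coordlike1 w cg).
move: fg1 fg2 f1 f2 g1 g2.
set a := Ex P _; set a' := Ex Q _; set p := Ex P f; set p' := Ex Q f.
set q := Ex P g; set q' := Ex Q g => fg1 fg2 f1 f2 g1 g2.
(* The product of the means is expanded around the means under [Q], which are bounded by [B]. *)
have -> : a - p * q - (a' - p' * q') =
    (a - a') - ((p - p') * (q - q') + (p - p') * q' + p' * (q - q')) by ring.
rewrite (le_trans (ler_normB _ _))//.
have H1 : `|(p - p') * (q - q')| <= (2 * e) * (2 * e) by rewrite normrM ler_pM.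
have H2 : `|(p - p') * q'| <= (2 * e) * B by rewrite normrM ler_pM.
have H3 : `|p' * (q - q')| <= B * (2 * e) by rewrite normrM ler_pM.
have := ler_normD ((p - p') * (q - q') + (p - p') * q') (p' * (q - q')).
have := ler_normD ((p - p') * (q - q')) ((p - p') * q').
lra.
Qed.

Definition gain P : 'M[R]_(n, m) := cov_uy P *m invmx (cov_yy P).

Lemma gain_close (B c : R) : 0 <= B -> 0 < c -> exists2 C, 0 <= C &
  forall P Q e, 0 <= e <= B ->
  mclose (fun w => jw w ^+ 2) e P Q -> (\int[Q]_w (jw w ^+ 2)%:E <= B%:E)%E ->
  (forall x, c * `|x| ^+ 2 <= quadf (cov_yy P) x) ->
  (forall x, c * `|x| ^+ 2 <= quadf (cov_yy Q) x) ->
  (forall v : 'cV[R]_m, `|gain P *m v| <= C * `|v|) /\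
  (forall v : 'cV[R]_m, `|gain Q *m v| <= C * `|v|) /\
  (forall v : 'cV[R]_m, `|(gain P - gain Q) *m v| <= C * e * `|v|).
Proof.
move=> B0 c0.
(* For [e <= B] the bound of [cov_coord_close] is at most [E * e]. [V] is the bound of
   [cov_coord_le] for the common second moment bound [B + B]. *)
pose E := 2 * (1 + 2 * B + 2 * B).
have E0 : 0 <= E by rewrite mulr_ge0 ?addr_ge0 ?mulr_ge0.
pose V := (B + B) + (B + B) * (B + B).
have V0 : 0 <= V by rewrite addr_ge0 ?mulr_ge0 ?addr_ge0.
pose k := m%:R / c.
have k0 : 0 <= k by rewrite divr_ge0// ltW.
pose M : R := m%:R.
have M0 : 0 <= M by rewrite ler0n.
pose C1 := M * V * k.
have C10 : 0 <= C1 by exact: mulr_ge0 (mulr_ge0 M0 V0) k0.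
pose C2 := M * E * k + C1 * (M * E * k).
have MEk0 : 0 <= M * E * k by exact: mulr_ge0 (mulr_ge0 M0 E0) k0.
have C20 : 0 <= C2 by exact: addr_ge0 MEk0 (mulr_ge0 C10 MEk0).
exists (C1 + C2) => [|P Q e /andP[e0 eB] cl QB cP cQ]; first by rewrite addr_ge0.
have PB : (\int[P]_w (jw w ^+ 2)%:E <= (B + B)%:E)%E.
  have [H _] := cl _ measurable_jw2 (fun w => jw2_itv w).
  by rewrite (le_trans H)// EFinD leeD// lee_fin.
have QB' : (\int[Q]_w (jw w ^+ 2)%:E <= (B + B)%:E)%E.
  by rewrite (le_trans QB)// lee_fin lerDl.
have [uP iP] := coercive_inv c0 cP; have [uQ iQ] := coercive_inv c0 cQ.
have small (f g : T -> R) : coordlike f -> coordlike g ->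
    `|fine (covariance P f g) - fine (covariance Q f g)| <= E * e.
  move=> cf cg; rewrite (le_trans (cov_coord_close e0 cl QB cf cg))//.
  rewrite /E; nra.
have mulle k1 k2 (A : 'M[R]_(k1, k2)) (b : R) (x : 'cV[R]_k2) : 0 <= b ->
    (forall i j, `|A i j| <= b) -> `|A *m x| <= k2%:R * b * `|x|.
  move=> b0 Ab; rewrite (le_trans (ler_norm_mulmx _ _))// ler_wpM2r// ler_wpM2l//.
  exact: mx_norm_le.
have Ee0 : 0 <= E * e by rewrite mulr_ge0.
have duy (x : 'cV[R]_m) : `|(cov_uy P - cov_uy Q) *m x| <= M * (E * e) * `|x|.
  apply: mulle => // i j; rewrite mxE [X in _ + X]mxE !cov_uyE.
  by apply: small; [exact: coordlike_u|exact: coordlike_y].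
have dyy (x : 'cV[R]_m) : `|(cov_yy Q - cov_yy P) *m x| <= M * (E * e) * `|x|.
  apply: mulle => // i j; rewrite mxE [X in _ + X]mxE !cov_yyE distrC.
  by apply: small; exact: coordlike_y.
have bP (x : 'cV[R]_m) : `|cov_uy P *m x| <= M * V * `|x|.
  apply: mulle => // i j; rewrite cov_uyE.
  by apply: (cov_coord_le PB); [exact: coordlike_u|exact: coordlike_y].
have bQ (x : 'cV[R]_m) : `|cov_uy Q *m x| <= M * V * `|x|.
  apply: mulle => // i j; rewrite cov_uyE.
  by apply: (cov_coord_le QB'); [exact: coordlike_u|exact: coordlike_y].
have gP (v : 'cV[R]_m) : `|gain P *m v| <= C1 * `|v|.
  rewrite /gain -mulmxA (le_trans (bP _))// /C1 -[leRHS]mulrA.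
  by rewrite ler_wpM2l ?mulr_ge0// iP.
have gQ (v : 'cV[R]_m) : `|gain Q *m v| <= C1 * `|v|.
  rewrite /gain -mulmxA (le_trans (bQ _))// /C1 -[leRHS]mulrA.
  by rewrite ler_wpM2l ?mulr_ge0// iQ.
split; [|split] => v.
- by rewrite (le_trans (gP v))// ler_wpM2r// lerDl.
- by rewrite (le_trans (gQ v))// ler_wpM2r// lerDl.
(* Resolvent identity for the difference of the two inverses. *)
have -> : gain P - gain Q = (cov_uy P - cov_uy Q) *m invmx (cov_yy P) +
    gain Q *m (cov_yy Q - cov_yy P) *m invmx (cov_yy P).
  rewrite /gain mulmxBl mulmxBr !mulmxBl mulmxKV// -!mulmxA mulmxV// mulmx1.
  by rewrite addrA subrK.
rewrite mulmxDl (le_trans (ler_normD _ _))//.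
have H1 : `|(cov_uy P - cov_uy Q) *m invmx (cov_yy P) *m v| <=
    M * (E * e) * (k * `|v|).
  rewrite -mulmxA.
  exact: le_trans (duy _) (ler_wpM2l (mulr_ge0 M0 Ee0) (iP v)).
have H2 : `|gain Q *m (cov_yy Q - cov_yy P) *m invmx (cov_yy P) *m v| <=
    C1 * (M * (E * e) * (k * `|v|)).
  have -> : gain Q *m (cov_yy Q - cov_yy P) *m invmx (cov_yy P) *m v =
    gain Q *m ((cov_yy Q - cov_yy P) *m (invmx (cov_yy P) *m v)) by rewrite !mulmxA.
  apply: le_trans (gQ _) _; apply: (ler_wpM2l C10).
  exact: le_trans (dyy _) (ler_wpM2l (mulr_ge0 M0 Ee0) (iP v)).
rewrite (le_trans (lerD H1 H2))//.
have -> : M * (E * e) * (k * `|v|) + C1 * (M * (E * e) * (k * `|v|)) =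
  C2 * e * `|v| by rewrite /C2; ring.
by rewrite ler_wpM2r// ler_wpM2r// lerDr.
Qed.

End covariances.

(** * Exactness of the transport for Gaussian laws *)

Section exactness.
Context (R : realType) (n m : nat).
Context (G : 'M[R]_m) (C : 'M[R]_n) (H : 'M[R]_(m, n)) (b : 'cV[R]_m) (c : 'cV[R]_n).
Hypotheses (pG : posdefmx G) (pC : posdefmx C).
Local Notation T := ('cV[R]_n * 'cV[R]_m)%type.
Local Notation lebn := (lebesgue_cV R n).
Local Notation lebm := (lebesgue_cV R m).
Local Notation S := (innov_cov G C H).
Local Notation C' := (post_cov G C H).
Local Notation K := (kgain G C H).
Let pS : posdefmx S := posdef_innov H pG pC.
Let pC' : posdefmx C' := posdef_post H pG pC.
Let h u := H *m u + b.

Definition post_mean (y : 'cV[R]_m) := c + K *m (y - (H *m c + b)).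

Lemma measurable_affine : measurable_fun setT (fun u : 'cV[R]_n => H *m u + b).
Proof. by mfun. Qed.

Lemma gauss_conv y :
  (\int[lebn]_v (gauss_pdf G (H *m v + b) y * gauss_pdf C c v)%:E =
   (gauss_pdf S (H *m c + b) y)%:E)%E.
Proof.
under eq_integral do rewrite gauss_factor//.
rewrite int_scale ?gauss_ge0//; first by rewrite integral_gauss// mule1.
  by mfun.
by move=> v; rewrite gauss_ge0.
Qed.

Lemma gauss_density : is_density lebn (gauss_pdf C c).
Proof.
split; [by mfun|by move=> x; rewrite gauss_ge0|exact: integral_gauss].
Qed.

Let pi0 := density_prob (lebn \x lebm)%E (joint_pdf G h (gauss_pdf C c)).

Lemma law_gauss_joint (F : T -> R) : measurable_fun setT F -> (forall w, 0 <= F w) ->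
  (\int[pi0]_w (F w)%:E =
   \int[lebm]_y \int[lebn]_u
     (F (u, y) * (gauss_pdf S (H *m c + b) y * gauss_pdf C' (post_mean y) u))%:E)%E.
Proof.
move=> mF F0.
rewrite (law_joint_iter pG measurable_affine gauss_density mF F0).
have [f fE] := opaque_copy (fun w : T =>
  F w * (gauss_pdf S (H *m c + b) w.2 * gauss_pdf C' (post_mean w.2) w.1)).
have mf : measurable_fun setT f by rewrite fE /post_mean; mfun.
have f0 w : 0 <= f w by rewrite fE !mulr_ge0 ?gauss_ge0.
have := int_swap lebn lebm mf f0; rewrite fE/= => <-.
apply: eq_integral => u _; apply: eq_integral => y _.
by rewrite /post_mean -gauss_factor//; congr EFin; ring.
Qed.

Lemma transport_gauss (ydag : 'cV[R]_m) (f : 'cV[R]_n -> R) :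
  measurable_fun setT f -> (forall u, 0 <= f u) ->
  (\int[pi0]_w (f (w.1 + K *m (ydag - w.2)))%:E =
   \int[lebn]_u (f u * gauss_pdf C' (post_mean ydag) u)%:E)%E.
Proof.
move=> mf f0.
rewrite (law_gauss_joint (F := fun w => f (w.1 + K *m (ydag - w.2)))); first last.
- by move=> w; exact: f0.
- by mfun.
set I := RHS.
transitivity (\int[lebm]_y ((gauss_pdf S (H *m c + b) y)%:E * I))%E.
  apply: eq_integral => y _; rewrite /I.
  have mg : measurable_fun setT (fun u => f u * gauss_pdf C' (post_mean ydag) u).
    by mfun.
  have g0 u : 0 <= f u * gauss_pdf C' (post_mean ydag) u.
    by rewrite mulr_ge0 ?gauss_ge0.
  rewrite -[X in (_ * X)%E](ge0_integral_shift_cV (K *m (ydag - y))); first last.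
  - by move=> u; rewrite lee_fin.
  - exact/measurable_EFinP.
  set z := K *m (ydag - y).
  have ms : measurable_fun setT (fun u : 'cV[R]_n => u + z) by mfun.
  rewrite -(int_scale lebn (measurableT_comp mg ms) (gauss_ge0 pS _ y)
    (fun u => g0 (u + z))).
  apply: eq_integral => u _.
  apply: (congr1 EFin).
  (* Replacing [y] by [ydag] moves the conditional mean by [K (ydag - y)], which is the translation
     of [u]. The inner integral is therefore the same for every [y]. *)
  have E : gauss_pdf C' (post_mean y) u = gauss_pdf C' (post_mean ydag) (u + z).
    rewrite gauss_pdf_shift [RHS]gauss_pdf_shift; congr gauss_pdf.
    rewrite /post_mean /z !mulmxBr; move: (K *m _) (K *m _) (K *m _) => p q s.
    by apply/colP => i; rewrite !mxE; ring.
  by rewrite E mulrCA.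
have I0 : (0 <= I)%E by apply: int_ge0 => u; rewrite mulr_ge0 ?gauss_ge0.
rewrite ge0_integralZr//.
- by rewrite integral_gauss// mul1e.
- by mfun.
- by move=> y _; rewrite lee_fin gauss_ge0.
Qed.

Lemma condition_gauss y u :
  condition_pdf y (joint_pdf G h (gauss_pdf C c)) u = gauss_pdf C' (post_mean y) u.
Proof.
rewrite /condition_pdf.
have -> : joint_pdf G h (gauss_pdf C c) (u, y) =
    gauss_pdf S (H *m c + b) y * gauss_pdf C' (post_mean y) u.
  exact (gauss_factor H pG pC b c u y).
have -> : (\int[lebn]_v joint_pdf G h (gauss_pdf C c) (v, y) =
  gauss_pdf S (H *m c + b) y)%R by exact (congr1 fine (gauss_conv y)).
by rewrite mulrAC mulfV ?mul1r// gt_eqF// gauss_gt0.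
Qed.

(* The reflection [u |-> 2 m(y) - u] about the conditional mean preserves the
   law and changes the sign of the integrand. *)
Lemma cond_mean_ortho i (phi : 'cV[R]_m -> R) : measurable_fun setT phi ->
  Ex pi0 (fun w => (w.1 - post_mean w.2) i 0 * phi w.2) = 0.
Proof.
move=> mphi.
have mf : measurable_fun setT (fun w : T => (w.1 - post_mean w.2) i 0 * phi w.2).
  by rewrite /post_mean; mfun.
rewrite /Ex integral_posneg//.
have [p pE] := opaque_copy
  (fun w : T => Num.max ((w.1 - post_mean w.2) i 0 * phi w.2) 0).
have [q qE] := opaque_copy
  (fun w : T => Num.max (- ((w.1 - post_mean w.2) i 0 * phi w.2)) 0).
have mp : measurable_fun setT p by rewrite pE; exact: measurable_pospart.
have mq : measurable_fun setT q.
  rewrite qE; apply: measurable_pospart.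
  exact: (measurableT_comp (@oppr_measurable _ setT) mf).
have pq u y : p (- u + post_mean y, y) = q (u + post_mean y, y).
  by rewrite pE qE /= !addrK mxE mulNr.
suff : (\int[pi0]_x (p x)%:E = \int[pi0]_x (q x)%:E)%E.
  rewrite pE qE => ->.
  (* If both parts are infinite, their difference is infinite and [fine] sends it to 0. *)
  by case: (\int[pi0]_x _)%E => [z| |] //=; rewrite subrr.
have p0 w : 0 <= p w by rewrite pE max0_ge0.
have q0 w : 0 <= q w by rewrite qE max0_ge0.
rewrite (law_gauss_joint mp p0) (law_gauss_joint mq q0); apply: eq_integral => y _.
have aux (g : T -> R) : measurable_fun setT g -> (forall w, 0 <= g w) ->
    measurable_fun setT (fun u => (g (u, y) * (gauss_pdf S (H *m c + b) y *
      gauss_pdf C' (post_mean y) u))%:E) /\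
    (forall u, 0 <= (g (u, y) * (gauss_pdf S (H *m c + b) y *
      gauss_pdf C' (post_mean y) u))%:E)%E.
  move=> mg g0; split; first by mfun.
  by move=> u; rewrite lee_fin !mulr_ge0 ?gauss_ge0.
have [mP P0] := aux p mp p0; have [mQ Q0] := aux q mq q0.
rewrite -[LHS](ge0_integral_shift_cV (post_mean y) mP P0).
rewrite -[RHS](ge0_integral_shift_cV (post_mean y) mQ Q0).
rewrite -[LHS]ge0_integral_opp_cV.
- apply: eq_integral => u _; rewrite pq; apply: (congr1 EFin).
  by rewrite (gauss_pdf_shift C' _ (- u + _)) (gauss_pdf_shift C' _ (u + _)) !addrK gauss_pdf_opp.
- by apply: (measurableT_comp mP); mfun.
- by move=> u; exact: P0.
Qed.

Lemma intg_centered (B : R) f g (x y : R) :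
  (\int[pi0]_w (jw w ^+ 2)%:E <= B%:E)%E -> coordlike f -> coordlike g ->
  intg pi0 (fun w => (f w - x) * (g w - y)).
Proof.
move=> iB cf cg.
rewrite (_ : (fun _ => _) = fun w => f w * g w + ((- x) * g w +
    ((- y) * f w + x * y))); last by apply/funext => w; ring.
refine (intgD (intg_coord2 iB cf cg) _).
refine (intgD (intgZ _ (intg_coord iB cg)) _).
exact (intgD (intgZ _ (intg_coord iB cf)) (intg_cst _ _)).
Qed.

(** Normal equations: orthogonality of [u - m(y)] to the centered coordinates of [y] says that
    [C^uy = K C^yy]. *)
Lemma gain_gauss (B : R) : (\int[pi0]_w (jw w ^+ 2)%:E <= B%:E)%E ->
  cov_yy pi0 \in unitmx -> gain pi0 = K.
Proof.
move=> iB uyy; suff E : cov_uy pi0 = K *m cov_yy pi0.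
  by rewrite /gain E mulmxK.
apply/matrixP => i j; rewrite cov_uyE mxE fine_covE.
under eq_bigr do rewrite cov_yyE fine_covE.
pose U i (w : T) := w.1 i 0; pose Y j (w : T) := w.2 j 0.
set a := Ex pi0 (fun w => w.1 i 0).
pose e k := Ex pi0 (Y k).
have IYY k l : intg pi0 (fun w => (Y k w - e k) * (Y l w - e l)).
  by apply: (intg_centered _ _ iB); exact: coordlike_y.
have IUY : intg pi0 (fun w => (U i w - a) * (Y j w - e j)).
  by apply: (intg_centered _ _ iB); [exact: coordlike_u|exact: coordlike_y].
have IY k : intg pi0 (Y k) by apply: (intg_coord iB); exact: coordlike_y.
(* The offset [d] multiplies the centered coordinate [Y j - e j], so its contribution has
   expectation zero. *)
pose d := post_mean (\col_k e k) i 0 - a.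
have PM (y : 'cV[R]_m) : post_mean y i 0 =
    c i 0 + \sum_k K i k * (y k 0 - (H *m c + b) k 0).
  rewrite /post_mean mxE; congr (_ + _); rewrite mxE; apply: eq_bigr => k _.
  by congr (_ * _); rewrite mxE [X in _ + X]mxE.
have fE : (fun w : T => (w.1 - post_mean w.2) i 0 * (Y j w - e j)) =
    (fun w => (U i w - a) * (Y j w - e j) +
      ((- 1) * (\sum_k K i k * ((Y k w - e k) * (Y j w - e j))) +
       (- d) * (Y j w + (- e j)))).
  apply/funext => w; under eq_bigr do rewrite mulrA.
  rewrite -mulr_suml.
  have -> : \sum_k K i k * (Y k w - e k) = post_mean w.2 i 0 - post_mean (\col_k e k) i 0.
    rewrite !PM opprD addrACA subrr add0r -sumrB; apply: eq_bigr => k _.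
    by rewrite mxE /Y; ring.
  have -> : (w.1 - post_mean w.2) i 0 = U i w - post_mean w.2 i 0.
    by rewrite mxE [X in _ + X]mxE.
  rewrite /d; move: (U i w) (Y j w) (post_mean _ i 0) (post_mean _ i 0).
  by move=> t1 t2 t3 t4; ring.
have m1 : measurable_fun setT (fun y : 'cV[R]_m => y j 0 - e j) by mfun.
have := cond_mean_ortho i m1.
have IS : intg pi0 (fun w => \sum_k K i k * ((Y k w - e k) * (Y j w - e j))).
  by apply: intg_sum => k; exact: intgZ.
have IYe : intg pi0 (fun w => Y j w + (- e j)) by apply: intgD => //; exact: intg_cst.
rewrite -/(Y j) fE ExD//; last by apply: intgD; exact: intgZ.
rewrite ExD; [|exact: intgZ|exact: intgZ].
rewrite (ExZ _ IS) (ExZ _ IYe) ExD//; last exact: intg_cst.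
rewrite Ex_cst subrr mulr0 addr0 mulN1r => /eqP; rewrite subr_eq0 => /eqP ->.
rewrite Ex_sum; last by move=> k; exact: intgZ.
by apply: eq_bigr => k _; rewrite ExZ.
Qed.

End exactness.

(** * Dependence of the transport on the gain *)

Section shift.
Context (R : realType) (n : nat).
Local Notation lebn := (lebesgue_cV R n).

(** Translation invariance moves the shifts from [f], which has no regularity, to the density [j],
    which has. The two error terms [t] are then shifted back, where [E] dominates them. *)
Lemma int_shift_compare (f j t E : 'cV[R]_n -> R) (p q : 'cV[R]_n) :
  measurable_fun setT f -> measurable_fun setT j -> measurable_fun setT t ->
  measurable_fun setT E ->
  (forall u, 0 <= f u) -> (forall u, 0 <= j u) -> (forall u, 0 <= t u) ->
  (forall w, j (w - p) <= j (w - q) + t (w - p) + t (w - q)) ->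
  (forall u, f (u + p) * t u <= E u) -> (forall u, f (u + q) * t u <= E u) ->
  (\int[lebn]_u (f (u + p) * j u)%:E <=
   \int[lebn]_u (f (u + q) * j u)%:E + \int[lebn]_u (2 * E u)%:E)%E.
Proof.
move=> mf mj mt mE f0 j0 t0 jt Ep Eq.
have shift (g : 'cV[R]_n -> R) (c : 'cV[R]_n) : measurable_fun setT g -> (forall u, 0 <= g u) ->
    (\int[lebn]_u (f (u + c) * g u)%:E = \int[lebn]_w (f w * g (w - c))%:E)%E.
  move=> mg g0.
  have := @ge0_integral_shift_cV R n (fun w => (f w * g (w - c))%:E) c.
  move=> <-; [|by mfun|by move=> x; rewrite lee_fin mulr_ge0].
  by apply: eq_integral => u _; rewrite addrK.
have E0 u : 0 <= E u by rewrite (le_trans _ (Ep u))// mulr_ge0.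
rewrite shift// (shift j q)//.
have [A AE] := opaque_copy (fun w => f w * j (w - q)).
have [P PE] := opaque_copy (fun w => f w * t (w - p)).
have [Q QE] := opaque_copy (fun w => f w * t (w - q)).
have mA : measurable_fun setT A by rewrite AE; mfun.
have mP : measurable_fun setT P by rewrite PE; mfun.
have mQ : measurable_fun setT Q by rewrite QE; mfun.
have A0 w : 0 <= A w by rewrite AE mulr_ge0.
have P0 w : 0 <= P w by rewrite PE mulr_ge0.
have Q0 w : 0 <= Q w by rewrite QE mulr_ge0.
apply: (@le_trans _ _ (\int[lebn]_w (A w + (P w + Q w))%:E)%E).
  apply: int_le; [by mfun|by mfun|by move=> w; rewrite mulr_ge0|].
  by move=> w; rewrite AE PE QE -!mulrDr ler_wpM2l// addrA.
have mPQ : measurable_fun setT (fun w => P w + Q w) by mfun.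
have PQ0 w : 0 <= P w + Q w by rewrite addr_ge0.
rewrite (int_add lebn mA mPQ A0 PQ0) (int_add lebn mP mQ P0 Q0).
have -> : (\int[lebn]_w (A w)%:E = \int[lebn]_w (f w * j (w - q))%:E)%E by rewrite AE.
apply: leeD => //.
have -> : (\int[lebn]_u (2 * E u)%:E =
    \int[lebn]_u (E u)%:E + \int[lebn]_u (E u)%:E)%E.
  rewrite -(int_add lebn mE mE E0 E0); apply: eq_integral => u _.
  by apply: (congr1 EFin); rewrite mulr_natl mulr2n.
apply: leeD.
  have -> : (\int[lebn]_w (P w)%:E = \int[lebn]_w (f w * t (w - p))%:E)%E by rewrite PE.
  rewrite -shift//; apply: int_le => //; first by mfun.
  by move=> u; rewrite mulr_ge0.
have -> : (\int[lebn]_w (Q w)%:E = \int[lebn]_w (f w * t (w - q))%:E)%E by rewrite QE.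
rewrite -shift//; apply: int_le => //; first by mfun.
by move=> u; rewrite mulr_ge0.
Qed.

End shift.

Section transport_stability.
Context (R : realType) (n m : nat) (S : 'M[R]_n) (G : 'M[R]_m).
Hypotheses (pS : posdefmx S) (pG : posdefmx G).
Local Notation lebn := (lebesgue_cV R n).
Local Notation lebm := (lebesgue_cV R m).
Local Notation T := ('cV[R]_n * 'cV[R]_m)%type.

Definition joint_ker (h : 'cV[R]_n -> 'cV[R]_m) (a : 'cV[R]_n) (w : T) : R :=
  gauss_pdf G (h w.1) w.2 * gauss_pdf S a w.1.

Lemma jker_ge0 h a w : 0 <= joint_ker h a w.
Proof. by rewrite mulr_ge0 ?gauss_ge0. Qed.

Section law3.
Context (l : nat) (nu : probability 'cV[R]_l R) (a : 'cV[R]_l -> 'cV[R]_n).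
Context (h : 'cV[R]_n -> 'cV[R]_m).
Hypotheses (ma : measurable_fun setT a) (mh : measurable_fun setT h).
Context (F : T -> R) (mF : measurable_fun setT F) (F0 : forall w, 0 <= F w).

Let phi (u : 'cV[R]_n) := (\int[lebm]_y (F (u, y) * gauss_pdf G (h u) y)%:E)%E.

Let mphi : measurable_fun setT phi.
Proof.
have [H HE] := opaque_copy (fun w : T => F w * gauss_pdf G (h w.1) w.2).
have mH : measurable_fun setT H by rewrite HE; mfun.
have H0 w : 0 <= H w by rewrite HE mulr_ge0 ?gauss_ge0.
by have := measurable_int1 lebm mH H0; rewrite HE.
Qed.

Let phi0 u : (0 <= phi u)%E.
Proof. by apply: int_ge0 => y; rewrite mulr_ge0 ?gauss_ge0. Qed.

Let mphi2 : measurable_fun setT (fun w : 'cV[R]_l * 'cV[R]_n =>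
  (gauss_pdf S (a w.1) w.2)%:E * phi w.2)%E.
Proof.
apply: emeasurable_funM; first by mfun.
exact: (measurableT_comp mphi measurable_snd).
Qed.

Let mFg u : measurable_fun setT (fun y => F (u, y) * gauss_pdf G (h u) y).
Proof.
have mFu : measurable_fun setT (fun y => F (u, y)).
  exact: (measurableT_comp mF (measurable_pair1 u)).
by mfun.
Qed.

Lemma int_jker v : (\int[lebn]_u \int[lebm]_y (F (u, y) * joint_ker h (a v) (u, y))%:E =
  \int[lebn]_u ((gauss_pdf S (a v) u)%:E * phi u))%E.
Proof.
apply: eq_integral => u _.
rewrite -(int_scale lebm (mFg u) (gauss_ge0 pS _ _)); last first.
  by move=> y; rewrite mulr_ge0 ?gauss_ge0.
apply: eq_integral => y _; apply: (congr1 EFin); rewrite /joint_ker/=; ring.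
Qed.

Lemma measurable_int_jker : measurable_fun setT (fun v =>
  \int[lebn]_u \int[lebm]_y (F (u, y) * joint_ker h (a v) (u, y))%:E)%E.
Proof.
have := @measurable_fun_fubini_tonelli_F _ _ _ _ _ lebn _ mphi2.
move=> /(_ (fun w => mule_ge0 _ (phi0 _))).
rewrite (_ : (fun v => _) = fubini_F lebn (fun w : 'cV[R]_l * 'cV[R]_n =>
  (gauss_pdf S (a w.1) w.2)%:E * phi w.2)%E); last first.
  by apply/funext => v; exact: int_jker.
by apply=> w; rewrite lee_fin gauss_ge0.
Qed.

(** Tonelli puts the integral over the starting point [v] outside, so that estimates for the kernel
    issued from one point can be integrated against [nu]. *)
Lemma law3 : (\int[density_prob (lebn \x lebm)
    (joint_pdf G h (mixture_pdf S nu a))]_w (F w)%:E =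
  \int[nu]_v \int[lebn]_u \int[lebm]_y (F (u, y) * joint_ker h (a v) (u, y))%:E)%E.
Proof.
rewrite (law_joint_iter pG mh (mixture_density pS nu ma) mF F0).
under [RHS]eq_integral => v _ do rewrite int_jker.
have := @fubini_tonelli _ _ _ _ _ nu lebn _ mphi2.
move=> /(_ (fun w => mule_ge0 _ (phi0 _))) => ->; last first.
  by move=> w; rewrite lee_fin gauss_ge0.
apply: eq_integral => u _.
rewrite (int_scale lebm (mFg u) (mixture_pdf_ge0 pS nu a u)); last first.
  by move=> y; rewrite mulr_ge0 ?gauss_ge0.
rewrite (mixture_pdfE pS nu ma u) -ge0_integralZr//.
- by mfun.
- by move=> v _; rewrite lee_fin gauss_ge0.
- exact: phi0.
Qed.

End law3.

Section growth.
Context (kap : R) (kap0 : 0 <= kap).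

(** [u - a] and [y - h u] are the two noise variables, whose Gaussian moments are uniform; each
    stage of the model costs a factor [1 + kap]. *)
Lemma jw_le (wv : R) (h : 'cV[R]_n -> 'cV[R]_m) (a u : 'cV[R]_n) (y : 'cV[R]_m) :
  1 <= wv -> `|a| <= kap * wv -> `|h u| <= kap * wt u ->
  jw (u, y) <= (1 + kap) ^+ 2 * (wv * wt (u - a) * wt (y - h u)).
Proof.
move=> wv1 aw hu.
have u1 : wt u <= (1 + kap) * (wv * wt (u - a)).
  rewrite (le_trans (wt_shift a u (lexx 1)))// mulrA ler_wpM2r ?wt_ge0//.
  by rewrite mulrDl mul1r lerD.
have j1 : jw (u, y) <= (1 + kap) * wt u * wt (y - h u).
  rewrite /jw/= (le_trans (wt_shift (h u) y (wt_ge1 u)))// ler_wpM2r ?wt_ge0//.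
  by rewrite mulrDl mul1r lerD.
rewrite (le_trans j1)//.
have -> : (1 + kap) ^+ 2 * (wv * wt (u - a) * wt (y - h u)) =
  (1 + kap) * ((1 + kap) * (wv * wt (u - a))) * wt (y - h u) by ring.
by rewrite ler_wpM2r ?wt_ge0// ler_wpM2l// addr_ge0.
Qed.

(** By [jw_le] the integrand splits into powers of the two noise weights, which leaves a product of
    Gaussian moments of order [k + p]. The extra powers [p] accommodate the error terms of
    [jker_shift]; plain moments have [p = 0]. *)
Lemma jker_moment (k p : nat) : exists2 C : R, 0 <= C &
  forall (wv : R) (h : 'cV[R]_n -> 'cV[R]_m) (a : 'cV[R]_n),
  1 <= wv -> `|a| <= kap * wv -> (forall u, `|h u| <= kap * wt u) ->
  measurable_fun setT h ->
  (\int[lebn]_u \int[lebm]_y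
    (jw (u, y) ^+ k * (wt (y - h u) ^+ p * wt (u - a) ^+ p * joint_ker h a (u, y)))%:E <=
   (C * wv ^+ k)%:E)%E.
Proof.
have [M1 M10 MG] := gauss_moment pG (k + p).
have [M2 M20 MS] := gauss_moment pS (k + p).
pose D := ((1 + kap) ^+ 2) ^+ k.
have D0 : 0 <= D by rewrite exprn_ge0// exprn_ge0// addr_ge0.
exists (D * (M1 * M2)) => [|wv h a wv1 aw hu mh]; first by rewrite !mulr_ge0.
have wv0 : 0 <= wv by rewrite (le_trans _ wv1).
have [f fE] := opaque_copy (fun u : 'cV[R]_n => wt (u - a) ^+ (k + p) * gauss_pdf S a u).
have [g gE] := opaque_copy (fun u (y : 'cV[R]_m) =>
  wt (y - h u) ^+ (k + p) * gauss_pdf G (h u) y).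
have f0 u : 0 <= f u by rewrite fE mulr_ge0 ?gauss_ge0 ?exprn_ge0 ?wt_ge0.
have g0 u y : 0 <= g u y by rewrite gE mulr_ge0 ?gauss_ge0 ?exprn_ge0 ?wt_ge0.
have mf : measurable_fun setT f by rewrite fE; mfun.
have mg u : measurable_fun setT (g u) by rewrite gE; mfun.
pose e := D * wv ^+ k.
have e0 : 0 <= e by rewrite mulr_ge0// exprn_ge0.
have pt u y : jw (u, y) ^+ k * (wt (y - h u) ^+ p * wt (u - a) ^+ p * joint_ker h a (u, y))
    <= e * f u * g u y.
  have -> : e * f u * g u y = ((1 + kap) ^+ 2 * (wv * wt (u - a) * wt (y - h u))) ^+ k *
      (wt (y - h u) ^+ p * wt (u - a) ^+ p * joint_ker h a (u, y)).
    by rewrite /e /D fE gE /joint_ker !exprMn !exprD/=; ring.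
  rewrite ler_wpM2r ?mulr_ge0 ?exprn_ge0 ?wt_ge0 ?gauss_ge0//.
  rewrite lerXn2r ?nnegrE ?jw_ge0 ?mulr_ge0 ?wt_ge0 ?exprn_ge0 ?addr_ge0//.
  exact: jw_le.
have ef0 u : 0 <= e * f u by rewrite mulr_ge0.
have inner u : (\int[lebm]_y
    (jw (u, y) ^+ k * (wt (y - h u) ^+ p * wt (u - a) ^+ p * joint_ker h a (u, y)))%:E <=
    (M1 * e * f u)%:E)%E.
  apply: (@le_trans _ _ (\int[lebm]_y (e * f u * g u y)%:E)%E).
    apply: int_le; [|by have mgu := mg u; mfun| |exact: pt].
      by rewrite /jw /joint_ker; mfun.
    move=> y; rewrite !mulr_ge0 ?exprn_ge0 ?wt_ge0 ?jw_ge0 ?gauss_ge0//.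
  rewrite (int_scale lebm (mg u) (ef0 u) (g0 u)).
  rewrite (_ : M1 * e * f u = e * f u * M1); last by rewrite -mulrA mulrC.
  by rewrite [leRHS]EFinM lee_wpmul2l ?lee_fin// gE MG.
have [H HE] := opaque_copy (fun w : T =>
  jw w ^+ k * (wt (w.2 - h w.1) ^+ p * wt (w.1 - a) ^+ p * joint_ker h a w)).
have mH : measurable_fun setT H by rewrite HE /jw /joint_ker; mfun.
have H0 w : 0 <= H w.
  by rewrite HE !mulr_ge0 ?exprn_ge0 ?wt_ge0 ?jw_ge0 ?gauss_ge0.
have := measurable_int1 lebm mH H0; rewrite HE/= => mI.
have I0 u : (0 <= \int[lebm]_y (jw (u, y) ^+ k *
    (wt (y - h u) ^+ p * wt (u - a) ^+ p * joint_ker h a (u, y)))%:E)%E.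
  by have := int_ge0 lebm (fun y => H0 (u, y)); rewrite HE.
have Me0 : 0 <= M1 * e by rewrite mulr_ge0.
apply: (@le_trans _ _ (\int[lebn]_u (M1 * e * f u)%:E)%E).
  by apply: ge0_le_integral => //; mfun.
rewrite (int_scale lebn mf Me0 f0).
have -> : D * (M1 * M2) * wv ^+ k = M1 * e * M2 by rewrite /e; ring.
by rewrite [leRHS]EFinM lee_wpmul2l ?lee_fin// fE MS.
Qed.

End growth.
(** The points differ by at most [d * wt y], as do the translations given by two gains. One factor
    [wt y] is this distance, the other appears when the norms at one point are bounded by those at
    the other. By [expRN_lip] the error is weighted by the kernel itself. *)
Lemma jker_shift (kap M : R) : 0 <= kap -> 0 <= M ->
  exists2 D, 0 <= D & forall (h : 'cV[R]_n -> 'cV[R]_m) a (d : R) u1 u2 y,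
  (forall u u', `|h u - h u'| <= kap * `|u - u'|) ->
  `|u1 - u2| <= d * wt y -> 0 <= d <= M ->
  joint_ker h a (u1, y) <= joint_ker h a (u2, y) + D * d *
    (wt y ^+ 2 * wt (y - h u1) * wt (u1 - a) * joint_ker h a (u1, y)) + D * d *
    (wt y ^+ 2 * wt (y - h u2) * wt (u2 - a) * joint_ker h a (u2, y)).
Proof.
move=> kap0 M0.
have [iG _] := posdef_inv pG; have [iS _] := posdef_inv pS.
have [cG cG0 GP] := quadf_shift_le iG; have [cS cS0 SP] := quadf_shift_le iS.
(* The first summand comes from the observation exponent, where [h] is [kap]-Lipschitz, the second
   from the prediction exponent; [M] bounds [d]. *)
pose c := cG * kap * (2 + kap * M) + cS * (2 + M).
have c0 : 0 <= c by rewrite addr_ge0 ?mulr_ge0 ?addr_ge0 ?mulr_ge0.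
exists c => // h a d u1 u2 y hl u12 /andP[d0 dM].
pose E u := 2^-1 * quadf (invmx G) (y - h u) + 2^-1 * quadf (invmx S) (u - a).
have [k k0 jE] : exists2 k, 0 <= k & forall u, joint_ker h a (u, y) = k * expR (- E u).
  exists ((Num.sqrt ((2 * pi) ^+ m * \det G))^-1 *
          (Num.sqrt ((2 * pi) ^+ n * \det S))^-1).
    by rewrite mulr_ge0 ?invr_ge0 ?sqrtr_ge0.
  move=> u; rewrite /joint_ker/= !gauss_pdfE// /E opprD expRD; ring.
have wy := wt_ge1 y.
have dw0 : 0 <= d * wt y by rewrite mulr_ge0 ?wt_ge0.
have E12 v1 v2 : `|v1 - v2| <= d * wt y ->
    `|E v1 - E v2| <= c * d * (wt y ^+ 2 * wt (y - h v1) * wt (v1 - a)).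
  move=> v12.
  have hv : `|h v2 - h v1| <= kap * (d * wt y).
    by rewrite (le_trans (hl _ _))// ler_wpM2l// distrC.
  have e1 : `|y - h v2| <= `|y - h v1| + kap * (d * wt y).
    rewrite (_ : y - h v2 = (y - h v1) - (h v2 - h v1)); last by rewrite opprB addrA subrK.
    by rewrite (le_trans (ler_normB _ _))// lerD2l.
  have e2 : `|v2 - a| <= `|v1 - a| + d * wt y.
    rewrite (_ : v2 - a = (v1 - a) - (v1 - v2)); last by rewrite opprB [RHS]addrC addrA subrK.
    by rewrite (le_trans (ler_normB _ _))// lerD2l.
  have q1 := GP (y - h v1) (y - h v2).
  have d1 : y - h v1 - (y - h v2) = h v2 - h v1.
    by rewrite opprB [LHS]addrC addrA subrK.
  have q2 := SP (v1 - a) (v2 - a).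
  have d2 : v1 - a - (v2 - a) = v1 - v2 by rewrite opprB addrA subrK.
  rewrite d1 in q1; rewrite d2 in q2.
  have dMw : d * wt y <= M * wt y by rewrite ler_wpM2r ?wt_ge0.
  have s1 : `|y - h v1| + `|y - h v2| <= (2 + kap * M) * (wt y * wt (y - h v1)).
    move: e1 dMw wy (normr_ge0 (y - h v1)); rewrite [wt (y - h v1)]/wt.
    move: (wt y) (`|y - h v1|) (`|y - h v2|) => w p q.
    move=> e1 zM w1 p0.
    have kz : kap * (d * w) <= kap * (M * w) by rewrite ler_wpM2l.
    have kM : 0 <= kap * M by rewrite mulr_ge0.
    have : 0 <= kap * M * (w * p) by rewrite !mulr_ge0// (le_trans _ w1).
    have : 0 <= (w - 1) * p by rewrite mulr_ge0// subr_ge0.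
    lra.
  have s2 : `|v1 - a| + `|v2 - a| <= (2 + M) * (wt y * wt (v1 - a)).
    move: e2 dMw wy (normr_ge0 (v1 - a)); rewrite [wt (v1 - a)]/wt.
    move: (wt y) (`|v1 - a|) (`|v2 - a|) => w p q.
    move=> e2' zM w1 p0.
    have : 0 <= M * (w * p) by rewrite !mulr_ge0// (le_trans _ w1).
    have : 0 <= (w - 1) * p by rewrite mulr_ge0// subr_ge0.
    lra.
  have P1 : 0 <= wt (y - h v1) by exact: wt_ge0.
  have b1 : `|quadf (invmx G) (y - h v1) - quadf (invmx G) (y - h v2)| <=
      cG * kap * (2 + kap * M) * (d * (wt y ^+ 2 * wt (y - h v1) * wt (v1 - a))).
    rewrite (le_trans q1)//.
    apply: (@le_trans _ _ (cG * (kap * (d * wt y)) * ((2 + kap * M) * (wt y * wt (y - h v1))))).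
      by rewrite ler_pM ?mulr_ge0 ?addr_ge0// ler_wpM2l.
    rewrite [leLHS](_ : _ = cG * kap * (2 + kap * M) * (d * (wt y ^+ 2 * wt (y - h v1)))); last by ring.
    rewrite ler_wpM2l ?mulr_ge0 ?addr_ge0 ?mulr_ge0// ler_wpM2l// ler_peMr ?wt_ge1//.
    by rewrite mulr_ge0 ?sqr_ge0.
  have b2 : `|quadf (invmx S) (v1 - a) - quadf (invmx S) (v2 - a)| <=
      cS * (2 + M) * (d * (wt y ^+ 2 * wt (y - h v1) * wt (v1 - a))).
    rewrite (le_trans q2)//.
    apply: (@le_trans _ _ (cS * (d * wt y) * ((2 + M) * (wt y * wt (v1 - a))))).
      by rewrite ler_pM ?mulr_ge0 ?addr_ge0// ler_wpM2l.
    rewrite [leLHS](_ : _ = cS * (2 + M) * (d * (wt y ^+ 2 * wt (v1 - a)))); last by ring.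
    rewrite ler_wpM2l ?mulr_ge0 ?addr_ge0// ler_wpM2l// ler_wpM2r ?wt_ge0//.
    by rewrite ler_peMr ?wt_ge1 ?sqr_ge0.
  have -> : E v1 - E v2 =
      2^-1 * (quadf (invmx G) (y - h v1) - quadf (invmx G) (y - h v2)) +
      2^-1 * (quadf (invmx S) (v1 - a) - quadf (invmx S) (v2 - a)) by rewrite /E; ring.
  rewrite (le_trans (ler_normD _ _))// !normrM (ger0_norm (x := 2^-1)) ?invr_ge0//.
  move: b1 b2; rewrite /c.
  move: (`|quadf (invmx G) (y - h v1) - _|) (`|quadf (invmx S) (v1 - a) - _|) => x z.
  rewrite -[_ * d * _]mulrA mulrDl.
  set X := _ * (d * _); set Y := cS * _ * _ => b1 b2.
  have : 0 <= X + Y.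
    by rewrite addr_ge0// !mulr_ge0 ?addr_ge0 ?mulr_ge0 ?wt_ge0 ?sqr_ge0.
  lra.
have l1 := E12 _ _ u12; have := E12 u2 u1; rewrite (distrC u2) (distrC (E u2)) => /(_ u12) l2.
have := expRN_lip (E u1) (E u2); rewrite !jE.
have x1 := expR_ge0 (- E u1); have x2 := expR_ge0 (- E u2).
move: l1 l2 x1 x2; move: (expR (- E u1)) (expR (- E u2)) (`|E u1 - E u2|) => f g e.
set A := c * d * (wt y ^+ 2 * _ * _); set B := c * d * (wt y ^+ 2 * wt (y - h u2) * _).
move=> l1 l2 x1 x2 fg.
have fgl : f <= g + (A * f + B * g).
  have := ler_norm (f - g).
  have : e * f <= A * f by rewrite ler_wpM2r.
  have : e * g <= B * g by rewrite ler_wpM2r.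
  lra.
have := ler_wpM2l k0 fgl.
rewrite /A /B => kf; refine (le_trans kf _).
by rewrite le_eqVlt; apply/orP; left; apply/eqP; ring.
Qed.

(** Translations act on [u] for fixed [y], so inequalities are obtained fiberwise in [y], while the
    joint laws are integrated over [y] first. *)
Lemma int_le_fiber (F H : T -> R) : measurable_fun setT F -> measurable_fun setT H ->
  (forall w, 0 <= F w) -> (forall w, 0 <= H w) ->
  (forall y, (\int[lebn]_u (F (u, y))%:E <= \int[lebn]_u (H (u, y))%:E)%E) ->
  (\int[lebn]_u \int[lebm]_y (F (u, y))%:E <= \int[lebn]_u \int[lebm]_y (H (u, y))%:E)%E.
Proof.
move=> mF mH F0 H0 FH; rewrite (int_swap lebn lebm mF F0) (int_swap lebn lebm mH H0).
have m2 (K : T -> R) : measurable_fun setT K -> (forall w, 0 <= K w) ->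
    measurable_fun setT (fun y => \int[lebn]_u (K (u, y))%:E)%E.
  move=> mK K0.
  have mK' : measurable_fun setT (fun w : 'cV[R]_m * 'cV[R]_n => K (w.2, w.1)) by mfun.
  exact: (measurable_int1 lebn mK' (fun w => K0 (w.2, w.1))).
apply: ge0_le_integral => //.
- by move=> y _; apply: int_ge0.
- exact: m2.
- exact: m2.
Qed.

Context (kap Kb ky : R) (kap0 : 0 <= kap) (Kb0 : 0 <= Kb) (ky0 : 0 <= ky).

Lemma wt_transport (K : 'M[R]_(n, m)) (z : 'cV[R]_m) (w : T) :
  (forall v : 'cV[R]_m, `|K *m v| <= Kb * `|v|) -> `|z| <= ky ->
  wt (w.1 + K *m (z - w.2)) <= (1 + Kb + Kb * ky) * jw w.
Proof.
move=> KB zk; rewrite /jw /wt.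
have : `|w.1 + K *m (z - w.2)| <= `|w.1| + Kb * (ky + `|w.2|).
  rewrite (le_trans (ler_normD _ _))// lerD2l (le_trans (KB _))// ler_wpM2l//.
  by rewrite (le_trans (ler_normB _ _))// lerD2r.
move: (normr_ge0 w.1) (normr_ge0 w.2) (`|w.1 + _|) => /=.
move: (`|w.1|) (`|w.2|) => p q p0 q0 s sp.
have -> : (1 + Kb + Kb * ky) * (1 + p + q) =
  1 + (p + Kb * (ky + q)) + (q + Kb * (1 + p) + Kb * ky * (p + q)) by ring.
rewrite (@le_trans _ _ (1 + (p + Kb * (ky + q))))// ?lerD2l// lerDl.
by rewrite !addr_ge0 ?mulr_ge0 ?addr_ge0.
Qed.

(** For fixed [y] the gains translate [u] by vectors that differ by [(K - K0) (z - y)]. The fourth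
    power is [2 + 2]: a quadratic weight from [f] and the factor [wt y ^+ 2] of [jker_shift]. *)
Lemma jker_transport_close : exists2 D : R, 0 <= D &
  forall (wv r : R) (h : 'cV[R]_n -> 'cV[R]_m) (a : 'cV[R]_n) (K K0 : 'M[R]_(n, m))
    (z : 'cV[R]_m) (f : 'cV[R]_n -> R),
  1 <= wv -> `|a| <= kap * wv -> measurable_fun setT h ->
  (forall u, `|h u| <= kap * wt u) ->
  (forall u u', `|h u - h u'| <= kap * `|u - u'|) ->
  (forall v : 'cV[R]_m, `|K *m v| <= Kb * `|v|) -> (forall v : 'cV[R]_m, `|K0 *m v| <= Kb * `|v|) ->
  (forall v : 'cV[R]_m, `|(K - K0) *m v| <= r * `|v|) -> 0 <= r <= Kb -> `|z| <= ky ->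
  measurable_fun setT f -> (forall u, 0 <= f u <= wt u ^+ 2) ->
  (\int[lebn]_u \int[lebm]_y (f (u + K *m (z - y)) * joint_ker h a (u, y))%:E <=
   \int[lebn]_u \int[lebm]_y (f (u + K0 *m (z - y)) * joint_ker h a (u, y))%:E +
   (D * r * wv ^+ 4)%:E)%E.
Proof.
have M0 : 0 <= Kb * (1 + ky) by rewrite mulr_ge0// addr_ge0.
have [Dj Dj0 DjP] := jker_shift kap0 M0.
have [C C0 CP] := jker_moment kap0 4 1.
have [D1 D1E] := opaque_copy (1 + Kb + Kb * ky).
have D10 : 0 <= D1 by rewrite D1E !addr_ge0// mulr_ge0.
exists (2 * (D1 ^+ 2 * (Dj * (1 + ky))) * C).
  by rewrite !mulr_ge0 ?sqr_ge0 ?addr_ge0.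
move=> wv r h a K K0 z f wv1 aw mh hg hl KB K0B KK /andP[r0 rK] zk mf fw.
have f0 u : 0 <= f u by case/andP: (fw u).
(* Indeed [r * |z - y| <= r * (ky + |y|) <= d * wt y]. *)
have [d dE] := opaque_copy (r * (1 + ky)).
have dM : 0 <= d <= Kb * (1 + ky).
  by rewrite dE mulr_ge0 ?addr_ge0//= ler_wpM2r// addr_ge0.
have d0 : 0 <= d by case/andP: dM.
have [th thE] := opaque_copy (fun w : T => Dj * d *
    (wt w.2 ^+ 2 * wt (w.2 - h w.1) * wt (w.1 - a) * joint_ker h a w)).
have mth : measurable_fun setT th by rewrite thE /joint_ker; mfun.
have th0 w : 0 <= th w by rewrite thE !mulr_ge0 ?jker_ge0 ?sqr_ge0 ?wt_ge0.
have [L LE] := opaque_copy (fun w : T => jw w ^+ 4 *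
   (wt (w.2 - h w.1) ^+ 1 * wt (w.1 - a) ^+ 1 * joint_ker h a w)).
have mL : measurable_fun setT L by rewrite LE /joint_ker /jw; mfun.
have L0 w : 0 <= L w by rewrite LE !mulr_ge0 ?jker_ge0 ?exprn_ge0 ?wt_ge0 ?jw_ge0.
have [e eE] := opaque_copy (2 * (D1 ^+ 2 * (Dj * d))).
have e0 : 0 <= e by rewrite eE !mulr_ge0 ?sqr_ge0.
have fth (N : 'M[R]_(n, m)) w : (forall v : 'cV[R]_m, `|N *m v| <= Kb * `|v|) ->
    f (w.1 + N *m (z - w.2)) * th w <= D1 ^+ 2 * (Dj * d) * L w.
  move=> NB; have /andP[_ fN] := fw (w.1 + N *m (z - w.2)).
  apply: (@le_trans _ _ ((D1 * jw w) ^+ 2 * th w)).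
    rewrite ler_wpM2r// (le_trans fN)// lerXn2r ?nnegrE ?wt_ge0 ?mulr_ge0 ?jw_ge0//.
    by rewrite D1E wt_transport.
  rewrite thE LE.
  rewrite [leLHS](_ : _ = (D1 ^+ 2 * (Dj * d)) * (jw w ^+ 2 * wt w.2 ^+ 2 *
    (wt (w.2 - h w.1) * wt (w.1 - a) * joint_ker h a w))); last by ring.
  rewrite ler_wpM2l ?mulr_ge0 ?sqr_ge0//.
  rewrite ler_wpM2r ?mulr_ge0 ?wt_ge0 ?jker_ge0//.
  rewrite -[4%N]/(2 + 2)%N exprD ler_wpM2l ?sqr_ge0//.
  by rewrite lerXn2r ?nnegrE ?wt_ge0 ?jw_ge0// /jw /wt lerD2r lerDl.
have [A AE] := opaque_copy (fun w : T => f (w.1 + K *m (z - w.2)) * joint_ker h a w).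
have [B BE] := opaque_copy (fun w : T => f (w.1 + K0 *m (z - w.2)) * joint_ker h a w).
have mA : measurable_fun setT A by rewrite AE /joint_ker; mfun.
have mB : measurable_fun setT B by rewrite BE /joint_ker; mfun.
have A0 w : 0 <= A w by rewrite AE !mulr_ge0 ?jker_ge0.
have B0 w : 0 <= B w by rewrite BE !mulr_ge0 ?jker_ge0.
have meL : measurable_fun setT (fun w => e * L w) by mfun.
have eL0 w : 0 <= e * L w by rewrite mulr_ge0.
have mBe : measurable_fun setT (fun w => B w + e * L w) by mfun.
have Be0 w : 0 <= B w + e * L w by rewrite addr_ge0.
have fib (F : T -> R) (y : 'cV[R]_m) : measurable_fun setT F ->
    measurable_fun setT (fun u => F (u, y)).
  by move=> mF; exact: (measurableT_comp mF (measurable_pair2 y)).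
have AB y : (\int[lebn]_u (A (u, y))%:E <= \int[lebn]_u (B (u, y) + e * L (u, y))%:E)%E.
  have mBy := fib B y mB; have mLy := fib (fun w => e * L w) y meL.
  rewrite (int_add lebn mBy mLy (fun u => B0 (u, y)) (fun u => eL0 (u, y))).
  have mj : measurable_fun setT (fun u => joint_ker h a (u, y)) by rewrite /joint_ker/=; mfun.
  have mt := fib th y mth.
  have mE := fib (fun w => D1 ^+ 2 * (Dj * d) * L w) y.
  have := @int_shift_compare R n f (fun u => joint_ker h a (u, y)) (fun u => th (u, y))
    (fun u => D1 ^+ 2 * (Dj * d) * L (u, y)) (K *m (z - y)) (K0 *m (z - y))
    mf mj mt (mE _) f0 (fun u => jker_ge0 h a _) (fun u => th0 _).
  rewrite AE BE eE /=.
  have -> : (\int[lebn]_u (2 * (D1 ^+ 2 * (Dj * d) * L (u, y)))%:E =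
    \int[lebn]_u (2 * (D1 ^+ 2 * (Dj * d)) * L (u, y))%:E)%E.
    by apply: eq_integral => u _; rewrite mulrA.
  apply; [by mfun| | |].
  - move=> w; rewrite thE; apply: DjP => //.
    rewrite [X in `|X|](_ : _ = - ((K - K0) *m (z - y))); last first.
      by rewrite mulmxBl !opprB addrC addrA subrK addrC.
    rewrite normrN (le_trans (KK _))// dE -mulrA ler_wpM2l//.
    rewrite (le_trans (ler_normB _ _))// /wt.
    have := normr_ge0 y; move: zk ky0; move: (`|z|) (`|y|) => p q zp k0 q0.
    have : 0 <= ky * q by rewrite mulr_ge0.
    lra.
  - by move=> u; have := fth K (u, y) KB.
  - by move=> u; have := fth K0 (u, y) K0B.
have := int_le_fiber mA mBe A0 Be0 AB; rewrite -(int_prod lebn lebm mBe Be0).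
rewrite (int_add _ mB meL B0 eL0) (int_scale _ mL e0 L0).
rewrite (int_prod lebn lebm mB B0) (int_prod lebn lebm mL L0).
rewrite {1}AE {1}BE /= => H; apply: (le_trans H); apply: leeD => //.
have -> : 2 * (D1 ^+ 2 * (Dj * (1 + ky))) * C * r * wv ^+ 4 = e * (C * wv ^+ 4).
  by rewrite eE dE; ring.
rewrite [leRHS]EFinM lee_wpmul2l ?lee_fin//.
by have := CP wv h a wv1 aw hg mh; rewrite LE.
Qed.

Section law.
Context (l : nat) (nu : probability 'cV[R]_l R) (a : 'cV[R]_l -> 'cV[R]_n).
Context (h : 'cV[R]_n -> 'cV[R]_m) (B : R).
Hypotheses (ma : measurable_fun setT a) (mh : measurable_fun setT h).
Hypotheses (ag : forall v, `|a v| <= kap * wt v) (hg : forall u, `|h u| <= kap * wt u).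
Hypothesis nuB : (\int[nu]_v (wt v ^+ 4)%:E <= B%:E)%E.
Local Notation pi0 := (density_prob (lebn \x lebm) (joint_pdf G h (mixture_pdf S nu a)))%E.

Lemma law3_le (F : T -> R) (C : R) : measurable_fun setT F -> (forall w, 0 <= F w) ->
  0 <= C ->
  (forall v, (\int[lebn]_u \int[lebm]_y (F (u, y) * joint_ker h (a v) (u, y))%:E <=
    (C * wt v ^+ 4)%:E)%E) ->
  (\int[pi0]_w (F w)%:E <= (C * B)%:E)%E.
Proof.
move=> mF F0 C0 FC; rewrite (law3 nu ma mh mF F0).
apply: (@le_trans _ _ (\int[nu]_v (C * wt v ^+ 4)%:E)%E).
  apply: ge0_le_integral => //.
  - move=> v _; apply: integral_ge0 => u _; apply: int_ge0 => y.
    by rewrite mulr_ge0 ?jker_ge0.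
  - exact: measurable_int_jker.
  - by mfun.
have mw : measurable_fun setT (fun v : 'cV[R]_l => wt v ^+ 4) by mfun.
have w0 (v : 'cV[R]_l) : 0 <= wt v ^+ 4 by rewrite exprn_ge0// wt_ge0.
by rewrite (int_scale nu mw C0 w0) [leRHS]EFinM lee_wpmul2l ?lee_fin.
Qed.

End law.

Lemma joint_moment : exists2 C : R, 0 <= C & forall l (nu : probability 'cV[R]_l R)
    (a : 'cV[R]_l -> 'cV[R]_n) (h : 'cV[R]_n -> 'cV[R]_m) (B : R),
  measurable_fun setT a -> measurable_fun setT h ->
  (forall v, `|a v| <= kap * wt v) -> (forall u, `|h u| <= kap * wt u) ->
  (\int[nu]_v (wt v ^+ 4)%:E <= B%:E)%E ->
  (\int[density_prob (lebn \x lebm) (joint_pdf G h (mixture_pdf S nu a))]_w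
    (jw w ^+ 4)%:E <= (C * B)%:E)%E.
Proof.
have [C C0 CP] := jker_moment kap0 4 0; exists C => // l nu a h B ma mh ag hg nuB.
apply: law3_le => //.
- by rewrite /jw; mfun.
- by move=> w; rewrite exprn_ge0// jw_ge0.
- move=> v; refine (le_trans _ (CP (wt v) h (a v) (wt_ge1 v) (ag v) hg mh)).
  rewrite le_eqVlt; apply/orP; left; apply/eqP; apply: eq_integral => u _; apply: eq_integral => y _.
  by rewrite !expr0 !mul1r.
Qed.

Lemma transport_close : exists2 D : R, 0 <= D &
  forall l (nu : probability 'cV[R]_l R) (a : 'cV[R]_l -> 'cV[R]_n)
    (h : 'cV[R]_n -> 'cV[R]_m) (B r : R) (K K0 : 'M[R]_(n, m))
    (z : 'cV[R]_m) (f : 'cV[R]_n -> R),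
  measurable_fun setT a -> measurable_fun setT h ->
  (forall v, `|a v| <= kap * wt v) -> (forall u, `|h u| <= kap * wt u) ->
  (forall u u', `|h u - h u'| <= kap * `|u - u'|) ->
  (\int[nu]_v (wt v ^+ 4)%:E <= B%:E)%E ->
  (forall v : 'cV[R]_m, `|K *m v| <= Kb * `|v|) -> (forall v : 'cV[R]_m, `|K0 *m v| <= Kb * `|v|) ->
  (forall v : 'cV[R]_m, `|(K - K0) *m v| <= r * `|v|) -> 0 <= r <= Kb -> `|z| <= ky ->
  measurable_fun setT f -> (forall u, 0 <= f u <= wt u ^+ 2) ->
  (\int[density_prob (lebn \x lebm)
    (joint_pdf G h (mixture_pdf S nu a))]_w (f (w.1 + K *m (z - w.2)))%:E <=
   \int[density_prob (lebn \x lebm)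
    (joint_pdf G h (mixture_pdf S nu a))]_w (f (w.1 + K0 *m (z - w.2)))%:E + (D * r * B)%:E)%E.
Proof.
have [D D0 DP] := jker_transport_close; exists D => //.
move=> l nu a h B r K K0 z f ma mh ag hg hl nuB KB K0B KK rK zk mf fw.
have f0 u : 0 <= f u by case/andP: (fw u).
have r0 : 0 <= r by case/andP: rK.
have mT (N : 'M[R]_(n, m)) : measurable_fun setT (fun w : T => f (w.1 + N *m (z - w.2))).
  by mfun.
have fT (N : 'M[R]_(n, m)) (w : T) : 0 <= f (w.1 + N *m (z - w.2)) by [].
rewrite (law3 nu ma mh (mT K) (fT K)) (law3 nu ma mh (mT K0) (fT K0)).
have mw : measurable_fun setT (fun v : 'cV[R]_l => wt v ^+ 4) by mfun.
have w0 (v : 'cV[R]_l) : 0 <= wt v ^+ 4 by rewrite exprn_ge0// wt_ge0.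
have Dr0 : 0 <= D * r by rewrite mulr_ge0.
have I0 (N : 'M[R]_(n, m)) v : (0 <= \int[lebn]_u \int[lebm]_y
    (f (u + N *m (z - y)) * joint_ker h (a v) (u, y))%:E)%E.
  by apply: integral_ge0 => u _; apply: int_ge0 => y; rewrite mulr_ge0 ?jker_ge0.
have mI N := measurable_int_jker ma mh (mT N) (fT N).
apply: (@le_trans _ _ (\int[nu]_v (\int[lebn]_u \int[lebm]_y
    (f (u + K0 *m (z - y)) * joint_ker h (a v) (u, y))%:E + (D * r * wt v ^+ 4)%:E))%E).
  apply: ge0_le_integral => //.
  - by apply: emeasurable_funD; [exact: (mI K0)|mfun].
  - by move=> v _; exact: DP (wt_ge1 v) (ag v) mh hg hl KB K0B KK rK zk mf fw.
rewrite ge0_integralD//.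
- apply: leeD => //.
  by rewrite (int_scale nu mw Dr0 w0) [leRHS]EFinM lee_wpmul2l ?lee_fin.
- by move=> v _; rewrite lee_fin mulr_ge0.
- by mfun.
Qed.

End transport_stability.

(** * One step of the filters *)

Lemma eq_close (R : realType) (X X' Y Y' c : \bar R) : X = X' -> Y = Y' ->
  (X' <= Y' + c)%E /\ (Y' <= X' + c)%E -> (X <= Y + c)%E /\ (Y <= X + c)%E.
Proof. by move=> -> ->. Qed.

Lemma mclose_le (R : realType) d (T : measurableType d) (W : T -> R) (e e' : R)
    (mu nu : {measure set T -> \bar R}) :
  e <= e' -> mclose W e mu nu -> mclose W e' mu nu.
Proof.
move=> ee cl f mf fW; have [H1 H2] := cl f mf fW.
by split; [apply: (le_trans H1)|apply: (le_trans H2)]; rewrite leeD2l// lee_fin.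
Qed.

Lemma mclose_bound (R : realType) d (T : measurableType d) (W : T -> R) (e B : R)
    (mu nu : {measure set T -> \bar R}) :
  measurable_fun setT W -> (forall x, 0 <= W x) -> mclose W e mu nu ->
  (\int[nu]_x (W x)%:E <= B%:E)%E -> (\int[mu]_x (W x)%:E <= (B + e)%:E)%E.
Proof.
move=> mW W0 cl nuB.
have [H _] := cl W mW (fun x => introT andP (conj (W0 x) (lexx (W x)))).
by rewrite (le_trans H)// EFinD leeD2r.
Qed.

Section steps.
Context (R : realType) (n m : nat) (S : 'M[R]_n) (G : 'M[R]_m).
Hypotheses (pS : posdefmx S) (pG : posdefmx G).
Local Notation lebn := (lebesgue_cV R n).
Local Notation lebm := (lebesgue_cV R m).
Local Notation T := ('cV[R]_n * 'cV[R]_m)%type.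
Local Notation wt2 := (fun v => wt v ^+ 2).
Local Notation jw2 := (fun w => jw w ^+ 2).
Context (kap ky : R) (kap0 : 0 <= kap) (ky0 : 0 <= ky).

Lemma wt2_wt4 l (v : 'cV[R]_l) : wt v ^+ 2 <= wt v ^+ 4.
Proof. by rewrite ler_weXn2l// wt_ge1. Qed.

Lemma measurable_wt2 l : measurable_fun setT (fun v : 'cV[R]_l => wt v ^+ 2).
Proof. by mfun. Qed.

Lemma wt2_ge0 l (v : 'cV[R]_l) : 0 <= wt v ^+ 2.
Proof. by rewrite exprn_ge0// wt_ge0. Qed.

(** [kernel_close] takes the second moment of the perturbed law, which is at most [B + del]; the
    additional [eps * del] is absorbed since [eps <= 1]. *)
Lemma loss_le (C eps B del : R) : 0 <= C -> 0 <= eps -> eps <= 1 -> 0 <= B -> 0 <= del ->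
  C * (eps * (B + del) + del) <= 2 * C * (eps * B + del).
Proof.
move=> C0 e0 e1 B0 d0; rewrite mulrAC [leRHS]mulrC ler_wpM2l//.
have : 0 <= eps * B by rewrite mulr_ge0.
have : 0 <= (1 - eps) * del by rewrite mulr_ge0// subr_ge0.
lra.
Qed.

Lemma int_wt2_le l (nu : probability 'cV[R]_l R) (B : R) :
  (\int[nu]_v (wt v ^+ 4)%:E <= B%:E)%E -> (\int[nu]_v (wt v ^+ 2)%:E <= B%:E)%E.
Proof.
apply: le_trans; apply: int_le; [by mfun|by mfun| |exact: wt2_wt4].
by move=> v; rewrite exprn_ge0// wt_ge0.
Qed.

Lemma predict_close : exists2 C : R, 0 <= C &
  forall (mu nu : probability 'cV[R]_n R) (Psi Psi0 : 'cV[R]_n -> 'cV[R]_n) (del eps B : R),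
  0 <= del -> eps <= 1 -> 0 <= B ->
  measurable_fun setT Psi -> measurable_fun setT Psi0 ->
  (forall v, `|Psi v - Psi0 v| <= eps) -> (forall v, `|Psi0 v| <= kap * wt v) ->
  mclose wt2 del mu nu -> (\int[nu]_v (wt v ^+ 2)%:E <= B%:E)%E ->
  mclose wt2 (C * (eps * B + del)) (density_prob lebn (mixture_pdf S mu Psi))
    (density_prob lebn (mixture_pdf S nu Psi0)).
Proof.
have [C C0 CP] := kernel_close pS kap0; exists (2 * C); first by rewrite mulr_ge0.
move=> mu nu Psi Psi0 del eps B del0 e1 B0 mP mP0 PP Pg cl nuB.
have muB := mclose_bound (@measurable_wt2 n) (@wt2_ge0 n) cl nuB.
have BD0 : 0 <= B + del by rewrite addr_ge0.
apply: mclose_le (loss_le C0 (le_trans (normr_ge0 _) (PP 0)) e1 B0 del0) _ => f mf fw.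
have fw2 x : 0 <= f x <= wt x ^+ 2 by exact: fw.
have E1 := law_mixture pS mu mP mf fw2.
have E2 := law_mixture pS nu mP0 mf fw2.
have mF : measurable_fun setT (fun w : 'cV[R]_n * 'cV[R]_n => f w.2) by mfun.
refine (eq_close E1 E2 (CP _ mu nu del eps (B + del) Psi Psi0 (fun w => f w.2)
  del0 e1 BD0 mP mP0 PP Pg cl muB mF _)).
move=> v x /=; have /andP[-> fx] := fw x; rewrite (le_trans fx)//=.
by rewrite lerXn2r ?nnegrE ?wt_ge0 ?addr_ge0 ?wt_ge0// /wt lerD2r lerDl.
Qed.

Lemma predict_moment : exists2 C : R, 0 <= C &
  forall (nu : probability 'cV[R]_n R) (Psi0 : 'cV[R]_n -> 'cV[R]_n) (B : R),
  measurable_fun setT Psi0 -> (forall v, `|Psi0 v| <= kap * wt v) ->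
  (\int[nu]_v (wt v ^+ 2)%:E <= B%:E)%E ->
  (\int[density_prob lebn (mixture_pdf S nu Psi0)]_u (wt u ^+ 2)%:E <= (C * B)%:E)%E.
Proof.
have [C C0 CP] := gexp_le pS 2.
exists (C * (1 + kap) ^+ 2) => [|nu Psi0 B mP Pg nuB]; first by rewrite mulr_ge0 ?sqr_ge0.
have ww (x : 'cV[R]_n) : 0 <= wt x ^+ 2 <= wt x ^+ 2 by rewrite wt2_ge0 lexx.
have E := law_mixture pS nu mP (@measurable_wt2 n) ww; rewrite E.
have C'0 : 0 <= C * (1 + kap) ^+ 2 by rewrite mulr_ge0 ?sqr_ge0.
apply: (@le_trans _ _ (\int[nu]_v (C * (1 + kap) ^+ 2 * wt v ^+ 2)%:E)%E).
  apply: int_le.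
  - have mF : measurable_fun setT (fun w : 'cV[R]_n * 'cV[R]_n => wt w.2 ^+ 2) by mfun.
    exact: (measurable_gexp pS mF (fun w => wt2_ge0 w.2) mP).
  - by mfun.
  - by move=> v; apply: gexp_ge0 => // x; exact: wt2_ge0.
  - move=> v; rewrite (le_trans (CP 1 _ _ (@measurable_wt2 n) (lexx 1) ww))// -mulrA -exprMn ler_wpM2l//.
    rewrite lerXn2r ?nnegrE ?addr_ge0 ?mulr_ge0 ?wt_ge0 ?addr_ge0//.
    by rewrite mulrDl mul1r lerD// wt_ge1.
by rewrite (int_scale nu (@measurable_wt2 n) C'0 (@wt2_ge0 n)) [leRHS]EFinM lee_wpmul2l ?lee_fin.
Qed.

Lemma joint_close : exists2 C : R, 0 <= C &
  forall (r r0 : 'cV[R]_n -> R) (h h0 : 'cV[R]_n -> 'cV[R]_m) (del eps B : R),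
  is_density lebn r -> is_density lebn r0 ->
  0 <= del -> eps <= 1 -> 0 <= B ->
  measurable_fun setT h -> measurable_fun setT h0 ->
  (forall v, `|h v - h0 v| <= eps) -> (forall v, `|h0 v| <= kap * wt v) ->
  mclose wt2 del (density_prob lebn r) (density_prob lebn r0) ->
  (\int[density_prob lebn r0]_v (wt v ^+ 2)%:E <= B%:E)%E ->
  mclose jw2 (C * (eps * B + del)) (density_prob (lebn \x lebm)%E (joint_pdf G h r))
    (density_prob (lebn \x lebm)%E (joint_pdf G h0 r0)).
Proof.
have [C C0 CP] := kernel_close pG kap0; exists (2 * C); first by rewrite mulr_ge0.
move=> r r0 h h0 del eps B rd rd0 del0 e1 B0 mh mh0 hh hg cl nuB.
have muB := mclose_bound (@measurable_wt2 n) (@wt2_ge0 n) cl nuB.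
have BD0 : 0 <= B + del by rewrite addr_ge0.
apply: mclose_le (loss_le C0 (le_trans (normr_ge0 _) (hh 0)) e1 B0 del0) _ => f mf fw.
have fuy u y : 0 <= f (u, y) <= (wt u + `|y|) ^+ 2 by exact: fw.
have E1 := law_joint pG mh rd mf fuy; have E2 := law_joint pG mh0 rd0 mf fuy.
exact (eq_close E1 E2 (CP _ (density_prob lebn r) (density_prob lebn r0) del eps
  (B + del) h h0 f del0 e1 BD0 mh mh0 hh hg cl muB mf fuy)).
Qed.

(** Given [u], the variance of [y] is that of the observation noise, about whatever center. Hence
    [c] depends on [G] alone and serves all laws and observation maps. *)
Lemma coercive_joint : exists2 c : R, 0 < c &
  forall (r : 'cV[R]_n -> R) (h : 'cV[R]_n -> 'cV[R]_m) (B : R),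
  is_density lebn r -> measurable_fun setT h ->
  (\int[density_prob (lebn \x lebm) (joint_pdf G h r)]_w (jw w ^+ 2)%:E <= B%:E)%E ->
  forall x, c * `|x| ^+ 2 <= quadf (cov_yy (density_prob (lebn \x lebm)%E (joint_pdf G h r))) x.
Proof.
have [c c0 cP] := gauss_variance_ge pG; exists c => // r h B rd mh iB x.
have [mr r0 r1] := rd.
have [a ->] := quadf_cov_yy iB x.
have [F FE] := opaque_copy (fun w : T => ((x^T *m w.2) 0 0 - a) ^+ 2).
have mF : measurable_fun setT F.
  rewrite FE; have md := measurable_dot x (measurable_snd (T1 := 'cV[R]_n) (T2 := 'cV[R]_m)).
  by mfun.
have F0 w : 0 <= F w by rewrite FE sqr_ge0.
have [D DE] := opaque_copy (m%:R * `|x^T| + `|a|).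
have D0 : 0 <= D by rewrite DE addr_ge0// mulr_ge0.
have FD w : `|F w| <= D ^+ 2 * jw w ^+ 2.
  rewrite ger0_norm// FE -exprMn -[leLHS]ger0_norm ?sqr_ge0// normrX.
  rewrite lerXn2r ?nnegrE ?mulr_ge0 ?jw_ge0// (le_trans (ler_normB _ _))// DE mulrDl.
  apply: lerD; last by rewrite ler_peMr// jw_ge1.
  rewrite (le_trans (ler_coord _ _ _))// (le_trans (ler_norm_mulmx _ _))//.
  by rewrite ler_wpM2l ?mulr_ge0// /jw lerDr wt_ge0.
have IF : intg (density_prob (lebn \x lebm)%E (joint_pdf G h r)) F.
  apply: (intg_dominated (W := jw2) (C := D ^+ 2)) => //.
  - exact: measurable_jw2.
  - exact: jw2_ge0.
  - by rewrite (le_lt_trans iB)// ltry.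
  - exact: sqr_ge0.
rewrite -FE -lee_fin /Ex fineK; last exact: (integrable_fin_num measurableT IF).
rewrite (law_joint_iter pG mh rd mF F0).
have [k kE] := opaque_copy (c * `|x| ^+ 2).
have k0 : 0 <= k by rewrite kE mulr_ge0 ?sqr_ge0// ltW.
rewrite -kE.
(* Writing the constant as an integral against the density [r] reduces the claim to a pointwise
   inequality in [u]. *)
have -> : (k%:E = \int[lebn]_u (k * r u)%:E)%E.
  by rewrite (int_scale lebn mr k0 r0) r1 mule1.
have [H HE] := opaque_copy (fun w : T => r w.1 * (F w * gauss_pdf G (h w.1) w.2)).
have mH : measurable_fun setT H by rewrite HE; mfun.
have H0 w : 0 <= H w by rewrite HE !mulr_ge0 ?gauss_ge0.
apply: ge0_le_integral => //.
- by move=> u _; rewrite lee_fin mulr_ge0.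
- by mfun.
- by have := measurable_int1 lebm mH H0; rewrite HE.
move=> u _.
have mg : measurable_fun setT (fun y => F (u, y) * gauss_pdf G (h u) y).
  have mFu : measurable_fun setT (fun y => F (u, y)).
    exact: (measurableT_comp mF (measurable_pair1 u)).
  by mfun.
rewrite (int_scale lebm mg (r0 u)); last by move=> y; rewrite mulr_ge0 ?gauss_ge0.
rewrite mulrC EFinM lee_wpmul2l ?lee_fin// kE FE.
exact: (cP (h u) x a).
Qed.

End steps.

(** * Stability of conditioning *)

Section conditioning.
Context (R : realType) (n m : nat) (G : 'M[R]_m) (pG : posdefmx G).
Local Notation lebn := (lebesgue_cV R n).
Local Notation wt2 := (fun v => wt v ^+ 2).
Context (kap ky : R) (kap0 : 0 <= kap) (ky0 : 0 <= ky).

(** The observation density is evaluated at the datum [y] instead of being integrated over it, so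
    the uniform bound [gauss_lip_bound] takes the place of [gexp_lip]. *)
Lemma likelihood_close : exists2 D : R, 0 <= D &
  forall (P P0 : probability 'cV[R]_n R) (h h0 : 'cV[R]_n -> 'cV[R]_m) (del eps B : R)
    (y : 'cV[R]_m) (f : 'cV[R]_n -> R),
  0 <= del -> eps <= 1 -> 0 <= B ->
  measurable_fun setT h -> measurable_fun setT h0 -> (forall v, `|h v - h0 v| <= eps) ->
  mclose wt2 del P P0 -> (\int[P0]_v (wt v ^+ 2)%:E <= B%:E)%E ->
  measurable_fun setT f -> (forall u, 0 <= f u <= wt u ^+ 2) ->
  (\int[P]_u (f u * gauss_pdf G (h u) y)%:E <=
    \int[P0]_u (f u * gauss_pdf G (h0 u) y)%:E + (D * (eps * B + del))%:E)%E /\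
  (\int[P0]_u (f u * gauss_pdf G (h0 u) y)%:E <=
    \int[P]_u (f u * gauss_pdf G (h u) y)%:E + (D * (eps * B + del))%:E)%E.
Proof.
have [C C0 CP] := gauss_lip_bound pG.
have [Cg Cg0 CgP] := gauss_bound pG 0.
have [K KE] := opaque_copy (C + Cg + 1).
have K0 : 0 < K by rewrite KE ltr_wpDl// addr_ge0.
exists (2 * K + K) => [|P P0 h h0 del eps B y f del0 e1 B0 mh mh0 hh cl P0B mf fw].
  by rewrite addr_ge0 ?mulr_ge0// ltW.
have e0 : 0 <= eps := le_trans (normr_ge0 _) (hh 0).
have PB := mclose_bound (@measurable_wt2 R n) (@wt2_ge0 R n) cl P0B.
have f0 u : 0 <= f u by case/andP: (fw u).
have gK a x : gauss_pdf G a x <= K.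
  have := CgP a x; rewrite expr0 mul1r => /le_trans; apply.
  by rewrite KE -addrA addrCA lerDl addr_ge0.
have hl u : `|gauss_pdf G (h u) y - gauss_pdf G (h0 u) y| <= K * eps.
  rewrite (le_trans (CP _ _ _ (le_trans (hh u) e1)))// ler_pM//.
  by rewrite KE -addrA lerDl addr_ge0.
have Ke0 : 0 <= K * eps by rewrite mulr_ge0// ltW.
have step (a b : 'cV[R]_n -> 'cV[R]_m) : measurable_fun setT a -> measurable_fun setT b ->
    (forall u, `|gauss_pdf G (a u) y - gauss_pdf G (b u) y| <= K * eps) ->
    (\int[P]_u (f u * gauss_pdf G (a u) y)%:E <=
     \int[P]_u (f u * gauss_pdf G (b u) y)%:E + (K * eps * (B + del))%:E)%E.
  move=> ma mb ab.
  have mb' : measurable_fun setT (fun u => f u * gauss_pdf G (b u) y) by mfun.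
  have mw : measurable_fun setT (fun u : 'cV[R]_n => K * eps * wt u ^+ 2) by mfun.
  have b0 u : 0 <= f u * gauss_pdf G (b u) y by rewrite mulr_ge0 ?gauss_ge0.
  have w0 (u : 'cV[R]_n) : 0 <= K * eps * wt u ^+ 2 by rewrite mulr_ge0 ?wt2_ge0.
  apply: (@le_trans _ _ (\int[P]_u (f u * gauss_pdf G (b u) y + K * eps * wt u ^+ 2)%:E)%E).
    apply: int_le; [by mfun|by mfun|by move=> u; rewrite mulr_ge0 ?gauss_ge0|] => u.
    have /andP[_ fu] := fw u.
    have := ab u => /(le_trans (ler_norm _)); rewrite lerBlDl => abu.
    rewrite (le_trans (ler_wpM2l (f0 u) abu))// mulrDr lerD2l mulrC.
    by rewrite ler_wpM2l.
  rewrite (int_add P mb' mw b0 w0) leeD2l//.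
  rewrite (int_scale P (@measurable_wt2 R n) Ke0 (@wt2_ge0 R n)).
  by rewrite [leRHS]EFinM lee_wpmul2l ?lee_fin.
have swap (mu nu : probability 'cV[R]_n R) : mclose wt2 del mu nu ->
    (\int[mu]_u (f u * gauss_pdf G (h0 u) y)%:E <=
     \int[nu]_u (f u * gauss_pdf G (h0 u) y)%:E + (K * del)%:E)%E.
  move=> c; apply: (mclose_scale c K0); first by mfun.
  move=> u; rewrite mulr_ge0 ?gauss_ge0//= mulrC.
  by have /andP[_ fu] := fw u; rewrite ler_pM ?gauss_ge0.
have bnd : K * del + K * eps * (B + del) <= (2 * K + K) * (eps * B + del).
  have := loss_le (ltW K0) e0 e1 B0 del0.
  have : 0 <= K * (eps * B) by rewrite !mulr_ge0// ltW.
  have : 0 <= K * del by rewrite !mulr_ge0// ltW.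
  by lra.
have fin (X : \bar R) : (X + (K * del)%:E + (K * eps * (B + del))%:E <=
    X + ((2 * K + K) * (eps * B + del))%:E)%E.
  by rewrite -addeA leeD2l// -EFinD lee_fin.
split.
  refine (le_trans (step h h0 mh mh0 hl) (le_trans _ (fin _))).
  by rewrite leeD2r// swap.
have fin' (X : \bar R) : (X + (K * eps * (B + del))%:E + (K * del)%:E <=
    X + ((2 * K + K) * (eps * B + del))%:E)%E.
  by rewrite addeAC.
refine (le_trans (swap P0 P (mclose_sym cl)) (le_trans _ (fin' _))).
refine (leeD2r _ (step h0 h mh0 mh _)) => u.
by rewrite distrC hl.
Qed.

(* The likelihood is at least a multiple of [exp (- K * wt u ^+ 2)]; the tangent
   bound [exp (- t) >= exp (- M) (1 + M - t)] at [M = K B] carries this lower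
   bound over to the expectation. *)
Lemma normalizer_ge (B : R) : exists2 z : R, 0 < z &
  forall (P : probability 'cV[R]_n R) (h : 'cV[R]_n -> 'cV[R]_m) (y : 'cV[R]_m),
  measurable_fun setT h -> (forall v, `|h v| <= kap * wt v) -> `|y| <= ky ->
  (\int[P]_v (wt v ^+ 2)%:E <= B%:E)%E ->
  (z%:E <= \int[P]_u (gauss_pdf G (h u) y)%:E)%E.
Proof.
have [iG _] := posdef_inv pG.
have [q q0 qP] := quadf_shift_le iG.
have [k kE] := opaque_copy ((Num.sqrt ((2 * pi) ^+ m * \det G))^-1).
have k0 : 0 < k by rewrite kE gauss_cst_gt0.
have [K KE] := opaque_copy (2^-1 * (q * (ky + kap) ^+ 2)).
have K0 : 0 <= K by rewrite KE mulr_ge0 ?invr_ge0// mulr_ge0 ?sqr_ge0.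
have [M ME] := opaque_copy (K * B).
have [z zE] := opaque_copy (k * expR (- M)).
have z0 : 0 < z by rewrite zE mulr_gt0 ?expR_gt0.
exists z => // P h y mh hg yk PB.
have gl u : z * (1 + M) <= gauss_pdf G (h u) y + z * K * wt u ^+ 2.
  have e1 : 2^-1 * quadf (invmx G) (y - h u) <= K * wt u ^+ 2.
    have := qP (y - h u) 0; rewrite quadf0 !subr0 normr0 addr0.
    move=> /(le_trans (ler_norm _)) h1.
    have h2 : `|y - h u| <= (ky + kap) * wt u.
      rewrite (le_trans (ler_normB _ _))// mulrDl lerD//.
      by rewrite (le_trans yk)// ler_peMr ?wt_ge1.
    rewrite KE -mulrA ler_wpM2l ?invr_ge0// (le_trans h1)//.
    by rewrite -mulrA -[leRHS]mulrA ler_wpM2l// -exprMn expr2 ler_pM.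
  have e2 : z * (1 + M - K * wt u ^+ 2) <= gauss_pdf G (h u) y.
    rewrite gauss_pdfE// -kE zE -mulrA ler_wpM2l ?(ltW k0)//.
    apply: (@le_trans _ _ (expR (- (K * wt u ^+ 2)))); last by rewrite ler_expR lerN2.
    have -> : expR (- (K * wt u ^+ 2)) = expR (- M) * expR (M - K * wt u ^+ 2).
      by rewrite -expRD; congr expR; ring.
    by rewrite ler_wpM2l ?expR_ge0// -addrA expR_ge1Dx.
  by move: e2; lra.
have mg : measurable_fun setT (fun u => gauss_pdf G (h u) y) by mfun.
have mw : measurable_fun setT (fun u : 'cV[R]_n => z * K * wt u ^+ 2) by mfun.
have zK0 : 0 <= z * K by rewrite mulr_ge0// ltW.
have w0 (u : 'cV[R]_n) : 0 <= z * K * wt u ^+ 2 by rewrite mulr_ge0 ?wt2_ge0.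
have M0 : 0 <= M.
  rewrite ME mulr_ge0// -lee_fin (le_trans _ PB)//.
  by apply: int_ge0 => v; exact: wt2_ge0.
have : ((z * (1 + M))%:E <= \int[P]_u (gauss_pdf G (h u) y)%:E + (z * M)%:E)%E.
  have <- := int_prob_cst P (z * (1 + M)).
  have g0 u : 0 <= gauss_pdf G (h u) y by rewrite gauss_ge0.
  have zM0 : 0 <= z * (1 + M) by rewrite mulr_ge0 ?addr_ge0// ltW.
  refine (le_trans (int_le P _ _ (fun=> zM0) gl) _); [by mfun|by mfun|].
  rewrite (int_add P mg mw g0 w0) leeD2l//.
  rewrite (int_scale P (@measurable_wt2 R n) zK0 (@wt2_ge0 R n)).
  by rewrite ME mulrA [leRHS]EFinM lee_wpmul2l ?lee_fin.
by rewrite -leeBlDr// -EFinB mulrDr mulr1 addrK.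
Qed.

(** One-sided, so that exchanging the two laws gives the other half of [mclose]; [z] is the common
    lower bound of the normalizing constants. *)
Lemma ratio_le (N N0 Z Z0 a b A z : R) : 0 < z -> z <= Z -> z <= Z0 ->
  0 <= a -> 0 <= N0 <= A -> N <= N0 + a -> Z0 <= Z + b -> 0 <= b ->
  Z^-1 * N <= Z0^-1 * N0 + (z^-1 * a + z^-1 ^+ 2 * A * b).
Proof.
move=> z0 zZ zZ0 a0 /andP[N00 NA] NN ZZ b0.
have Z_0 : 0 < Z by rewrite (lt_le_trans z0).
have Z0_0 : 0 < Z0 by rewrite (lt_le_trans z0).
have iZ : Z^-1 <= z^-1 by rewrite lef_pV2.
have iZ0 : Z0^-1 <= z^-1 by rewrite lef_pV2.
have iZp : 0 <= Z^-1 by rewrite invr_ge0 ltW.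
have iZ0p : 0 <= Z0^-1 by rewrite invr_ge0 ltW.
have h1 : Z^-1 * N <= Z^-1 * N0 + z^-1 * a.
  by rewrite (le_trans (ler_wpM2l iZp NN))// mulrDr lerD2l ler_wpM2r.
have h2 : Z^-1 * N0 - Z0^-1 * N0 <= z^-1 ^+ 2 * A * b.
  have -> : Z^-1 * N0 - Z0^-1 * N0 = Z^-1 * Z0^-1 * N0 * (Z0 - Z).
    by field; rewrite !gt_eqF.
  have [ZZ'|ZZ'] := leP (Z0 - Z) 0.
    apply: (@le_trans _ _ 0).
      by rewrite mulr_ge0_le0 ?mulr_ge0.
    by rewrite mulr_ge0// mulr_ge0 ?sqr_ge0// (le_trans N00).
  rewrite expr2 ler_pM ?mulr_ge0 ?(ltW ZZ')//; last by rewrite lerBlDl.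
  by rewrite ler_pM ?mulr_ge0// ler_pM.
move: h1 h2; lra.
Qed.

Lemma condition_close (B Del : R) : 0 <= B -> 0 <= Del -> exists2 C : R, 0 <= C &
  forall (r r0 : 'cV[R]_n -> R) (h h0 : 'cV[R]_n -> 'cV[R]_m) (del eps : R) (y : 'cV[R]_m),
  is_density lebn r -> is_density lebn r0 ->
  0 <= del <= Del -> eps <= 1 ->
  measurable_fun setT h -> measurable_fun setT h0 ->
  (forall v, `|h v - h0 v| <= eps) ->
  (forall v, `|h v| <= kap * wt v) -> (forall v, `|h0 v| <= kap * wt v) -> `|y| <= ky ->
  mclose wt2 del (density_prob lebn r) (density_prob lebn r0) ->
  (\int[density_prob lebn r0]_v (wt v ^+ 2)%:E <= B%:E)%E ->
  mclose wt2 (C * (eps + del)) (density_prob lebn (condition_pdf y (joint_pdf G h r)))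
    (density_prob lebn (condition_pdf y (joint_pdf G h0 r0))).
Proof.
move=> B0 Del0.
have [D D0 DP] := likelihood_close.
have [z z0 zP] := normalizer_ge (B + Del).
have [Cg Cg0 CgP] := gauss_bound pG 0.
have [A AE] := opaque_copy (Cg * (B + Del)).
have A0 : 0 <= A by rewrite AE mulr_ge0// addr_ge0.
have [E EE] := opaque_copy (D * (B + 1)).
have E0 : 0 <= E by rewrite EE mulr_ge0// addr_ge0.
have iz0 : 0 <= z^-1 by rewrite invr_ge0 ltW.
exists (z^-1 * E + z^-1 ^+ 2 * A * E).
  by rewrite addr_ge0 ?mulr_ge0.
move=> r r0 h h0 del eps y rd rd0 /andP[del0 delD] e1 mh mh0 hh hg hg0 yk cl P0B f mf fw.
have e0 : 0 <= eps := le_trans (normr_ge0 _) (hh 0).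
have PB := mclose_bound (@measurable_wt2 R n) (@wt2_ge0 R n) cl P0B.
have BD : B + del <= B + Del by rewrite lerD2l.
have PB' : (\int[density_prob lebn r]_v (wt v ^+ 2)%:E <= (B + Del)%:E)%E.
  by rewrite (le_trans PB)// lee_fin.
have P0B' : (\int[density_prob lebn r0]_v (wt v ^+ 2)%:E <= (B + Del)%:E)%E.
  by rewrite (le_trans P0B)// lee_fin lerDl.
have f0 u : 0 <= f u by case/andP: (fw u).
have [t tE] := opaque_copy (E * (eps + del)).
have t0 : 0 <= t by rewrite tE mulr_ge0// addr_ge0.
have Dt : D * (eps * B + del) <= t.
  rewrite tE EE -mulrA ler_wpM2l//.
  have : 0 <= B * del by rewrite mulr_ge0.
  lra.
have fin (rho : probability 'cV[R]_n R) (k : 'cV[R]_n -> 'cV[R]_m) (g : 'cV[R]_n -> R) :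
    measurable_fun setT k -> measurable_fun setT g -> (forall u, 0 <= g u <= wt u ^+ 2) ->
    (\int[rho]_v (wt v ^+ 2)%:E <= (B + Del)%:E)%E ->
    exists2 N : R, 0 <= N <= A & (\int[rho]_u (g u * gauss_pdf G (k u) y)%:E = N%:E)%E.
  move=> mk mg gw rB.
  have g0 u : 0 <= g u by case/andP: (gw u).
  have le : (\int[rho]_u (g u * gauss_pdf G (k u) y)%:E <= A%:E)%E.
    apply: (@le_trans _ _ (\int[rho]_u (Cg * wt u ^+ 2)%:E)%E).
      apply: int_le; [by mfun|by mfun|by move=> u; rewrite mulr_ge0 ?gauss_ge0|] => u.
      have /andP[_ gu] := gw u; have := CgP (k u) y; rewrite expr0 mul1r => kC.
      by rewrite mulrC ler_pM ?gauss_ge0.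
    rewrite (int_scale rho (@measurable_wt2 R n) Cg0 (@wt2_ge0 R n)).
    by rewrite AE [leRHS]EFinM lee_wpmul2l ?lee_fin.
  have ge : (0 <= \int[rho]_u (g u * gauss_pdf G (k u) y)%:E)%E.
    by apply: int_ge0 => u; rewrite mulr_ge0 ?gauss_ge0.
  move: le ge; case: (\int[rho]_u _)%E => [N| |]//; rewrite !lee_fin => le ge.
  by exists N => //; rewrite ge le.
(* The constant function 1 is an admissible test function, so the normalizing constants obey the
   same estimates as the numerators. *)
have w1 (u : 'cV[R]_n) : (0 : R) <= 1 <= wt u ^+ 2.
  by rewrite ler01 exprn_ege1// wt_ge1.
have m1 : measurable_fun setT (fun u : 'cV[R]_n => 1 : R) by mfun.
have [N /andP[N0 NA] NE] := fin (density_prob lebn r) h f mh mf fw PB'.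
have [N' /andP[N'0 N'A] N'E] := fin (density_prob lebn r0) h0 f mh0 mf fw P0B'.
have [Z _ ZE] := fin (density_prob lebn r) h _ mh m1 w1 PB'.
have [Z' _ Z'E] := fin (density_prob lebn r0) h0 _ mh0 m1 w1 P0B'.
have zZ : z <= Z.
  rewrite -lee_fin -ZE; under eq_integral do rewrite mul1r.
  exact: (zP (density_prob lebn r) h y mh hg yk PB').
have zZ' : z <= Z'.
  rewrite -lee_fin -Z'E; under eq_integral do rewrite mul1r.
  exact: (zP (density_prob lebn r0) h0 y mh0 hg0 yk P0B').
have [] := DP (density_prob lebn r) (density_prob lebn r0) h h0 del eps B y f
  del0 e1 B0 mh mh0 hh cl P0B mf fw.
rewrite NE N'E -!EFinD !lee_fin => NN' N'N.
have [] := DP (density_prob lebn r) (density_prob lebn r0) h h0 del eps B y _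
  del0 e1 B0 mh mh0 hh cl P0B m1 w1.
rewrite ZE Z'E -!EFinD !lee_fin => ZZ' Z'Z.
have Zr : (\int[density_prob lebn r]_u gauss_pdf G (h u) y)%R = Z.
  by rewrite /Rintegral; under eq_integral do rewrite -[gauss_pdf _ _ _]mul1r; rewrite ZE.
have Z'r : (\int[density_prob lebn r0]_u gauss_pdf G (h0 u) y)%R = Z'.
  by rewrite /Rintegral; under eq_integral do rewrite -[gauss_pdf _ _ _]mul1r; rewrite Z'E.
have Zp : 0 < (\int[density_prob lebn r]_u gauss_pdf G (h u) y)%R.
  by rewrite Zr (lt_le_trans z0).
have Z'p : 0 < (\int[density_prob lebn r0]_u gauss_pdf G (h0 u) y)%R.
  by rewrite Z'r (lt_le_trans z0).
have E1 := law_condition pG mh rd Zp mf f0.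
have E2 := law_condition pG mh0 rd0 Z'p mf f0.
rewrite Zr NE -EFinM in E1; rewrite Z'r N'E -EFinM in E2.
refine (eq_close E1 E2 _); rewrite -!EFinD !lee_fin.
have -> : (z^-1 * E + z^-1 ^+ 2 * A * E) * (eps + del) = z^-1 * t + z^-1 ^+ 2 * A * t.
  by rewrite tE; ring.
split; apply: ratio_le => //.
- by rewrite N'0.
- by rewrite (le_trans NN')// lerD2l.
- by rewrite (le_trans Z'Z)// lerD2l.
- by rewrite N0.
- by rewrite (le_trans N'N)// lerD2l.
- by rewrite (le_trans ZZ')// lerD2l.
Qed.

End conditioning.

Lemma close_trans (R : realType) (X Y Z : \bar R) (a b : R) :
  (X <= Y + a%:E -> Y <= X + a%:E -> Y <= Z + b%:E -> Z <= Y + b%:E ->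
   X <= Z + (a + b)%:E /\ Z <= X + (a + b)%:E)%E.
Proof.
move=> XY YX YZ ZY; rewrite EFinD; split.
  by rewrite (le_trans XY)// [(a%:E + _)%E]addeC addeA leeD2r.
by rewrite (le_trans ZY)// addeA leeD2r.
Qed.

Lemma int_transport (R : realType) n m (P : probability ('cV[R]_n * 'cV[R]_m)%type R)
    (y : 'cV[R]_m) (f : 'cV[R]_n -> R) :
  measurable_fun setT f -> (forall u, 0 <= f u) ->
  (\int[transport y P]_u (f u)%:E = \int[P]_w (f (w.1 + gain P *m (y - w.2)))%:E)%E.
Proof.
move=> mf f0; rewrite /transport ge0_integral_distribution//.
exact/measurable_EFinP.
Qed.

(** * Stability of prediction, observation and transport together *)

Section ensemble_step.
Context (R : realType) (n m : nat) (S : 'M[R]_n) (G : 'M[R]_m).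
Hypotheses (pS : posdefmx S) (pG : posdefmx G).
Local Notation lebn := (lebesgue_cV R n).
Local Notation lebm := (lebesgue_cV R m).
Local Notation T := ('cV[R]_n * 'cV[R]_m)%type.
Local Notation wt2 := (fun v => wt v ^+ 2).
Local Notation jw2 := (fun w => jw w ^+ 2).
Context (kap ky : R) (kap0 : 0 <= kap) (ky0 : 0 <= ky).

Lemma measurable_jw4 : measurable_fun setT (fun w : T => jw w ^+ 4).
Proof. by apply: measurable_funX; exact: measurable_jw. Qed.

Lemma int_jw2_le (P : probability T R) (B : R) :
  (\int[P]_w (jw w ^+ 4)%:E <= B%:E)%E -> (\int[P]_w (jw w ^+ 2)%:E <= B%:E)%E.
Proof.
apply: le_trans; apply: int_le.
- exact: measurable_jw2.
- exact: measurable_jw4.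
- exact: jw2_ge0.
- by move=> w; rewrite ler_weXn2l// jw_ge1.
Qed.

Section transport.
Context (P P0 : probability T R) (e Kb : R) (z : 'cV[R]_m).
Hypotheses (Kb0 : 0 <= Kb) (zk : `|z| <= ky).
Hypothesis cl : mclose jw2 e P P0.
Hypothesis KB : forall v : 'cV[R]_m, `|gain P *m v| <= Kb * `|v|.
Hypothesis K0B : forall v : 'cV[R]_m, `|gain P0 *m v| <= Kb * `|v|.
Let DD := 1 + Kb + Kb * ky.

Let DD0 : 0 < DD.
Proof. by rewrite /DD ltr_wpDr ?mulr_ge0// ltr_wpDr. Qed.

Let mT (f : 'cV[R]_n -> R) (N : 'M[R]_(n, m)) : measurable_fun setT f ->
  measurable_fun setT (fun w : T => f (w.1 + N *m (z - w.2))).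
Proof. by move=> mf; mfun. Qed.

Lemma transport_moment (k : nat) (B : R) : (\int[P0]_w (jw w ^+ k)%:E <= B%:E)%E ->
  (\int[transport z P0]_u (wt u ^+ k)%:E <= (DD ^+ k * B)%:E)%E.
Proof.
move=> iB; rewrite int_transport; [|by mfun|by move=> u; rewrite exprn_ge0 ?wt_ge0].
have Dk0 : 0 <= DD ^+ k by rewrite exprn_ge0// ltW.
have mj : measurable_fun setT (fun w : T => jw w ^+ k).
  by apply: measurable_funX; exact: measurable_jw.
have j0 (w : T) : 0 <= jw w ^+ k by rewrite exprn_ge0// jw_ge0.
apply: (@le_trans _ _ (\int[P0]_w (DD ^+ k * jw w ^+ k)%:E)%E).
  apply: int_le => [||w|w].
  - by apply: (mT (f := fun u => wt u ^+ k)); mfun.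
  - exact (measurable_funM (measurable_cst _) mj).
  - by rewrite exprn_ge0 ?wt_ge0.
  rewrite -exprMn lerXn2r ?nnegrE ?wt_ge0 ?mulr_ge0 ?jw_ge0 ?(ltW DD0)//.
  exact: wt_transport.
by rewrite (int_scale P0 mj Dk0 j0) [leRHS]EFinM lee_wpmul2l ?lee_fin.
Qed.

(** First the law changes while the gain of [P] is kept, then the gain changes under [P0]. The
    disjunction on the pair of gains provides both directions of the second comparison. *)
Lemma transport_mclose (t : R) :
  (forall K K0 : 'M[R]_(n, m), (K, K0) = (gain P, gain P0) \/ (K, K0) = (gain P0, gain P) ->
    forall f : 'cV[R]_n -> R, measurable_fun setT f -> (forall u, 0 <= f u <= wt u ^+ 2) ->
    (\int[P0]_w (f (w.1 + K *m (z - w.2)))%:E <=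
     \int[P0]_w (f (w.1 + K0 *m (z - w.2)))%:E + t%:E)%E) ->
  mclose wt2 (DD ^+ 2 * e + t) (transport z P) (transport z P0).
Proof.
move=> Ht f mf fw.
have f0 u : 0 <= f u by case/andP: (fw u).
have D20 : 0 < DD ^+ 2 by rewrite exprn_gt0.
have fT (w : T) : 0 <= f (w.1 + gain P *m (z - w.2)) <= DD ^+ 2 * jw w ^+ 2.
  rewrite f0/=; have /andP[_ fu] := fw (w.1 + gain P *m (z - w.2)).
  rewrite (le_trans fu)// -exprMn lerXn2r ?nnegrE ?wt_ge0 ?mulr_ge0 ?jw_ge0 ?(ltW DD0)//.
  exact: wt_transport.
have E1 := int_transport P z mf f0; have E2 := int_transport P0 z mf f0.
refine (eq_close E1 E2 _).
have H1 := mclose_scale cl D20 (mT (gain P) mf) fT.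
have H2 := mclose_scale (mclose_sym cl) D20 (mT (gain P) mf) fT.
have H3 := Ht (gain P) (gain P0) (or_introl erefl) f mf fw.
have H4 := Ht (gain P0) (gain P) (or_intror erefl) f mf fw.
exact (close_trans H1 H2 H3 H4).
Qed.

End transport.

(** The fourth moment of the transported reference law is what the next step starts from; the last
    two conclusions are the premises of [gain_gauss]. *)
Lemma ensemble_close (B Del : R) : 0 <= B -> 0 <= Del -> exists2 C : R, 0 <= C &
  forall (mu nu : probability 'cV[R]_n R) (Psi Psi0 : 'cV[R]_n -> 'cV[R]_n)
    (h h0 : 'cV[R]_n -> 'cV[R]_m) (del eps : R) (z : 'cV[R]_m),
  0 <= del <= Del -> eps <= 1 ->
  measurable_fun setT Psi -> measurable_fun setT Psi0 ->
  measurable_fun setT h -> measurable_fun setT h0 ->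
  (forall v, `|Psi v - Psi0 v| <= eps) -> (forall v, `|h v - h0 v| <= eps) ->
  (forall v, `|Psi0 v| <= kap * wt v) -> (forall v, `|h0 v| <= kap * wt v) ->
  (forall u u', `|h0 u - h0 u'| <= kap * `|u - u'|) -> `|z| <= ky ->
  mclose wt2 del mu nu -> (\int[nu]_v (wt v ^+ 4)%:E <= B%:E)%E ->
  [/\ mclose wt2 (C * (eps + del))
       (transport z (density_prob (lebn \x lebm)%E (joint_pdf G h (mixture_pdf S mu Psi))))
       (transport z (density_prob (lebn \x lebm)%E (joint_pdf G h0 (mixture_pdf S nu Psi0)))),
     (\int[transport z (density_prob (lebn \x lebm)%E
        (joint_pdf G h0 (mixture_pdf S nu Psi0)))]_u (wt u ^+ 4)%:E <= C%:E)%E,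
     (\int[density_prob (lebn \x lebm)
        (joint_pdf G h0 (mixture_pdf S nu Psi0))]_w (jw w ^+ 2)%:E <= C%:E)%E &
     cov_yy (density_prob (lebn \x lebm)%E
        (joint_pdf G h0 (mixture_pdf S nu Psi0))) \in unitmx].
Proof.
move=> B0 Del0.
have [Cp Cp0 CpP] := predict_close pS kap0.
have [Cm Cm0 CmP] := predict_moment pS kap0.
have [Cj Cj0 CjP] := joint_close n pG kap0.
have [Cq Cq0 CqP] := joint_moment pS pG kap0.
have [c c0 cP] := coercive_joint n pG.
(* Loss of prediction and observation: the joint laws are [L * (eps + del)] close. *)
have [L LE] := opaque_copy (Cj * (Cm * B + Cp * (B + 1))).
have L0 : 0 <= L by rewrite LE mulr_ge0 ?addr_ge0 ?mulr_ge0 ?addr_ge0.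
(* As [gain_close] requires, [BB] dominates both that distance, since [eps <= 1] and [del <= Del],
   and the second moment of the reference joint law. *)
have [BB BE] := opaque_copy (L * (1 + Del) + Cq * B).
have BB0 : 0 <= BB by rewrite BE addr_ge0 ?mulr_ge0 ?addr_ge0.
have [Kg Kg0 KgP] := gain_close n m BB0 c0.
(* Both gains are bounded by [Kg], and their difference by [Kg * e <= Kg * BB]. *)
have [Kb KbE] := opaque_copy (Kg + Kg * BB).
have Kb0 : 0 <= Kb by rewrite KbE addr_ge0 ?mulr_ge0.
have [D D0 DP] := transport_close pS pG kap0 Kb0 ky0.
have [DD DDE] := opaque_copy (1 + Kb + Kb * ky).
have DD0 : 0 <= DD by rewrite DDE !addr_ge0// mulr_ge0.
have [Q QE] := opaque_copy (DD ^+ 2 * L + D * (Kg * L) * B).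
have Q0 : 0 <= Q by rewrite QE addr_ge0 ?mulr_ge0 ?sqr_ge0.
exists (Q + (DD ^+ 4 * (Cq * B) + Cq * B)).
  by rewrite !addr_ge0 ?mulr_ge0 ?exprn_ge0.
move=> mu nu Psi Psi0 h h0 del eps z /andP[del0 delD] e1 mP mP0 mh mh0 PP hh Pg hg hl zk cl nuB.
have e0 : 0 <= eps := le_trans (normr_ge0 _) (hh 0).
have nuB2 := int_wt2_le nuB.
have cl1 := CpP mu nu Psi Psi0 del eps B del0 e1 B0 mP mP0 PP Pg cl nuB2.
have m1 := CmP nu Psi0 B mP0 Pg nuB2.
have rd := mixture_density pS mu mP.
have rd0 := mixture_density pS nu mP0.
have d10 : 0 <= Cp * (eps * B + del) by rewrite mulr_ge0 ?addr_ge0 ?mulr_ge0.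
have CmB0 : 0 <= Cm * B by rewrite mulr_ge0.
have cl2 := CjP _ _ h h0 _ eps (Cm * B) rd rd0 d10 e1 CmB0 mh mh0 hh hg cl1 m1.
have [e eE] := opaque_copy (L * (eps + del)).
have ed0 : 0 <= eps + del by rewrite addr_ge0.
have ee0 : 0 <= e by rewrite eE mulr_ge0.
have ele : Cj * (eps * (Cm * B) + Cp * (eps * B + del)) <= e.
  rewrite eE LE -mulrA ler_wpM2l//.
  have : 0 <= Cm * B * del by rewrite !mulr_ge0.
  have : 0 <= Cp * (B * del) by rewrite !mulr_ge0.
  have : 0 <= Cp * eps by rewrite !mulr_ge0.
  lra.
have {}cl2 := mclose_le ele cl2.
have m4 := CqP n nu Psi0 h0 B mP0 mh0 Pg hg nuB.
(* The two joint laws become variables, and the hypotheses list all that is used of them. The second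
   law is still tied to [Psi0] and [h0] through the last hypothesis, which compares two gains under
   it. *)
suff key (P P0 : probability T R) : mclose jw2 e P P0 ->
    (\int[P0]_w (jw w ^+ 4)%:E <= (Cq * B)%:E)%E ->
    ((\int[P]_w (jw w ^+ 2)%:E <= (BB + e)%:E)%E ->
      forall x, c * `|x| ^+ 2 <= quadf (cov_yy P) x) ->
    ((\int[P0]_w (jw w ^+ 2)%:E <= BB%:E)%E ->
      forall x, c * `|x| ^+ 2 <= quadf (cov_yy P0) x) ->
    (forall (f : 'cV[R]_n -> R) (K K0 : 'M[R]_(n, m)) r,
      (forall v : 'cV[R]_m, `|K *m v| <= Kb * `|v|) ->
      (forall v : 'cV[R]_m, `|K0 *m v| <= Kb * `|v|) ->
      (forall v : 'cV[R]_m, `|(K - K0) *m v| <= r * `|v|) -> 0 <= r <= Kb ->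
      measurable_fun setT f -> (forall u, 0 <= f u <= wt u ^+ 2) ->
      (\int[P0]_w (f (w.1 + K *m (z - w.2)))%:E <=
       \int[P0]_w (f (w.1 + K0 *m (z - w.2)))%:E + (D * r * B)%:E)%E) ->
    [/\ mclose wt2 ((Q + (DD ^+ 4 * (Cq * B) + Cq * B)) * (eps + del))
          (transport z P) (transport z P0),
        (\int[transport z P0]_u (wt u ^+ 4)%:E <=
          (Q + (DD ^+ 4 * (Cq * B) + Cq * B))%:E)%E,
        (\int[P0]_w (jw w ^+ 2)%:E <= (Q + (DD ^+ 4 * (Cq * B) + Cq * B))%:E)%E &
        cov_yy P0 \in unitmx].
  exact (key _ _ cl2 m4 (cP _ h (BB + e) rd mh) (cP _ h0 BB rd0 mh0)
    (fun f K K0 r H1 H2 H3 H4 => DP n nu Psi0 h0 B r K K0 z f mP0 mh0 Pg hg hl nuB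
      H1 H2 H3 H4 zk)).
move=> {}cl2 {}m4 cPP cPP0 DP'.
have m2 := int_jw2_le m4.
have eB : 0 <= e <= BB.
  rewrite ee0 eE BE ler_wpDr ?mulr_ge0// ler_wpM2l//.
  by rewrite lerD.
have m2' : (\int[P0]_w (jw w ^+ 2)%:E <= BB%:E)%E.
  by rewrite (le_trans m2)// lee_fin BE lerDr mulr_ge0// addr_ge0.
have c2 := cPP0 m2'.
have c1 := cPP (mclose_bound (@measurable_jw2 R n m) (@jw2_ge0 R n m) cl2 m2').
have [g1 [g2 g3]] := KgP P P0 e eB cl2 m2' c1 c2.
have KK : Kg <= Kb by rewrite KbE lerDl mulr_ge0.
have g1' (v : 'cV[R]_m) : `|gain P *m v| <= Kb * `|v|.
  by rewrite (le_trans (g1 v))// ler_wpM2r.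
have g2' (v : 'cV[R]_m) : `|gain P0 *m v| <= Kb * `|v|.
  by rewrite (le_trans (g2 v))// ler_wpM2r.
have g3' (v : 'cV[R]_m) : `|(gain P0 - gain P) *m v| <= Kg * e * `|v|.
  by rewrite -opprB mulNmx normrN.
have rK : 0 <= Kg * e <= Kb.
  rewrite mulr_ge0//= KbE ler_wpDl// ler_wpM2l//.
  by case/andP: eB.
split.
- have Ht (K K0 : 'M[R]_(n, m)) : (K, K0) = (gain P, gain P0) \/ (K, K0) = (gain P0, gain P) ->
      forall f : 'cV[R]_n -> R, measurable_fun setT f -> (forall u, 0 <= f u <= wt u ^+ 2) ->
      (\int[P0]_w (f (w.1 + K *m (z - w.2)))%:E <=
       \int[P0]_w (f (w.1 + K0 *m (z - w.2)))%:E + (D * (Kg * e) * B)%:E)%E.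
    case=> -[-> ->] f mf fw.
      exact (DP' f (gain P) (gain P0) (Kg * e) g1' g2' g3 rK mf fw).
    exact (DP' f (gain P0) (gain P) (Kg * e) g2' g1' g3' rK mf fw).
  have := transport_mclose Kb0 zk cl2 g1' Ht; rewrite -DDE.
  apply: mclose_le; rewrite eE.
  have -> : DD ^+ 2 * (L * (eps + del)) + D * (Kg * (L * (eps + del))) * B = Q * (eps + del).
    by rewrite QE; ring.
  by rewrite ler_wpM2r// lerDl addr_ge0 ?mulr_ge0 ?exprn_ge0.
- have := transport_moment Kb0 zk g2' m4; rewrite -DDE => /le_trans; apply.
  by rewrite lee_fin addrCA lerDl addr_ge0 ?mulr_ge0.
- rewrite (le_trans m2)// lee_fin addrA lerDr addr_ge0// mulr_ge0 ?exprn_ge0// mulr_ge0//.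
- by have [] := coercive_inv c0 c2.
Qed.

End ensemble_step.

(** * Induction along the filters *)

Lemma mclose_eqr (R : realType) d (T : measurableType d) (W : T -> R) (e : R)
    (mu nu nu' : {measure set T -> \bar R}) :
  (forall f : T -> R, measurable_fun setT f -> (forall x, 0 <= f x) ->
    (\int[nu]_x (f x)%:E = \int[nu']_x (f x)%:E)%E) ->
  mclose W e mu nu -> mclose W e mu nu'.
Proof.
move=> E cl f mf fW; have f0 x : 0 <= f x by case/andP: (fW x).
exact (eq_close erefl (esym (E f mf f0)) (cl f mf fW)).
Qed.

Lemma int_image (R : realType) d d' (T : measurableType d) (T' : measurableType d')
    (P : probability T R) (mu : probability T' R) (phi : T -> T') (f : T' -> R) :
  measurable_fun setT phi ->
  (forall A, measurable A -> mu A = pushforward P phi A) ->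
  measurable_fun setT f -> (forall x, 0 <= f x) ->
  (\int[mu]_x (f x)%:E = \int[P]_x (f (phi x))%:E)%E.
Proof.
move=> mphi muE mf f0.
pose X : {mfun T >-> T'} := HB.pack phi (isMeasurableFun.Build _ _ _ _ _ mphi).
rewrite -[RHS](ge0_integral_distribution (P := P) X (f := EFin \o f)).
- by apply: eq_measure_integral => A mA _; exact: (muE A mA).
- exact/measurable_EFinP.
- by move=> y; rewrite lee_fin.
Qed.

Section gaussian.
Context (R : realType) (n m : nat) (S : 'M[R]_n) (G : 'M[R]_m).
Hypotheses (pS : posdefmx S) (pG : posdefmx G).
Local Notation lebn := (lebesgue_cV R n).
Local Notation lebm := (lebesgue_cV R m).
Local Notation T := ('cV[R]_n * 'cV[R]_m)%type.

(** The invariant concerns the predictive law instead of [nu] itself: [mu_0] may be degenerate and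
    have no density, but adding the noise [S] always gives a nondegenerate Gaussian. *)
Definition gaussian_mixture (a : 'cV[R]_n -> 'cV[R]_n) (nu : probability 'cV[R]_n R) :=
  exists C c, posdefmx C /\ mixture_pdf S nu a = gauss_pdf C c.

Lemma gauss_mixture (A C : 'M[R]_n) (a c : 'cV[R]_n) (nu : probability 'cV[R]_n R) :
  posdefmx C ->
  (forall f : 'cV[R]_n -> R, measurable_fun setT f -> (forall x, 0 <= f x) ->
    (\int[nu]_x (f x)%:E = \int[lebn]_x (f x * gauss_pdf C c x)%:E)%E) ->
  gaussian_mixture (fun v => A *m v + a) nu.
Proof.
move=> pC nuE; exists (innov_cov S C A), (A *m c + a).
split; first exact: posdef_innov.
apply/funext => u; apply: EFin_inj; rewrite (mixture_pdfE pS).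
- rewrite nuE; [exact: gauss_conv|by mfun|by move=> v; rewrite gauss_ge0].
- exact: measurable_affine.
Qed.

Section base.
Context (mu0 : probability 'cV[R]_n R) (L : 'M[R]_n) (l : 'cV[R]_n).
Hypothesis mu0E : forall A, measurable A ->
  mu0 A = pushforward (std_gaussian R n) (fun x => L *m x + l) A.

Lemma int_std_image (f : 'cV[R]_n -> R) : measurable_fun setT f -> (forall x, 0 <= f x) ->
  (\int[mu0]_x (f x)%:E = \int[lebn]_x (f (L *m x + l) * gauss_pdf 1%:M 0 x)%:E)%E.
Proof.
move=> mf f0; have mL := measurable_affine L l.
rewrite (int_image mL mu0E mf f0).
have mfL : measurable_fun setT (fun x => f (L *m x + l)) by mfun.
exact (integral_density_prob (gauss_density 0 (posdef1 R n)) mfL (fun x => f0 _)).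
Qed.

(** The initial law is an affine image of the standard Gaussian, so its affine map is composed with
    that of the dynamics and [gauss_conv] applies with identity covariance. *)
Lemma gaussian_base (A : 'M[R]_n) (a : 'cV[R]_n) :
  gaussian_mixture (fun v => A *m v + a) mu0.
Proof.
exists (innov_cov S 1%:M (A *m L)), (A *m L *m 0 + (A *m l + a)).
split; first exact: posdef_innov (posdef1 R n).
apply/funext => u; apply: EFin_inj; rewrite (mixture_pdfE pS); last exact: measurable_affine.
rewrite int_std_image; [|by mfun|by move=> v; rewrite gauss_ge0].
rewrite -(gauss_conv (A *m L) (A *m l + a) 0 pS (posdef1 R n) u).
apply: eq_integral => x _.
have E : A *m (L *m x + l) + a = A *m L *m x + (A *m l + a).
  by rewrite mulmxDr mulmxA addrA.
by rewrite E.
Qed.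

Lemma enormX_le k (x : 'cV[R]_n) : enorm x ^+ k <= (n%:R * wt x) ^+ k.
Proof.
rewrite lerXn2r ?nnegrE ?enorm_ge0 ?mulr_ge0 ?wt_ge0//.
by rewrite (le_trans (enorm_le x))// ler_wpM2l// /wt lerDr.
Qed.

Lemma measurable_enorm2 : measurable_fun setT (fun x : 'cV[R]_n => enorm x ^+ 2).
Proof.
rewrite (_ : (fun x => _) = quadf 1%:M); first by mfun.
by apply/funext => x; rewrite sqr_enorm.
Qed.

Lemma measurable_enorm_even k :
  measurable_fun setT (fun x : 'cV[R]_n => enorm x ^+ (2 * k)).
Proof.
under eq_fun do rewrite exprM.
by apply: measurable_funX; exact: measurable_enorm2.
Qed.

(** [16 = 2 ^ 4]: the weight is at most 2 where the norm is at most 1, and at most twice the norm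
    elsewhere. *)
Lemma wt4_le_enorm k (x : 'cV[R]_n) : (2 <= k)%N -> wt x ^+ 4 <= 16 * (1 + enorm x ^+ (2 * k)).
Proof.
move=> k2; have xe := ler_norm_enorm x.
have k4 : (4 <= 2 * k)%N by rewrite -[4%N]/(2 * 2)%N leq_mul2l.
have [e1|e1] := leP (enorm x) 1.
  apply: (@le_trans _ _ (2 ^+ 4)).
    by rewrite lerXn2r ?nnegrE ?wt_ge0// /wt [leRHS](_ : 2 = 1 + 1)// lerD2l (le_trans xe).
  rewrite (_ : 2 ^+ 4 = 16 * 1 :> R); last by rewrite mulr1 -natrX.
  by rewrite ler_wpM2l// lerDl exprn_ge0// enorm_ge0.
apply: (@le_trans _ _ ((2 * enorm x) ^+ 4)).
  rewrite lerXn2r ?nnegrE ?wt_ge0 ?mulr_ge0 ?enorm_ge0//.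
  rewrite /wt mulr_natl mulr2n; apply: lerD => //; exact: ltW.
rewrite exprMn (_ : 2 ^+ 4 = 16 :> R); last by rewrite -natrX.
rewrite ler_wpM2l// ler_wpDl// ler_weXn2l// ltW//.
Qed.

Lemma base_moment k : (2 <= k)%N ->
  (\int[mu0]_x (wt x ^+ 4)%:E <= (16 * (1 + fine (moment (2 * k) mu0)))%:E)%E.
Proof.
move=> k2; have me := measurable_enorm_even k.
have e0 (x : 'cV[R]_n) : 0 <= enorm x ^+ (2 * k) by rewrite exprn_ge0// enorm_ge0.
(* Finiteness has to be established, as [fine] would send an infinite moment to 0. It holds because
   [mu0] is Gaussian. *)
have fin : (moment (2 * k) mu0 \is a fin_num).
  have [C C0 CP] := gauss_moment (posdef1 R n) (2 * k).
  have [K KE] := opaque_copy ((n%:R * (1 + n%:R * `|L| + `|l|)) ^+ (2 * k)).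
  have K0 : 0 <= K.
    by rewrite KE exprn_ge0// mulr_ge0// addr_ge0// addr_ge0// mulr_ge0.
  apply: (int_fin_num (c := K * C)) => //.
  rewrite (int_std_image me e0).
  have m1 : measurable_fun setT (fun x : 'cV[R]_n =>
      wt (x - 0) ^+ (2 * k) * gauss_pdf 1%:M 0 x) by mfun.
  have p1 (x : 'cV[R]_n) : 0 <= wt (x - 0) ^+ (2 * k) * gauss_pdf 1%:M 0 x.
    by rewrite mulr_ge0 ?exprn_ge0 ?wt_ge0 ?gauss_ge0//; exact: posdef1.
  apply: (@le_trans _ _ (\int[lebn]_x (K * (wt (x - 0) ^+ (2 * k) * gauss_pdf 1%:M 0 x))%:E)%E).
    apply: int_le.
    - have m2 : measurable_fun setT (fun x : 'cV[R]_n => enorm (L *m x + l) ^+ (2 * k)).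
        exact: (measurableT_comp me (measurable_affine L l)).
      by refine (measurable_funM m2 _); mfun.
    - by mfun.
    - by move=> x; rewrite mulr_ge0 ?e0 ?gauss_ge0//; exact: posdef1.
    - move=> x; rewrite [leRHS]mulrA; apply: ler_wpM2r; first by apply: gauss_ge0; exact: posdef1.
      rewrite (le_trans (enormX_le _ _))// KE -exprMn.
      rewrite lerXn2r ?nnegrE ?mulr_ge0 ?wt_ge0 ?addr_ge0 ?mulr_ge0//.
      rewrite -mulrA ler_wpM2l// subr0.
      have : `|L *m x + l| <= n%:R * `|L| * `|x| + `|l|.
        by rewrite (le_trans (ler_normD _ _))// lerD2r ler_norm_mulmx.
      rewrite /wt; have := normr_ge0 x; have := normr_ge0 l.
      have : 0 <= n%:R * `|L| by rewrite mulr_ge0.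
      move: (n%:R * `|L|) (`|L *m x + l|) (`|x|) (`|l|) => p s t q p0 q0 t0 h.
      have : 0 <= q * t by rewrite mulr_ge0.
      lra.
  rewrite (int_scale lebn m1 K0 p1) EFinM lee_wpmul2l ?lee_fin//.
have le16 : (0 : R) <= 16 by [].
have mc : measurable_fun setT (fun x : 'cV[R]_n => 1 : R) by mfun.
have mD : measurable_fun setT (fun x : 'cV[R]_n => 1 + enorm x ^+ (2 * k)).
  exact (measurable_funD mc me).
have D0 (x : 'cV[R]_n) : 0 <= 1 + enorm x ^+ (2 * k) by rewrite addr_ge0.
apply: (@le_trans _ _ (\int[mu0]_x (16 * (1 + enorm x ^+ (2 * k)))%:E)%E).
  apply: int_le; [by mfun|exact (measurable_funM (measurable_cst _) mD)| |].
    by move=> x; rewrite exprn_ge0// wt_ge0.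
  by move=> x; exact: wt4_le_enorm.
rewrite (int_scale mu0 mD le16 D0) (int_add mu0 mc me (fun=> ler01) e0).
have E1 := int_prob_cst mu0 (1 : R).
by rewrite [leRHS]EFinM [(1 + fine _)%:E]EFinD (fineK fin) E1.
Qed.

End base.

Section step.
Context (kap ky : R) (kap0 : 0 <= kap) (ky0 : 0 <= ky).
Local Notation wt2 := (fun v => wt v ^+ 2).

(** Both filters are compared with one law, the conditioned affine model. The ensemble filter is
    close to the transported affine model, and [gain_gauss] with [transport_gauss] identifies this
    with the conditioned one. *)
Lemma filter_step (B Del : R) : 0 <= B -> 0 <= Del -> exists2 C : R, 0 <= C &
  forall (mu muE nu : probability 'cV[R]_n R) (Psi : 'cV[R]_n -> 'cV[R]_n)
    (h : 'cV[R]_n -> 'cV[R]_m) (A : 'M[R]_n) (a : 'cV[R]_n) (H : 'M[R]_(m, n))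
    (b : 'cV[R]_m) (del eps : R) (z : 'cV[R]_m),
  0 <= del <= Del -> eps <= 1 -> measurable_fun setT Psi -> measurable_fun setT h ->
  (forall v, `|Psi v - (A *m v + a)| <= eps) -> (forall v, `|h v - (H *m v + b)| <= eps) ->
  (forall v, `|A *m v + a| <= kap * wt v) -> (forall v, `|H *m v + b| <= kap * wt v) ->
  (forall u u', `|(H *m u + b) - (H *m u' + b)| <= kap * `|u - u'|) -> `|z| <= ky ->
  mclose wt2 del mu nu -> mclose wt2 del muE nu ->
  (\int[nu]_v (wt v ^+ 4)%:E <= B%:E)%E -> gaussian_mixture (fun v => A *m v + a) nu ->
  exists nu' : probability 'cV[R]_n R,
  [/\ mclose wt2 (C * (eps + del))
        (density_prob lebn (condition_pdf z (joint_pdf G h (mixture_pdf S mu Psi)))) nu',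
      mclose wt2 (C * (eps + del))
        (transport z (density_prob (lebn \x lebm)%E (joint_pdf G h (mixture_pdf S muE Psi)))) nu',
      (\int[nu']_v (wt v ^+ 4)%:E <= C%:E)%E & gaussian_mixture (fun v => A *m v + a) nu'].
Proof.
move=> B0 Del0.
have [Cp Cp0 CpP] := predict_close pS kap0.
have [Cm Cm0 CmP] := predict_moment pS kap0.
have [Ce Ce0 CeP] := ensemble_close pS pG kap0 ky0 B0 Del0.
have [B1 B1E] := opaque_copy (Cm * B).
have B10 : 0 <= B1 by rewrite B1E mulr_ge0.
have [D1 D1E] := opaque_copy (Cp * (B + Del)).
have D10 : 0 <= D1 by rewrite D1E mulr_ge0 ?addr_ge0.
have [Cc Cc0 CcP] := condition_close n pG (kap + 1) ky0 B10 D10.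
have [Q QE] := opaque_copy (Cc * (1 + Cp * (B + 1))).
have Q0 : 0 <= Q by rewrite QE mulr_ge0 ?addr_ge0 ?mulr_ge0 ?addr_ge0.
exists (Ce + Q); first by rewrite addr_ge0.
move=> mu muE nu Psi h A a H b del eps z delD e1 mP mh PP hh Pg hg hl zk cl clE nuB gm.
have /andP[del0 dD] := delD.
have e0 : 0 <= eps := le_trans (normr_ge0 _) (hh 0).
have mP0 := measurable_affine A a; have mh0 := measurable_affine H b.
have [EK1 EK2 EK3 EK4] := CeP muE nu Psi _ h _ del eps z delD e1 mP mP0 mh mh0 PP hh Pg hg hl
  zk clE nuB.
have nuB2 := int_wt2_le nuB.
have cl1 := CpP mu nu Psi _ del eps B del0 e1 B0 mP mP0 PP Pg cl nuB2.
have := CmP nu _ B mP0 Pg nuB2; rewrite -B1E => m1.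
have rd := mixture_density pS mu mP.
have rd0 := mixture_density pS nu mP0.
have d1 : 0 <= Cp * (eps * B + del) <= D1.
  rewrite mulr_ge0 ?addr_ge0 ?mulr_ge0//= D1E ler_wpM2l// lerD//.
  by rewrite ler_piMl.
(* The perturbed map [h] grows like the affine one up to [eps <= 1], hence the growth constant
   [kap + 1] for conditioning. *)
have kw (v : 'cV[R]_n) : kap * wt v <= (kap + 1) * wt v by rewrite ler_wpM2r ?wt_ge0// lerDl.
have hg1 v : `|H *m v + b| <= (kap + 1) * wt v by rewrite (le_trans (hg v)).
have hg2 v : `|h v| <= (kap + 1) * wt v.
  rewrite -[h v](subrK (H *m v + b)) (le_trans (ler_normD _ _))// addrC mulrDl mul1r.
  by rewrite lerD// (le_trans (hh v))// (le_trans e1)// wt_ge1.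
have cl2 := CcP _ _ h _ _ eps z rd rd0 d1 e1 mh mh0 hh hg2 hg1 zk cl1 m1.
(* From here on the reference joint law is an affine observation of a Gaussian prior with mean [c]
   and covariance [C]. *)
have [C [c [pC gE]]] := gm.
rewrite gE in EK1 EK2 EK3 EK4 cl2.
have pC' := posdef_post H pG pC.
exists (density_prob lebn (condition_pdf z (joint_pdf G (fun v => H *m v + b) (gauss_pdf C c)))).
have nuE (f : 'cV[R]_n -> R) : measurable_fun setT f -> (forall x, 0 <= f x) ->
   (\int[density_prob lebn (condition_pdf z (joint_pdf G (fun v => H *m v + b)%R
      (gauss_pdf C c)))]_x (f x)%:E =
    \int[lebn]_x (f x * gauss_pdf (post_cov G C H) (post_mean G C H b c z) x)%:E)%E.
  move=> mf f0; rewrite (funext (condition_gauss H b c pG pC z)).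
  exact (integral_density_prob (gauss_density _ pC') mf f0).
have trE (f : 'cV[R]_n -> R) : measurable_fun setT f -> (forall x, 0 <= f x) ->
   (\int[transport z (density_prob (lebn \x lebm)%E (joint_pdf G (fun v => H *m v + b)%R
      (gauss_pdf C c)))]_x (f x)%:E =
    \int[density_prob lebn (condition_pdf z (joint_pdf G (fun v => H *m v + b)%R
      (gauss_pdf C c)))]_x (f x)%:E)%E.
  move=> mf f0; rewrite nuE// int_transport// (gain_gauss pG pC EK3 EK4).
  exact (transport_gauss H b c pG pC z mf f0).
split.
- refine (mclose_le _ cl2).
  apply: (@le_trans _ _ (Q * (eps + del))); last by rewrite ler_wpM2r ?addr_ge0// lerDr.
  rewrite QE -mulrA ler_wpM2l//.
  have : 0 <= Cp * (B * del) by rewrite !mulr_ge0.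
  have : 0 <= Cp * eps by rewrite !mulr_ge0.
  lra.
- refine (mclose_eqr trE (mclose_le _ EK1)).
  by rewrite ler_wpM2r ?addr_ge0// lerDl.
- have mw : measurable_fun setT (fun v : 'cV[R]_n => wt v ^+ 4) by mfun.
  have w0 (v : 'cV[R]_n) : 0 <= wt v ^+ 4 by rewrite exprn_ge0// wt_ge0.
  rewrite -(trE _ mw w0) (le_trans EK2)// lee_fin lerDl//.
- exact (gauss_mixture A a pC' nuE).
Qed.

End step.
End gaussian.

(** * Iteration over the time steps and proof of the theorem *)

Lemma linf_ballP (R : realType) n m p (c f : ('cV[R]_m -> 'cV[R]_n) * ('cV[R]_m -> 'cV[R]_p))
    (r : R) : f \in linf_ball c r ->
  (forall u, `|f.1 u - c.1 u| <= r) /\ (forall u, `|f.2 u - c.2 u| <= r).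
Proof.
rewrite inE => -[/= f1 f2]; split => u; rewrite (le_trans (ler_norm_enorm _))// -lee_fin.
  by refine (le_trans _ f1); apply: ereal_sup_ubound; exists u.
by refine (le_trans _ f2); apply: ereal_sup_ubound; exists u.
Qed.

Section affine.
Context (R : realType) (m n : nat) (A : 'M[R]_(n, m)) (a : 'cV[R]_n) (k : R).
Hypothesis k0 : 0 <= k.
Hypothesis Ak : forall u, enorm (A *m u + a) <= k * (1 + enorm u).

Lemma affine_growth (u : 'cV[R]_m) : `|A *m u + a| <= k * (1 + m%:R) * wt u.
Proof.
rewrite (le_trans (ler_norm_enorm _))// (le_trans (Ak u))// -mulrA ler_wpM2l//.
rewrite mulrDl mul1r (le_trans (lerD (lexx 1) (enorm_le u)))// lerD ?wt_ge1//.
by rewrite ler_wpM2l// /wt lerDr.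
Qed.

(* The growth bound at [t u] for [t] tending to infinity bounds the linear part. *)
Lemma affine_lipschitz (u v : 'cV[R]_m) :
  `|(A *m u + a) - (A *m v + a)| <= k * (1 + m%:R) * `|u - v|.
Proof.
rewrite opprD addrACA subrr addr0 -mulmxBr; move: (u - v) => w.
rewrite leNgt; apply/negP => lt.
set x := `|A *m w| in lt; set y := _ * `|w| in lt.
have d0 : 0 < x - y by rewrite subr_gt0.
pose t := (k * (1 + m%:R) + `|a| + 1) / (x - y).
have t0 : 0 <= t.
  by rewrite divr_ge0 ?(ltW d0)// !addr_ge0// mulr_ge0 ?addr_ge0.
have := affine_growth (t *: w); rewrite /wt normrZ (ger0_norm t0) -scalemxAr => h.
have h2 : t * x <= `|t *: (A *m w) + a| + `|a|.
  by rewrite -[t in t * x]ger0_norm// -normrZ -{1}[t *: _](addrK a) ler_normB.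
have h3 : t * (x - y) = k * (1 + m%:R) + `|a| + 1 by rewrite /t divfK// gt_eqF.
move: h h2 h3; rewrite /y; lra.
Qed.

End affine.

Section main.
Context (R : realType) (n m : nat) (S : 'M[R]_n) (G : 'M[R]_m).
Hypotheses (pS : posdefmx S) (pG : posdefmx G).
Context (k : nat) (k2 : (2 <= k)%N).
Local Notation wt2 := (fun v => wt v ^+ 2).
Context (ky kP kh : R) (M : \bar R).
Hypotheses (ky0 : 0 <= ky) (kP0 : 0 <= kP) (kh0 : 0 <= kh).

(** The value [M] of the moment is fixed before the constant, so that [C] depends on the initial law
    only through it. *)
Lemma filter_bound (J : nat) : exists2 C : R, 0 <= C &
  forall (ydag : nat -> 'cV[R]_m) (A : 'M[R]_n) (a : 'cV[R]_n) (H : 'M[R]_(m, n))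
    (b : 'cV[R]_m) (mu0 : probability 'cV[R]_n R) (eps : R)
    (Psi : 'cV[R]_n -> 'cV[R]_n) (h : 'cV[R]_n -> 'cV[R]_m),
  moment (2 * k) mu0 = M -> (forall j, (1 <= j <= J)%N -> enorm (ydag j) <= ky) ->
  (forall u, enorm (A *m u + a) <= kP * (1 + enorm u)) ->
  (forall u, enorm (H *m u + b) <= kh * (1 + enorm u)) ->
  is_gaussian mu0 -> 0 <= eps <= 1 -> measurable_fun setT Psi -> measurable_fun setT h ->
  (forall v, `|Psi v - (A *m v + a)| <= eps) -> (forall v, `|h v - (H *m v + b)| <= eps) ->
  exists nu : probability 'cV[R]_n R,
  [/\ mclose wt2 (C * eps) (filter_law S G Psi h ydag mu0 J) nu,
      mclose wt2 (C * eps) (filter_law_EK S G Psi h ydag mu0 J) nu,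
      (\int[nu]_v (wt v ^+ 4)%:E <= C%:E)%E & gaussian_mixture S (fun v => A *m v + a) nu].
Proof.
elim: J => [|J [C C0 IH]].
  (* [M] is an arbitrary extended real here; the maximum keeps the constant nonnegative for every
     value of it. *)
  exists (Num.max 0 (16 * (1 + fine M))); first by rewrite le_max lexx.
  move=> ydag A a H b mu0 eps Psi h ME _ _ _ [L [l mu0E]] /andP[e0 _] _ _ _ _.
  have Ce0 : 0 <= Num.max 0 (16 * (1 + fine M)) * eps.
    by rewrite mulr_ge0// le_max lexx.
  exists mu0; split; [exact: mclose_refl|exact: mclose_refl| |].
    rewrite (le_trans (base_moment mu0E k2))// ME lee_fin le_max lexx orbT//.
  exact: gaussian_base mu0E A a.
have kap0 : 0 <= (kP + kh) * (1 + n%:R) by rewrite mulr_ge0 ?addr_ge0.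
(* The constant of the previous step plays both parts: it bounds the fourth moment and, as
   [eps <= 1], the distance [C * eps]. *)
have [D D0 DP] := filter_step pS pG kap0 ky0 C0 C0.
exists (D * (1 + C)); first by rewrite mulr_ge0 ?addr_ge0.
move=> ydag A a H b mu0 eps Psi h ME yk PA hH gm e01 mP mh PP hh.
have /andP[e0 e1] := e01.
have [|nu [cl clE nuB gnu]] := IH ydag A a H b mu0 eps Psi h ME _ PA hH gm e01 mP mh PP hh.
  by move=> j /andP[j1 jJ]; apply: yk; rewrite j1 ltnW.
have le1 l (v : 'cV[R]_l) : kP * (1 + n%:R) * wt v <= (kP + kh) * (1 + n%:R) * wt v.
  by rewrite ler_wpM2r ?wt_ge0// ler_wpM2r ?addr_ge0// lerDl.
have le2 (x : R) : 0 <= x -> kh * (1 + n%:R) * x <= (kP + kh) * (1 + n%:R) * x.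
  by move=> x0; rewrite ler_wpM2r// ler_wpM2r ?addr_ge0// lerDr.
have del : 0 <= C * eps <= C by rewrite mulr_ge0//= ler_piMr.
have yJ : `|ydag J.+1| <= ky.
  by rewrite (le_trans (ler_norm_enorm _))// yk// leqnn.
have [nu' [c1 c2 c3 c4]] := DP _ _ nu Psi h A a H b (C * eps) eps (ydag J.+1) del e1 mP mh PP hh
  (fun v => le_trans (affine_growth kP0 PA v) (le1 n v))
  (fun v => le_trans (affine_growth kh0 hH v) (le2 _ (wt_ge0 v)))
  (fun u u' => le_trans (affine_lipschitz kh0 hH u u') (le2 _ (normr_ge0 _)))
  yJ cl clE nuB gnu.
have E : D * (eps + C * eps) = D * (1 + C) * eps by ring.
rewrite E in c1 c2.
exists nu'; split => //.
by rewrite (le_trans c3)// lee_fin ler_peMr// lerDl.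
Qed.

(** [4 = 2 * 2]: one factor 2 for the two signs in [signed_close], one for passing through [nu]. The
    factor [1 + n ^ 2] compares the Euclidean weight with [wt ^+ 2]. *)
Lemma dist_g_le (mu mu' nu : probability 'cV[R]_n R) (e B : R) :
  mclose wt2 e mu nu -> mclose wt2 e mu' nu -> (\int[nu]_v (wt v ^+ 2)%:E <= B%:E)%E ->
  (dist_g mu mu' <= (4 * (1 + n%:R ^+ 2) * e)%:E)%E.
Proof.
move=> cl cl' nuB; apply: ge_ereal_sup => _ [f [mf fg] <-].
have K0 : 0 < 1 + n%:R ^+ 2 :> R by rewrite ltr_wpDr ?sqr_ge0.
have fw x : `|f x| <= (1 + n%:R ^+ 2) * wt x ^+ 2.
  rewrite (le_trans (fg x))// mulrDl mul1r lerD//.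
    by rewrite exprn_ege1// wt_ge1.
  rewrite -exprMn lerXn2r ?nnegrE ?enorm_ge0 ?mulr_ge0 ?wt_ge0//.
  by rewrite (le_trans (enorm_le x))// ler_wpM2l// /wt lerDr.
have [x [y [-> yE xy _]]] := signed_close cl K0 (@measurable_wt2 R n) (@wt2_ge0 R n) nuB mf fw.
have [x' [y' [-> y'E xy' _]]] :=
  signed_close cl' K0 (@measurable_wt2 R n) (@wt2_ge0 R n) nuB mf fw.
have yy : y = y' by apply: EFin_inj; rewrite -yE -y'E.
rewrite -EFinB abse_EFin lee_fin.
rewrite (_ : x - x' = (x - y) - (x' - y')); last by rewrite yy opprB addrA subrK.
rewrite (le_trans (ler_normB _ _))// (le_trans (lerD xy xy'))//.
rewrite le_eqVlt; apply/orP; left; apply/eqP; ring.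
Qed.

End main.

Theorem theorem2p3 (R : realType) (du dy : nat)
  (du_gt0 : (0 < du)%N) (dy_gt0 : (0 < dy)%N) :
  let q := (2 * maxn (3 + du) (4 + dy))%N in
  exists C : \bar R -> R -> R -> R -> R -> 'M[R]_du -> 'M[R]_dy -> nat -> R,
  forall (J : nat) (ydag : nat -> 'cV[R]_dy)
    (Sigma : 'M[R]_du) (Gamma : 'M[R]_dy)
    (kappa_y sigma gamma kappa_Psi kappa_h ell_h : R)
    (Psi0 : 'cV[R]_du -> 'cV[R]_du) (h0 : 'cV[R]_du -> 'cV[R]_dy)
    (mu0 : probability 'cV[R]_du R),
  (1 <= J)%N ->
  posdefmx Sigma -> posdefmx Gamma ->
  0 < kappa_y -> 0 < sigma -> 0 < gamma ->
  0 < kappa_Psi -> 0 < kappa_h -> 0 < ell_h ->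
  (forall j, (1 <= j <= J)%N -> enorm (ydag j) <= kappa_y) ->
  lemx sigma%:M Sigma -> lemx gamma%:M Gamma ->
  affine_map Psi0 -> affine_map h0 ->
  (forall u, enorm (Psi0 u) <= kappa_Psi * (1 + enorm u)) ->
  (forall u, enorm (h0 u) <= kappa_h * (1 + enorm u)) ->
  is_gaussian mu0 ->
  forall (eps : R) (Psi : 'cV[R]_du -> 'cV[R]_du) (h : 'cV[R]_du -> 'cV[R]_dy),
  0 <= eps <= 1 ->
  measurable_fun setT Psi -> measurable_fun setT h ->
  (Psi, h) \in linf_ball (Psi0, h0) eps ->
  elipschitz ell_h h ->
  (dist_g (filter_law_EK Sigma Gamma Psi h ydag mu0 J)
          (filter_law Sigma Gamma Psi h ydag mu0 J)
   <= (C (moment q mu0) kappa_y kappa_Psi kappa_h ell_h Sigma Gamma J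
       * eps)%:E)%E.
Proof.
move=> q.
pose k := maxn (3 + du) (4 + dy).
have k2 : (2 <= k)%N by rewrite leq_max.
(* The theorem asks for a function [C] that precedes all hypotheses on its arguments: [bound] gives
   its value at each tuple of parameters, and [cid] assembles the function. *)
suff bound (M : \bar R) (ky kP kh : R) (S : 'M[R]_du) (G : 'M[R]_dy) (J : nat) :
  exists C : R, posdefmx S -> posdefmx G -> 0 < ky -> 0 < kP -> 0 < kh ->
  forall (ydag : nat -> 'cV[R]_dy) (Psi0 : 'cV[R]_du -> 'cV[R]_du)
    (h0 : 'cV[R]_du -> 'cV[R]_dy) (mu0 : probability 'cV[R]_du R) (eps : R)
    (Psi : 'cV[R]_du -> 'cV[R]_du) (h : 'cV[R]_du -> 'cV[R]_dy),
  moment (2 * k) mu0 = M -> (forall j, (1 <= j <= J)%N -> enorm (ydag j) <= ky) ->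
  affine_map Psi0 -> affine_map h0 ->
  (forall u, enorm (Psi0 u) <= kP * (1 + enorm u)) ->
  (forall u, enorm (h0 u) <= kh * (1 + enorm u)) ->
  is_gaussian mu0 -> 0 <= eps <= 1 -> measurable_fun setT Psi -> measurable_fun setT h ->
  (Psi, h) \in linf_ball (Psi0, h0) eps ->
  (dist_g (filter_law_EK S G Psi h ydag mu0 J) (filter_law S G Psi h ydag mu0 J) <=
    (C * eps)%:E)%E.
  exists (fun M ky kP kh _ S G J => sval (cid (bound M ky kP kh S G J))).
  move=> J ydag S G ky sigma gamma kP kh lh Psi0 h0 mu0 _ pS pG ky0 _ _ kP0 kh0 _ yk _ _.
  move=> aP ah gP gh gm eps Psi h e01 mP mh ball _.
  exact (svalP (cid (bound (moment q mu0) ky kP kh S G J)) pS pG ky0 kP0 kh0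
    ydag Psi0 h0 mu0 eps Psi h erefl yk aP ah gP gh gm e01 mP mh ball).
(* At inadmissible parameters the premises of [bound] are contradictory, and the value 0 serves. *)
have [[pS [pG [ky0 [kP0 kh0]]]]|neg] := pselect (posdefmx S /\ posdefmx G /\ 0 < ky /\ 0 < kP /\ 0 < kh); last first.
  by exists 0 => pS pG ky0 kP0 kh0; case: neg.
have [C C0 CP] := filter_bound pS pG k2 M (ltW ky0) (ltW kP0) (ltW kh0) J.
exists (4 * (1 + du%:R ^+ 2) * C) => _ _ _ _ _.
move=> ydag Psi0 h0 mu0 eps Psi h ME yk [A [a PE]] [H [b hE]] gP gh gm e01 mP mh ball.
have [PP hh] := linf_ballP ball.
have gP' u : enorm (A *m u + a) <= kP * (1 + enorm u) by rewrite -PE.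
have gh' u : enorm (H *m u + b) <= kh * (1 + enorm u) by rewrite -hE.
have PP' v : `|Psi v - (A *m v + a)| <= eps by rewrite -PE; exact: PP.
have hh' v : `|h v - (H *m v + b)| <= eps by rewrite -hE; exact: hh.
have [nu [cl clE nuB _]] := CP ydag A a H b mu0 eps Psi h ME yk gP' gh' gm e01 mP mh PP' hh'.
rewrite -mulrA; exact (dist_g_le clE cl (int_wt2_le nuB)).
Qed.
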